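(* Let $S^{(1)},S^{(2)}\in\operatorname{Sp}(2n,\mathbb{R})$ with block forms $S^{(p)}=\begin{pmatrix}A^{(p)}&B^{(p)}\\ C^{(p)}&D^{(p)}\end{pmatrix}$, $p=1,2$, such that $D^{(1,2)}=\begin{pmatrix}A^{(1)}&B^{(1)}\\ A^{(2)}&B^{(2)}\end{pmatrix}$ is invertible, and let $\widehat{S^{(1)}},\widehat{S^{(2)}}$ be metaplectic operators projecting onto $S^{(1)},S^{(2)}$. Let $f\in\mathcal{S}(\mathbb{R}^n)$. Then: 1. $\displaystyle\int_{\mathbb{R}^n}\int_{\mathbb{R}^n}x^\alpha\,W_\vartheta f(x,\xi)\,dx\,d\xi=\int_{\mathbb{R}^n}x^\alpha\,|(\widehat{S^{(1)}}f)(x)|^2\,dx$ for all multi-indices $\alpha\in\mathbb{N}_0^n$ with $|\alpha|>0$. 2. $\displaystyle\int_{\mathbb{R}^n}\int_{\mathbb{R}^n}\xi^\alpha\,W_\vartheta f(x,\xi)\,dx\,d\xi=\int_{\mathbb{R}^n}\xi^\alpha\,|(\widehat{S^{(2)}}f)(\xi)|^2\,d\xi$ for all multi-indices $\alpha\in\mathbb{N}_0^n$ with $|\alpha|>0$. 3. $\displaystyle\int_{\mathbb{R}^n}W_\vartheta f(x,\xi)\,d\xi=|(\widehat{S^{(1)}}f)(x)|^2$ for all $x\in\mathbb{R}^n$. 4. $\displaystyle\int_{\mathbb{R}^n}W_\vartheta f(x,\xi)\,dx=|(\widehat{S^{(2)}}f)(\xi)|^2$ for all $\xi\in\mathbb{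R}^n$.
   Context: $J=\begin{pmatrix}0&I_n\\ -I_n&0\end{pmatrix}$, and $\operatorname{Sp}(2n,\mathbb{R})$ is the group of real $2n\times2n$ matrices $S$ with $S^TJS=J$. Write $S=\begin{pmatrix}A&B\\ C&D\end{pmatrix}$ with $n\times n$ blocks; $S$ is called free if $\det B\ne 0$. Metaplectic operators: to each $S\in\operatorname{Sp}(2n,\mathbb{R})$ correspond two unitary operators $\pm\widehat S$ on $L^2(\mathbb{R}^n)$ (they ''project onto $S$''), which map $\mathcal{S}(\mathbb{R}^n)$ to itself. For $S$ free, $$(\widehat S f)(\xi)=\frac{c}{\sqrt{|\det B|}}\int_{\mathbb{R}^n}f(x)\,e^{i\pi(\xi\cdot DB^{-1}\xi+x\cdot B^{-1}Ax)-2\pi i\,x\cdot B^{-1}\xi}\,dx,\qquad f\in\mathcal{S}(\mathbb{R}^n),$$ with $c$ a constant of modulus $1$ (fixed up to sign). Every $S\in\operatorname{Sp}(2n,\mathbb{R})$ is a product $S=S_1S_2$ of two free symplectic matrices, and $\widehat S=\pm\widehat{S_1}\widehat{S_2}$. Only $|\widehat S f|$ matters here. Wigner function: $W_\sigma f(x,\xi)=\int_{\mathbb{R}^n}f(x+\frac y2)\overline{f(x-\frac y2)}\,e^{-2i\pi\xi\cdot y}\,dy$; it satisfies $W_\sigma(\widehat Sf)(z)=W_\sigma f(S^{-1}z)$. With $\Omega=D^{(1,2)}J(D^{(1,2)})^T$ and $\vartheta(z,z')=z\cdot\Omega^{-1}z'$, the $\vartheta$-Wigner function is $$W_\vartheta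 f(z)=\frac{1}{\sqrt{\det\Omega}}\,W_\sigma f\left((D^{(1,2)})^{-1}z\right),\quad z=(x,\xi)\in\mathbb{R}^{2n},\qquad \sqrt{\det\Omega}=|\det D^{(1,2)}| .$$ *)

(* Defs.v *)
From HB Require Import structures.
From mathcomp Require Import all_boot all_order all_algebra.
From mathcomp Require Import complex.
From mathcomp Require Import all_classical all_reals all_analysis.

Set Implicit Arguments.
Unset Strict Implicit.
Unset Printing Implicit Defensive.

Import Order.TTheory GRing.Theory Num.Theory.
Import numFieldNormedType.Exports.

Local Open Scope classical_set_scope.
Local Open Scope ring_scope.
Local Open Scope complex_scope.

(* Lebesgue measure on R^n: the n-fold product of [lebesgue_measure], carried
   by [n.-tuple R] with the product (= Borel) sigma-algebra.  At rank n.+1 it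
   is the image of the binary product measure under (a, t) |-> a :: t. *)
Section LebesgueTuple.
Context (R : realType).

Definition consT n (p : R * n.-tuple R) : n.+1.-tuple R :=
  [the n.+1.-tuple R of p.1 :: p.2].

Lemma measurable_consT n : measurable_fun setT (@consT n).
Proof. exact: measurable_cons measurable_fst measurable_snd. Qed.

Section Step.
Variables (n : nat) (m : {sigma_finite_measure set (n.-tuple R) -> \bar R}).

Definition lebesgue_cons : set (n.+1.-tuple R) -> \bar R :=
  pushforward (lebesgue_measure \x m)%E (@consT n).

Let lebesgue_cons0 : lebesgue_cons set0 = 0%E.
Proof. by rewrite /lebesgue_cons /pushforward preimage_set0 measure0. Qed.

Let lebesgue_cons_ge0 A : (0 <= lebesgue_cons A)%E.
Proof. by apply: (@measure_ge0 _ _ _ (lebesgue_measure \x m)%E). Qed.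

Let lebesgue_cons_sigma_additive : semi_sigma_additive lebesgue_cons.
Proof.
move=> F mF tF mUF; rewrite /lebesgue_cons /pushforward preimage_bigcup.
have mpre B : measurable B -> measurable (@consT n @^-1` B).
  by move=> mB; rewrite -[X in measurable X]setTI; exact: measurable_consT.
apply: measure_semi_sigma_additive.
- by move=> k; exact: mpre.
- apply/trivIsetP => /= i j _ _ ij; rewrite -preimage_setI.
  by move/trivIsetP : tF => /(_ _ _ _ _ ij) ->//; rewrite preimage_set0.
- by rewrite -preimage_bigcup; exact: mpre.
Qed.

HB.instance Definition _ := isMeasure.Build _ _ _ lebesgue_cons
  lebesgue_cons0 lebesgue_cons_ge0 lebesgue_cons_sigma_additive.

Let lebesgue_cons_sigma_finite : sigma_finite setT lebesgue_cons.
Proof.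
have /sigma_finiteP[F [TF ndF Foo]] := sigma_finiteT (@lebesgue_measure R).
have /sigma_finiteP[G [TG ndG Goo]] := sigma_finiteT m.
pose g (t : n.+1.-tuple R) : R * n.-tuple R :=
  (thead t, [tuple of behead t]).
have gK : cancel (@consT n) g by move=> [a t]; congr (_, _); exact: val_inj.
have mg : measurable_fun setT g.
  apply: measurable_fun_pair; last exact: measurable_behead.
  exact: (@measurable_tnth _ _ _ ord0).
exists (fun k => g @^-1` (F k `*` G k)).
  rewrite -preimage_bigcup; apply/esym; rewrite -subTset => t _ /=.
  have [k _ Fk] : (\bigcup_k F k) (thead t) by rewrite -TF.
  have [l _ Gl] : (\bigcup_k G k) [tuple of behead t] by rewrite -TG.
  exists (maxn k l) => //; split => /=.
  - by move: Fk; exact/subsetPset/ndF/leq_maxl.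
  - by move: Gl; exact/subsetPset/ndG/leq_maxr.
move=> k; have [mFk Fk] := Foo k; have [mGk Gk] := Goo k; split.
  by rewrite -[X in measurable X]setTI; apply: mg => //; exact: measurableX.
rewrite /lebesgue_cons /pushforward -comp_preimage.
rewrite (_ : g \o @consT n = idfun); last by apply/funext => p /=; rewrite gK.
by rewrite preimage_id product_measure1E// lte_mul_pinfty// ge0_fin_numE.
Qed.

HB.instance Definition _ := Measure_isSigmaFinite.Build _ _ _ lebesgue_cons
  lebesgue_cons_sigma_finite.

End Step.

Fixpoint lebesgue_tuple n : {sigma_finite_measure set (n.-tuple R) -> \bar R} :=
  match n with
  | 0 => \d_([tuple] : 0.-tuple R)
  | k.+1 => lebesgue_cons (lebesgue_tuple k)
  end.

End LebesgueTuple.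

Section ComplexIntegral.
Context d (T : measurableType d) (R : realType).
Variable mu : {measure set T -> \bar R}.
Implicit Type F : T -> R[i].

Definition Cintegrable F :=
  mu.-integrable setT (fun t => (complex.Re (F t))%:E) /\
  mu.-integrable setT (fun t => (complex.Im (F t))%:E).

Definition Cintegral F : R[i] :=
  (\int[mu]_t complex.Re (F t)) +i* (\int[mu]_t complex.Im (F t)).

(* The Lebesgue integral is a total function in the library, with a junk
   value on non-integrable functions; [has_Cintegral F v] is the assertion
   that F is absolutely integrable with integral v. *)
Definition has_Cintegral F v := Cintegrable F /\ Cintegral F = v.

End ComplexIntegral.

Section EuclideanSpace.
Context (R : realType) (n : nat).
Implicit Types (x y : 'cV[R]_n) (alpha : 'I_n -> nat).

Definition cvec (t : n.-tuple R) : 'cV[R]_n := \col_i tnth t i.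

Definition dotv x y : R := (x^T *m y) 0 0.

Definition mpow x alpha : R := \prod_(i < n) x i 0 ^+ alpha i.

Definition msize alpha : nat := (\sum_(i < n) alpha i)%N.

Definition intRn (F : 'cV[R]_n -> R[i]) : R[i] :=
  Cintegral (lebesgue_tuple R n) (fun t => F (cvec t)).

Definition has_intRn (F : 'cV[R]_n -> R[i]) (v : R[i]) : Prop :=
  has_Cintegral (lebesgue_tuple R n) (fun t => F (cvec t)) v.

(* Integral over R^n x R^n = R^(2n), with respect to the product measure. *)
Definition has_intRnRn (F : 'cV[R]_n -> 'cV[R]_n -> R[i]) (v : R[i]) : Prop :=
  has_Cintegral (lebesgue_tuple R n \x lebesgue_tuple R n)%E
    (fun p => F (cvec p.1) (cvec p.2)) v.

Definition expi (t : R) : R[i] := cos t +i* sin t.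

(* Partial derivatives are iterated along a list of coordinates, so that all
   mixed partials of all orders are covered without presupposing that they
   commute. *)
Definition partials (s : seq 'I_n) (g : 'cV[R]_n -> R) : 'cV[R]_n -> R :=
  foldr (fun i h x => 'D_(delta_mx i 0) h x) g s.

Definition smooth (g : 'cV[R]_n -> R) :=
  forall s : seq 'I_n, continuous (partials s g) /\
    forall (i : 'I_n) x, derivable (partials s g) x (delta_mx i 0).

Definition rapidly_decreasing (g : 'cV[R]_n -> R) :=
  forall alpha (s : seq 'I_n), exists M : R,
    forall x, `|mpow x alpha * partials s g x| <= M.

Definition schwartz (f : 'cV[R]_n -> R[i]) :=
  let re x := complex.Re (f x) in
  let im x := complex.Im (f x) in
  [/\ smooth re, rapidly_decreasing re, smooth im & rapidly_decreasing im].

End EuclideanSpace.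

Section Symplectic.
Context (R : realType) (n : nat).
Implicit Type S : 'M[R]_(n + n).

Definition Jmx : 'M[R]_(n + n) := block_mx 0 1%:M (- 1%:M) 0.

Definition symplectic S := S^T *m Jmx *m S = Jmx.

Definition blkA S : 'M[R]_n := ulsubmx S.
Definition blkB S : 'M[R]_n := ursubmx S.
Definition blkC S : 'M[R]_n := dlsubmx S.
Definition blkD S : 'M[R]_n := drsubmx S.

Definition free_symplectic S := symplectic S /\ \det (blkB S) != 0.

End Symplectic.

Section Metaplectic.
Context (R : realType) (n : nat).
Implicit Types (S : 'M[R]_(n + n)) (f : 'cV[R]_n -> R[i]).

Local Notation operator := (('cV[R]_n -> R[i]) -> 'cV[R]_n -> R[i]).
Implicit Type T : operator.

Definition quad_fourier S (c : R[i]) f (xi : 'cV[R]_n) : R[i] :=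
  let A := blkA S in let D := blkD S in
  let B := blkB S in let Bi := invmx B in
  c / (Num.sqrt `|\det B|)%:C *
  intRn (fun x => f x *
    expi (pi * (dotv xi (D *m Bi *m xi) + dotv x (Bi *m A *m x))
          - 2 * pi * dotv x (Bi *m xi))).

(* The unimodular constant is c = i^(m - n/2), where m is even if det B > 0
   and odd if det B < 0 (Maslov index); equivalently
   c^2 = sgn(det B) (-i)^n, which fixes c up to sign. *)
Definition metaplectic_free S T :=
  exists c : R[i], c ^+ 2 = (Num.sg (\det (blkB S)))%:C * (- 'i%C) ^+ n /\
    forall f, schwartz f -> forall xi, T f xi = quad_fourier S c f xi.

(* T is one of the two metaplectic operators projecting onto S.  Operators are
   total maps on functions, but only their action on Schwartz functions, which
   determines the unitary operator on L^2 by density, is constrained; there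
   the values T f are the smooth representatives, so pointwise evaluation is
   meaningful.  The ambiguity of sign is in the constants c. *)
Definition metaplectic S T :=
  (free_symplectic S /\ metaplectic_free S T) \/
  exists (S1 S2 : 'M[R]_(n + n)) (T1 T2 : operator),
    [/\ free_symplectic S1 /\ metaplectic_free S1 T1,
        free_symplectic S2 /\ metaplectic_free S2 T2,
        S = S1 *m S2 &
        forall f, schwartz f -> forall xi, T f xi = T1 (T2 f) xi].

End Metaplectic.

Section Wigner.
Context (R : realType) (n : nat).
Implicit Types (f : 'cV[R]_n -> R[i]) (z : 'cV[R]_(n + n)).

Definition wigner f z : R[i] :=
  let x := usubmx z in let xi := dsubmx z in
  intRn (fun y => f (x + 2^-1 *: y) * conjc (f (x - 2^-1 *: y)) *
                  expi (- (2 * pi * dotv xi y))).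

Definition D12 (S1 S2 : 'M[R]_(n + n)) : 'M[R]_(n + n) :=
  block_mx (blkA S1) (blkB S1) (blkA S2) (blkB S2).

Definition Omega (D : 'M[R]_(n + n)) : 'M[R]_(n + n) := D *m Jmx R n *m D^T.

(* The theta-Wigner function attached to D = D12 S1 S2; here theta is the
   bilinear form z . Omega(D)^-1 z'. *)
Definition wigner_theta (D : 'M[R]_(n + n)) f z : R[i] :=
  ((Num.sqrt (\det (Omega D)))^-1)%:C * wigner f (invmx D *m z).

End Wigner.

(* Main.v *)
Require Import Defs.
From mathcomp Require Import all_boot all_order all_algebra.
From mathcomp Require Import complex.
From mathcomp Require Import all_classical all_reals all_analysis.
From mathcomp Require Import measurable_realfun.
From mathcomp Require Import ring lra.

(** The theta-Wigner function is the Wigner function of [f] read in the coordinates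
    [(x, xi) = D w], where the first [n] rows of [D] are those of [S1] and the last [n]
    are the first rows of [S2]. The Wigner function is covariant under metaplectic
    operators: the value of the Wigner function of [f] at [w] is that of the Wigner
    function of [T1 f] at [S1 w] ([metaplectic_covariant]). Now [S1 w] has first
    component [x], and its second component is, for [x] fixed, an affine function of
    [xi] whose Jacobian is the normalising factor of the theta-Wigner function
    ([theta_shear_left]). Thus on each fibre [x = const] the theta-Wigner function is
    an affine image of the Wigner function of [T1 f], whose integral over the
    frequency is the squared modulus of [T1 f] at [x] by Fourier inversion
    ([sheared_marginal]). Since [S2 w] has first component [xi], the other marginal is
    the same statement with the two variables exchanged. The moments follow by
    Fubini's theorem, as the Wigner function of a Schwartz function decays rapidly in
    both variables ([cross_wigner_weight], [sheared_moment]).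

    Covariance is stable under composition, so it suffices to have it for a free
    symplectic matrix. The integral formula is then a composition of a quadratic phase,
    the Fourier transform, a linear change of variables and another quadratic phase. The
    phases shear the frequency, the change of variables is immediate, and for the
    Fourier transform covariance is Parseval's identity ([wigner_fourier]). As the
    operators are only prescribed on Schwartz functions, each of these steps also has
    to preserve the Schwartz space.

    The analysis behind this is developed from Fubini's theorem and dominated
    convergence. Changes of variables for invertible matrices come from a
    factorisation into block triangular matrices, by induction on the dimension
    ([ge0_integral_linear]). Closure properties of the Schwartz space are proved
    coinductively: a class of rapidly decreasing functions closed under partial
    derivatives consists of Schwartz functions ([stable_schwartz]). That the integral
    of a derivative vanishes follows from translation invariance ([intRn_pderiv]).
    Inversion is obtained by Abel summation, with an exponential factor whose
    transform is the Poisson kernel ([fourier_inversion0]), and the decay of the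
    Wigner function from its polarised form being stable under multiplication by
    position and frequency coordinates ([wigner_span]). *)

Set Implicit Arguments.
Unset Strict Implicit.
Unset Printing Implicit Defensive.

Import Order.TTheory GRing.Theory Num.Theory.
Import numFieldNormedType.Exports.

Local Open Scope classical_set_scope.
Local Open Scope ring_scope.
Local Open Scope complex_scope.

(** * The taxicab norm and complex exponentials *)
Section Norm1.
Context (R : realType).
Implicit Types z w : R[i].

(** Every estimate below is up to a constant, so the modulus may be replaced by
    this equivalent norm: it is submultiplicative, splits over the real and
    imaginary parts as the integral does, and contains no square root. *)
Definition norm1c z : R := `|complex.Re z| + `|complex.Im z|.

Lemma norm1c_ge0 z : 0 <= norm1c z.
Proof. by rewrite addr_ge0. Qed.

Lemma ReD z w : complex.Re (z + w) = complex.Re z + complex.Re w.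
Proof. by case: z => ? ?; case: w. Qed.

Lemma ImD z w : complex.Im (z + w) = complex.Im z + complex.Im w.
Proof. by case: z => ? ?; case: w. Qed.

Lemma ReN z : complex.Re (- z) = - complex.Re z.
Proof. by case: z. Qed.

Lemma ImN z : complex.Im (- z) = - complex.Im z.
Proof. by case: z. Qed.

Lemma ReM z w : complex.Re (z * w) =
  complex.Re z * complex.Re w - complex.Im z * complex.Im w.
Proof. by case: z => ? ?; case: w. Qed.

Lemma ImM z w : complex.Im (z * w) =
  complex.Re z * complex.Im w + complex.Im z * complex.Re w.
Proof. by case: z => ? ?; case: w. Qed.

Lemma Re_conjc z : complex.Re (conjc z) = complex.Re z.
Proof. by case: z. Qed.

Lemma Im_conjc z : complex.Im (conjc z) = - complex.Im z.
Proof. by case: z. Qed.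

Lemma complex_ext z w :
  complex.Re z = complex.Re w -> complex.Im z = complex.Im w -> z = w.
Proof. by case: z => ? ?; case: w => ? ? /= -> ->. Qed.

Lemma norm1cD z w : norm1c (z + w) <= norm1c z + norm1c w.
Proof.
rewrite /norm1c ReD ImD addrACA; apply: lerD; exact: ler_normD.
Qed.

Lemma norm1cM z w : norm1c (z * w) <= norm1c z * norm1c w.
Proof.
rewrite /norm1c ReM ImM mulrDl !mulrDr.
apply: le_trans (lerD (ler_normB _ _) (ler_normD _ _)) _.
by rewrite !normrM; lra.
Qed.

Lemma norm1cN z : norm1c (- z) = norm1c z.
Proof. by rewrite /norm1c ReN ImN !normrN. Qed.

Lemma norm1c_conj z : norm1c (conjc z) = norm1c z.
Proof. by rewrite /norm1c Re_conjc Im_conjc normrN. Qed.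

Lemma norm1c_real (r : R) : norm1c r%:C = `|r|.
Proof. by rewrite /norm1c /= normr0 addr0. Qed.

Lemma norm1cMr (r : R) z : norm1c (r%:C * z) = `|r| * norm1c z.
Proof. by rewrite /norm1c ReM ImM /= !mul0r subr0 addr0 mulrDr !normrM. Qed.

Lemma Re_le_norm1c z : `|complex.Re z| <= norm1c z.
Proof. by rewrite /norm1c lerDl. Qed.

Lemma Im_le_norm1c z : `|complex.Im z| <= norm1c z.
Proof. by rewrite /norm1c lerDr. Qed.

Lemma norm1c_eq0 z : norm1c z <= 0 -> z = 0.
Proof.
move=> h; have := Re_le_norm1c z; have := Im_le_norm1c z => h1 h2.
apply: complex_ext => /=; apply/eqP; rewrite -normr_le0.
  exact: le_trans h2 h.
exact: le_trans h1 h.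
Qed.

Lemma expiD (a b : R) : expi (a + b) = expi a * expi b.
Proof. by apply: complex_ext; rewrite ?ReM ?ImM /= ?cosD ?sinD//; ring. Qed.

Lemma expi0 : expi (0 : R) = 1.
Proof. by rewrite /expi cos0 sin0. Qed.

Lemma expiN (a : R) : expi (- a) = conjc (expi a).
Proof. by rewrite /expi /= cosN sinN. Qed.

Lemma expi_sum n (a : 'I_n -> R) :
  expi (\sum_(i < n) a i) = \prod_(i < n) expi (a i).
Proof.
by apply: (big_morph (@expi R)); [exact: expiD|exact: expi0].
Qed.

Lemma norm1c_expi (a : R) : norm1c (expi a) <= 2.
Proof.
rewrite /norm1c /= -[2]/(1 + 1); apply: lerD.
  by rewrite ler_norml cos_geN1 cos_le1.
by rewrite ler_norml sin_geN1 sin_le1.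
Qed.

Lemma le_sin_abs (a : R) : `|sin a| <= `|a|.
Proof.
have [c _] := @MVT_segment R sin cos 0 `|a| (normr_ge0 _)
  (fun x _ => is_derive_sin x) (continuous_subspaceT (@continuous_sin R)).
rewrite sin0 !subr0 => e.
have -> : `|sin a| = `|sin `|a| |.
  by have [h|h] := leP 0 a; [rewrite (ger0_norm h) | rewrite (ltr0_norm h) sinN normrN].
by rewrite e normrM normr_id ler_piMl// ler_norml cos_geN1 cos_le1.
Qed.

Lemma le_1cos (a : R) : `|cos a - 1| <= a ^+ 2.
Proof.
have [c cI] := @MVT_segment R cos (fun x => - sin x) 0 `|a| (normr_ge0 _)
  (fun x _ => is_derive_cos x) (continuous_subspaceT (@continuous_cos R)).
rewrite cos0 subr0 => e.
have -> : cos a = cos `|a|.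
  by have [h|h] := leP 0 a; [rewrite (ger0_norm h) | rewrite (ltr0_norm h) cosN].
rewrite e normrM normrN normr_id -[a ^+ 2]real_normK ?num_real// expr2 ler_wpM2r//.
apply: le_trans (le_sin_abs _) _.
by move: cI; rewrite in_itv /= => /andP[c0 ca]; rewrite ger0_norm.
Qed.

Lemma le_sinB (a : R) : `|sin a - a| <= `|a| ^+ 3.
Proof.
have [c cI] := @MVT_segment R (fun x => sin x - x) (fun x => cos x - 1) 0 `|a|
  (normr_ge0 _) (fun x _ => is_deriveB (is_derive_sin x) (is_derive_id x 1))
  (continuous_subspaceT (fun x => cvgB (@continuous_sin R x) cvg_id)).
rewrite sin0 !subr0 => e.
have -> : `|sin a - a| = `|sin `|a| - `|a| |.
  have [h|h] := leP 0 a; first by rewrite (ger0_norm h).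
  by rewrite (ltr0_norm h) sinN -opprD normrN.
rewrite e normrM normr_id exprSr ler_wpM2r//.
apply: le_trans (le_1cos _) _.
move: cI; rewrite in_itv /= => /andP[c0 ca].
by rewrite ler_sqr ?nnegrE.
Qed.

(** For small [a] this is the mean value theorem; for [`|a| > 1] the left member
    is at most 3 anyway. The next bound is obtained in the same way. *)
Lemma expi_lipschitz (a : R) : norm1c (expi a - 1) <= 3 * `|a|.
Proof.
have [a1|a1] := leP `|a| 1.
  rewrite /norm1c ReD ImD ReN ImN /= subr0.
  have h1 := le_1cos a; have h2 := le_sin_abs a.
  have : a ^+ 2 <= `|a|.
    by rewrite -real_normK ?num_real// expr2 ler_piMl.
  have := normr_ge0 a; lra.
apply: le_trans (norm1cD _ _) _; rewrite norm1cN norm1c_real normr1.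
have := norm1c_expi a; lra.
Qed.

Lemma expi_taylor (a : R) : norm1c (expi a - 1 - (a *i)) <= 4 * a ^+ 2.
Proof.
rewrite -[a ^+ 2]real_normK ?num_real//.
have [a1|a1] := leP `|a| 1.
  rewrite /norm1c !ReD !ImD !ReN !ImN /= !subr0.
  have h1 := le_1cos a; have h2 := le_sinB a.
  have : `|a| ^+ 3 <= `|a| ^+ 2 by rewrite exprS ler_piMl// exprn_ge0.
  move: h1; rewrite -[a ^+ 2]real_normK ?num_real//.
  by have := sqr_ge0 `|a|; lra.
apply: le_trans (norm1cD _ _) _; rewrite norm1cN.
have -> : norm1c (a *i) = `|a| by rewrite /norm1c /= normr0 add0r.
apply: le_trans (lerD (norm1cD _ _) (lexx _)) _; rewrite norm1cN norm1c_real normr1.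
have := norm1c_expi a; have : `|a| <= `|a| ^+ 2 by rewrite expr2 ler_peMl// ltW.
lra.
Qed.

End Norm1.

(** * Integrals of complex-valued functions *)

Section CIntegralTheory.
Context d (T : measurableType d) (R : realType).
Implicit Types F G : T -> R[i].

Definition Cmeasurable F :=
  measurable_fun setT (fun t => complex.Re (F t)) /\
  measurable_fun setT (fun t => complex.Im (F t)).

Lemma Cmeasurable_cst (c : R[i]) : Cmeasurable (fun=> c).
Proof. by split; exact: measurable_cst. Qed.

Lemma CmeasurableM F G :
  Cmeasurable F -> Cmeasurable G -> Cmeasurable (fun t => F t * G t).
Proof.
move=> [F1 F2] [G1 G2]; split.
  by under eq_fun do rewrite ReM; apply: measurable_funB; exact: measurable_funM.
by under eq_fun do rewrite ImM; apply: measurable_funD; exact: measurable_funM.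
Qed.

Lemma Cmeasurable_conj F : Cmeasurable F -> Cmeasurable (fun t => conjc (F t)).
Proof.
move=> [F1 F2]; split.
  by under eq_fun do rewrite Re_conjc.
by under eq_fun do rewrite Im_conjc; exact: measurableT_comp.
Qed.

Lemma Cmeasurable_expi (h : T -> R) :
  measurable_fun setT h -> Cmeasurable (fun t => expi (h t)).
Proof.
move=> mh; split => /=.
  by apply: measurableT_comp => //; apply: continuous_measurable_fun; exact: continuous_cos.
by apply: measurableT_comp => //; apply: continuous_measurable_fun; exact: continuous_sin.
Qed.

Lemma Cmeasurable_real (h : T -> R) :
  measurable_fun setT h -> Cmeasurable (fun t => (h t)%:C).
Proof. by move=> mh; split => //=; exact: measurable_cst. Qed.

Lemma Cmeasurable_prod (I : finType) (F : I -> T -> R[i]) :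
  (forall i, Cmeasurable (F i)) -> Cmeasurable (fun t => \prod_i F i t).
Proof.
move=> mF; elim: (index_enum I) => [|i s ih].
  by under eq_fun do rewrite big_nil; exact: Cmeasurable_cst.
by under eq_fun do rewrite big_cons; exact: CmeasurableM.
Qed.

Variable mu : {measure set T -> \bar R}.

Lemma Cintegrable_measurable F : Cintegrable mu F -> Cmeasurable F.
Proof.
by move=> [F1 F2]; split; apply/measurable_EFinP; exact: (measurable_int mu).
Qed.

Lemma Cintegrable_dominated F (g : T -> R) : Cmeasurable F ->
  mu.-integrable setT (EFin \o g) -> (forall t, norm1c (F t) <= g t) ->
  Cintegrable mu F.
Proof.
move=> [F1 F2] ig Fg; split; apply: (le_integrable _ _ _ ig) => //=;
  try exact/measurable_EFinP; move=> t _; rewrite lee_fin.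
  by apply: le_trans (Re_le_norm1c _) _; apply: le_trans (Fg t) (ler_norm _).
by apply: le_trans (Im_le_norm1c _) _; apply: le_trans (Fg t) (ler_norm _).
Qed.

Lemma integrable_norm1c F : Cintegrable mu F ->
  mu.-integrable setT (EFin \o (fun t => norm1c (F t))).
Proof.
move=> [F1 F2].
by apply: (integrableD _ (integrable_norm F1) (integrable_norm F2)).
Qed.

Lemma CintegrableD F G : Cintegrable mu F -> Cintegrable mu G ->
  Cintegrable mu (fun t => F t + G t).
Proof.
move=> [F1 F2] [G1 G2]; split.
  by under eq_fun do rewrite ReD EFinD; exact: integrableD.
by under eq_fun do rewrite ImD EFinD; exact: integrableD.
Qed.

Lemma CintegralD F G : Cintegrable mu F -> Cintegrable mu G ->
  Cintegral mu (fun t => F t + G t) = Cintegral mu F + Cintegral mu G.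
Proof.
move=> [F1 F2] [G1 G2]; apply: complex_ext; rewrite ?ReD ?ImD /=.
  by under eq_Rintegral do rewrite ReD; rewrite RintegralD.
by under eq_Rintegral do rewrite ImD; rewrite RintegralD.
Qed.

Lemma CintegrableZ (c : R[i]) F : Cintegrable mu F ->
  Cintegrable mu (fun t => c * F t).
Proof.
move=> iF; have mF := Cintegrable_measurable iF.
apply: (@Cintegrable_dominated _ (fun t => norm1c c * norm1c (F t))).
- exact: CmeasurableM (Cmeasurable_cst _) mF.
- by apply: eq_integrable (integrableZl _ (norm1c c) (integrable_norm1c iF)).
- by move=> t; exact: norm1cM.
Qed.

Lemma CintegralZ (c : R[i]) F : Cintegrable mu F ->
  Cintegral mu (fun t => c * F t) = c * Cintegral mu F.
Proof.
move=> [F1 F2]; case: c => a b.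
have h r (g : T -> R) : mu.-integrable setT (EFin \o g) ->
    mu.-integrable setT (EFin \o (fun t => r * g t)).
  by move=> ig; apply: eq_integrable (integrableZl _ r ig).
apply: complex_ext; rewrite ?ReM ?ImM /=.
  under eq_Rintegral do rewrite ReM.
  by rewrite RintegralB ?RintegralZl//; exact: h.
under eq_Rintegral do rewrite ImM.
by rewrite RintegralD ?RintegralZl//; exact: h.
Qed.

Lemma Cintegral_conj F : Cintegrable mu F ->
  Cintegral mu (fun t => conjc (F t)) = conjc (Cintegral mu F).
Proof.
move=> [F1 F2]; apply: complex_ext => /=.
  by under eq_Rintegral do rewrite Re_conjc.
under eq_Rintegral do rewrite Im_conjc -mulN1r.
by rewrite RintegralZl// mulN1r.
Qed.

Lemma CintegralB F G : Cintegrable mu F -> Cintegrable mu G ->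
  Cintegral mu (fun t => F t - G t) = Cintegral mu F - Cintegral mu G.
Proof.
move=> iF iG; rewrite -mulN1r -CintegralZ// -CintegralD//; last exact: CintegrableZ.
by congr Cintegral; apply/funext => t; rewrite mulN1r.
Qed.

Lemma CintegrableB F G : Cintegrable mu F -> Cintegrable mu G ->
  Cintegrable mu (fun t => F t - G t).
Proof.
move=> iF iG; have := CintegrableD iF (CintegrableZ (-1) iG).
by under eq_fun do rewrite mulN1r.
Qed.

Lemma norm1c_Cintegral_le F (g : T -> R) : Cintegrable mu F ->
  mu.-integrable setT (EFin \o g) -> (forall t, norm1c (F t) <= g t) ->
  norm1c (Cintegral mu F) <= \int[mu]_t g t.
Proof.
move=> iF ig Fg; have [F1 F2] := iF.
apply: (@le_trans _ _ (\int[mu]_t norm1c (F t))).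
  rewrite /norm1c RintegralD//; try exact: integrable_norm.
  by apply: lerD; exact: le_normr_Rintegral.
by apply: le_Rintegral => //; exact: integrable_norm1c.
Qed.

Lemma Cintegral_real (h : T -> R) :
  Cintegral mu (fun t => (h t)%:C) = (\int[mu]_t h t)%:C.
Proof.
by apply: complex_ext => //=; rewrite Rintegral_cst// mul0r.
Qed.

End CIntegralTheory.

Section CFubini.
Context d1 d2 (T1 : measurableType d1) (T2 : measurableType d2) (R : realType).
Variables (m1 : {sigma_finite_measure set T1 -> \bar R})
          (m2 : {sigma_finite_measure set T2 -> \bar R}).
Local Notation mm := (m1 \x m2)%E.

Lemma Cmeasurable_comp d (T : measurableType d) (F : T -> R[i]) (h : T1 -> T) :
  measurable_fun setT h -> Cmeasurable F -> Cmeasurable (fun t => F (h t)).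
Proof.
move=> mh [F1 F2]; split; [exact: (measurableT_comp F1)|exact: (measurableT_comp F2)].
Qed.

Lemma integrable_tensor (g1 : T1 -> R) (g2 : T2 -> R) :
  m1.-integrable setT (EFin \o g1) -> m2.-integrable setT (EFin \o g2) ->
  mm.-integrable setT (EFin \o (fun p => g1 p.1 * g2 p.2)).
Proof.
move=> i1 i2.
have m1' : measurable_fun setT g1 by apply/measurable_EFinP; exact: (measurable_int m1).
have m2' : measurable_fun setT g2 by apply/measurable_EFinP; exact: (measurable_int m2).
apply/integrable12ltyP.
  by apply/measurable_EFinP; apply: measurable_funM; exact: measurableT_comp.
rewrite /=.
have i1' := integrable_norm i1; have i2' := integrable_norm i2.
have e x : (\int[m2]_y (`|g1 x * g2 y|)%:E = (\int[m2]_t `|g2 t|)%:E * `|g1 x|%:E)%E.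
  under eq_integral do rewrite normrM EFinM.
  rewrite integralZl// muleC; congr (_ * _)%E.
  rewrite /Rintegral fineK//; exact: (integrable_fin_num _ i2').
under eq_integral do rewrite e.
rewrite integralZl//; apply: lte_mul_pinfty => //.
- by rewrite lee_fin; apply: Rintegral_ge0.
- exact: (integrable_lty _ i1').
Qed.

(** The integral of a signed function is by definition the difference of those of its
    positive and negative parts, to which the Fubini-Tonelli theorem applies
    separately. *)
Lemma measurable_Rintegral (f : T1 * T2 -> R) : measurable_fun setT f ->
  measurable_fun setT (fun x => \int[m2]_y f (x, y)).
Proof.
move=> mf.
have mf' : measurable_fun setT (EFin \o f) by exact/measurable_EFinP.
have hp := @measurable_fun_fubini_tonelli_F _ _ _ _ _ m2 _ (measurable_funepos mf')
  (fun=> funepos_ge0 _ _).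
have hn := @measurable_fun_fubini_tonelli_F _ _ _ _ _ m2 _ (measurable_funeneg mf')
  (fun=> funeneg_ge0 _ _).
have h := measurableT_comp (fine_measurable measurableT) (emeasurable_funB hp hn).
apply: eq_measurable_fun h => x _ /=.
rewrite /Rintegral; congr fine; rewrite [in RHS]integralE.
by congr (_ - _)%E; apply: eq_integral => y _; rewrite ?funeposE ?funenegE.
Qed.

Lemma Cmeasurable_Cintegral (F : T1 * T2 -> R[i]) : Cmeasurable F ->
  Cmeasurable (fun x => Cintegral m2 (fun y => F (x, y))).
Proof.
move=> [F1 F2]; split => /=.
  exact: (@measurable_Rintegral (fun p => complex.Re (F p))).
exact: (@measurable_Rintegral (fun p => complex.Im (F p))).
Qed.

Let integral12 (f : T1 * T2 -> R) : mm.-integrable setT (EFin \o f) ->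
  \int[mm]_p f p = \int[m1]_x \int[m2]_y f (x, y).
Proof.
move=> i; rewrite /Rintegral -(integral12_prod_meas1 i); congr fine.
apply: ae_eq_integral => //.
- exact: (measurable_fubini_F i).
- apply/measurable_EFinP; apply: measurable_Rintegral.
  by apply/measurable_EFinP; exact: (measurable_int mm).
- have := ae_integrable1 i; apply: filterS => x /= ix _.
  rewrite /Rintegral fineK//; exact: (integrable_fin_num _ ix).
Qed.

Lemma Cintegral12 (F : T1 * T2 -> R[i]) : Cintegrable mm F ->
  Cintegral mm F = Cintegral m1 (fun x => Cintegral m2 (fun y => F (x, y))).
Proof. by move=> [F1 F2]; rewrite /Cintegral /= !integral12. Qed.

End CFubini.

Section CFubiniSwap.
Context d1 d2 (T1 : measurableType d1) (T2 : measurableType d2) (R : realType).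
Variables (m1 : {sigma_finite_measure set T1 -> \bar R})
          (m2 : {sigma_finite_measure set T2 -> \bar R}).

Let integrable_swap (f : T1 * T2 -> R) :
  (m1 \x m2)%E.-integrable setT (EFin \o f) ->
  (m2 \x m1)%E.-integrable setT (EFin \o (fun p => f (p.2, p.1))).
Proof.
move=> i; have mf := measurable_int _ i.
have ms : measurable_fun setT (fun p : T2 * T1 => (p.2, p.1)).
  exact: measurable_fun_pair.
apply/integrable12ltyP => /=.
  exact: (measurableT_comp mf ms).
by move/(integrable21ltyP _ _ mf) : i.
Qed.

Lemma Cintegrable_swap (F : T1 * T2 -> R[i]) : Cintegrable (m1 \x m2)%E F ->
  Cintegrable (m2 \x m1)%E (fun p => F (p.2, p.1)).
Proof.
move=> [F1 F2]; split.
  exact: (@integrable_swap (fun p => complex.Re (F p))).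
exact: (@integrable_swap (fun p => complex.Im (F p))).
Qed.

Let integral_swap (f : T1 * T2 -> R) :
  (m1 \x m2)%E.-integrable setT (EFin \o f) ->
  \int[(m2 \x m1)%E]_p f (p.2, p.1) = \int[(m1 \x m2)%E]_p f p.
Proof.
move=> i; rewrite /Rintegral; congr fine.
rewrite -(integral21_prod_meas1 i).
by rewrite -(integral12_prod_meas1 (integrable_swap i)).
Qed.

Lemma Cintegral_swap (F : T1 * T2 -> R[i]) : Cintegrable (m1 \x m2)%E F ->
  Cintegral (m2 \x m1)%E (fun p => F (p.2, p.1)) = Cintegral (m1 \x m2)%E F.
Proof.
move=> [F1 F2]; rewrite /Cintegral /=.
rewrite (@integral_swap (fun p => complex.Re (F p)) F1).
by rewrite (@integral_swap (fun p => complex.Im (F p)) F2).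
Qed.

End CFubiniSwap.

Lemma Fubini_Cintegral d1 d2 (T1 : measurableType d1) (T2 : measurableType d2)
    (R : realType) (m1 : {sigma_finite_measure set T1 -> \bar R})
    (m2 : {sigma_finite_measure set T2 -> \bar R}) (F : T1 * T2 -> R[i]) :
  Cintegrable (m1 \x m2)%E F ->
  Cintegral m1 (fun x => Cintegral m2 (fun y => F (x, y))) =
  Cintegral m2 (fun y => Cintegral m1 (fun x => F (x, y))).
Proof.
move=> iF; rewrite -Cintegral12// -Cintegral_swap//.
by rewrite Cintegral12//; exact: Cintegrable_swap.
Qed.

Section CDominated.
Context d (T : measurableType d) (R : realType) (mu : {measure set T -> \bar R}).

Let dominated (f_ : (T -> R)^nat) (f g : T -> R) :
  (forall k, measurable_fun setT (f_ k)) ->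
  (forall t, f_ ^~ t @ \oo --> f t) ->
  mu.-integrable setT (EFin \o g) -> (forall k t, `|f_ k t| <= g t) ->
  (fun k => \int[mu]_t f_ k t) @ \oo --> \int[mu]_t f t.
Proof.
move=> mf ff ig fg.
have mlim : measurable_fun setT f.
  apply: (@measurable_fun_cvg _ _ _ setT f_) => // t _; exact: ff.
have [h1 h2 h3] := @dominated_convergence _ _ _ mu setT measurableT
  (fun k => EFin \o f_ k) (EFin \o f) (EFin \o g)
  (fun k => ltac:(apply/measurable_EFinP; exact: mf))
  ltac:(apply/measurable_EFinP; exact: mlim)
  ltac:(apply: aeW => t _; apply/fine_cvgP; split; [exact: nearW|exact: ff]) ig
  ltac:(apply: aeW => t k _ /=; rewrite lee_fin; exact: fg).
apply: fine_cvg; rewrite fineK; first exact: h3.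
exact: (integrable_fin_num _ h1).
Qed.

Lemma Cdominated (F_ : nat -> T -> R[i]) (F : T -> R[i]) (g : T -> R) :
  (forall k, Cmeasurable (F_ k)) ->
  (forall t, (fun k => complex.Re (F_ k t)) @ \oo --> complex.Re (F t)) ->
  (forall t, (fun k => complex.Im (F_ k t)) @ \oo --> complex.Im (F t)) ->
  mu.-integrable setT (EFin \o g) -> (forall k t, norm1c (F_ k t) <= g t) ->
  (fun k => complex.Re (Cintegral mu (F_ k))) @ \oo --> complex.Re (Cintegral mu F) /\
  (fun k => complex.Im (Cintegral mu (F_ k))) @ \oo --> complex.Im (Cintegral mu F).
Proof.
move=> mF cR cI ig Fg; split => /=.
  apply: (dominated _ cR ig); first by move=> k; case: (mF k).
  by move=> k t; apply: le_trans (Re_le_norm1c _) _.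
apply: (dominated _ cI ig); first by move=> k; case: (mF k).
by move=> k t; apply: le_trans (Im_le_norm1c _) _.
Qed.

End CDominated.

(** * Linear changes of variables in the integral over n-tuples *)

Section AffineLine.
Context (R : realType).
Local Notation leb := (@lebesgue_measure R).

Let aff (a b : R) (x : measurableTypeR R) : measurableTypeR R := a * x + b.

Let measurable_aff a b : measurable_fun setT (aff a b).
Proof. by apply: measurable_funD => //; exact: measurable_funM. Qed.

Let lebesgue_aff (a b : R) (A : set (measurableTypeR R)) : a != 0 -> measurable A ->
  leb A = (`|a|%:E * leb (aff a b @^-1` A))%E.
Proof.
move=> a0 mA; have na : 0 <= `|a| by [].
pose m := mscale (NngNum na) (pushforward leb (aff a b)).
rewrite (_ : leb A = m (measurable_aff a b) A)//.
apply: lebesgue_measure_unique => // _ [[c d]] _ <-.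
rewrite -[RHS]/(`|a|%:E * leb (aff a b @^-1` `]c, d]%classic))%E.
move: a0; rewrite neq_lt => /orP[a0|a0].
- rewrite (_ : aff a b @^-1` _ = `[(d - b) / a, (c - b) / a[%classic).
    rewrite !lebesgue_measure_itv/= !lte_fin ltr_ndivrMr// divrK ?unitfE ?lt_eqF//.
    rewrite ltrD2r; case: ifP => cd; last by rewrite mule0.
    by rewrite ltr0_norm// -!EFinB -EFinM; congr EFin; field; rewrite lt_eqF.
  apply/seteqP; split => x /=; rewrite !in_itv /= /aff.
    by rewrite ler_ndivrMr// ltr_ndivlMr// !(mulrC x) lerBrDr ltrBlDr andbC.
  by rewrite ler_ndivrMr// ltr_ndivlMr// !(mulrC x) lerBrDr ltrBlDr andbC.
- rewrite (_ : aff a b @^-1` _ = `](c - b) / a, (d - b) / a]%classic).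
    rewrite !lebesgue_measure_itv/= !lte_fin ltr_pdivrMr// divrK ?unitfE ?gt_eqF//.
    rewrite ltrD2r; case: ifP => cd; last by rewrite mule0.
    by rewrite gtr0_norm// -!EFinB -EFinM; congr EFin; field; rewrite gt_eqF.
  apply/seteqP; split => x /=; rewrite !in_itv /= /aff.
    by rewrite ler_pdivlMr// ltr_pdivrMr// !(mulrC x) lerBrDr ltrBlDr.
  by rewrite ler_pdivlMr// ltr_pdivrMr// !(mulrC x) lerBrDr ltrBlDr.
Qed.

(** The pushforward of Lebesgue measure by an affine map, rescaled, agrees with
    Lebesgue measure on half-open intervals, hence everywhere. *)
Lemma ge0_integral_affine (a b : R) (F : R -> \bar R) : a != 0 ->
  measurable_fun setT F -> (forall x, 0 <= F x)%E ->
  (\int[leb]_x F x = `|a|%:E * \int[leb]_x F (a * x + b)%R)%E.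
Proof.
move=> a0 mF F0; have na : 0 <= `|a| by [].
pose m := mscale (NngNum na) (pushforward leb (aff a b)).
rewrite (eq_measure_integral (m (measurable_aff a b))); last first.
  by move=> A mA _; rewrite [LHS](lebesgue_aff b a0).
rewrite ge0_integral_mscale//=; congr (_ * _)%E.
by rewrite (ge0_integral_pushforward (measurable_aff a b)).
Qed.

End AffineLine.

Section TupleVector.
Context (R : realType).

(** Integrals are taken over tuples while functions live on column vectors; [vtup]
    is the inverse of [cvec]. *)
Definition vtup n (x : 'cV[R]_n) : n.-tuple R := [tuple x i 0 | i < n].

Lemma vtupK n : cancel (@vtup n) (@cvec R n).
Proof. by move=> x; apply/colP => i; rewrite mxE tnth_mktuple. Qed.

Lemma cvecK n : cancel (@cvec R n) (@vtup n).
Proof. by move=> t; apply: eq_from_tnth => i; rewrite tnth_mktuple mxE. Qed.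

Lemma cvec_cons n a (t : n.-tuple R) :
  cvec (consT (a, t)) = col_mx (a%:M : 'M[R]_1) (cvec t) :> 'cV[R]_(1 + n).
Proof.
apply/colP => i; rewrite !mxE; case: splitP => j e.
  rewrite !ord1 !mxE eqxx mulr1n (_ : i = ord0)//.
  by apply: val_inj; rewrite /= e ord1.
by rewrite mxE (_ : i = lift ord0 j) ?tnthS//; apply: val_inj; rewrite /= e.
Qed.

Lemma vtup_col n (a : 'M[R]_1) (v : 'cV[R]_n) :
  vtup (col_mx a v : 'cV[R]_(1 + n)) = consT (a 0 0, vtup v).
Proof.
apply: (can_inj (@cvecK (1 + n))); rewrite cvec_cons !vtupK.
by rewrite -mx11_scalar.
Qed.

Context d (T : measurableType d).

(** Column vectors carry no measurable structure, so measurability of a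
    vector-valued map is expressed through its coordinates. *)
Definition vmeasurable n (h : T -> 'cV[R]_n) :=
  forall i, measurable_fun setT (fun t => h t i 0).

Lemma measurable_vtup n (h : T -> 'cV[R]_n) : vmeasurable h ->
  measurable_fun setT (fun t => vtup (h t)).
Proof.
move=> mh; apply/measurable_fun_tnthP => i.
by apply: eq_measurable_fun (mh i) => t _ /=; rewrite tnth_mktuple.
Qed.

Lemma vmeasurable_cst n (b : 'cV[R]_n) : vmeasurable (fun=> b).
Proof. by move=> i; exact: measurable_cst. Qed.

Lemma vmeasurableD n (h g : T -> 'cV[R]_n) : vmeasurable h -> vmeasurable g ->
  vmeasurable (fun t => h t + g t).
Proof.
move=> mh mg i; under eq_fun do rewrite mxE.
exact: measurable_funD (mh i) (mg i).
Qed.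

Lemma vmeasurableM m n (M : 'M[R]_(m, n)) (h : T -> 'cV[R]_n) :
  vmeasurable h -> vmeasurable (fun t => M *m h t).
Proof.
move=> mh i; under eq_fun do rewrite mxE.
by apply: measurable_sum => j; exact: measurable_funM (measurable_cst _) (mh j).
Qed.

Lemma vmeasurableZ n (c : R) (h : T -> 'cV[R]_n) :
  vmeasurable h -> vmeasurable (fun t => c *: h t).
Proof.
move=> mh i; under eq_fun do rewrite mxE.
exact: measurable_funM (measurable_cst _) (mh i).
Qed.

Lemma vmeasurableN n (h : T -> 'cV[R]_n) :
  vmeasurable h -> vmeasurable (fun t => - h t).
Proof.
move=> mh; under eq_fun do rewrite -scaleN1r; exact: vmeasurableZ.
Qed.

Lemma measurable_dotv n (h g : T -> 'cV[R]_n) : vmeasurable h -> vmeasurable g ->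
  measurable_fun setT (fun t => dotv (h t) (g t)).
Proof.
move=> mh mg; under eq_fun do (rewrite /dotv mxE; under eq_bigr do rewrite mxE).
by apply: measurable_sum => j; exact: measurable_funM (mh j) (mg j).
Qed.

End TupleVector.

Lemma vmeasurable_cvec (R : realType) n : vmeasurable (@cvec R n).
Proof. by move=> i; under eq_fun do rewrite mxE; exact: measurable_tnth. Qed.

Section TupleIntegral.
Context (R : realType).
Local Notation leb := (@lebesgue_measure R).
Local Notation lebt := (lebesgue_tuple R).

(* Lebesgue measure is carried by [measurableTypeR R], which is convertible to [R]
   but has its own measurable structure: unification has to be told which. *)
Let RT n := (measurableTypeR R * n.-tuple R)%type.

Let measurable_consTF n (F : n.+1.-tuple R -> \bar R) : measurable_fun setT F ->
  measurable_fun [set: RT n] (F \o @consT R n).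
Proof. by move=> mF; exact: measurableT_comp mF (@measurable_consT R n). Qed.

Lemma ge0_integral_tupleS n (F : n.+1.-tuple R -> \bar R) :
  measurable_fun setT F -> (forall t, 0 <= F t)%E ->
  (\int[lebt n.+1]_t F t = \int[leb \x lebt n]_p F (consT p))%E.
Proof.
move=> mF F0.
exact: (@ge0_integral_pushforward _ _ (RT n) _ R (@consT R n)
  (@measurable_consT R n) (leb \x lebt n)%E setT F measurableT mF
  (fun x _ => F0 x)).
Qed.

Lemma ge0_integral_tuple12 n (F : n.+1.-tuple R -> \bar R) :
  measurable_fun setT F -> (forall t, 0 <= F t)%E ->
  (\int[lebt n.+1]_t F t = \int[leb]_a \int[lebt n]_t F (consT (a, t)))%E.
Proof.
move=> mF F0; rewrite ge0_integral_tupleS//.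
exact: (@fubini_tonelli1 _ _ (measurableTypeR R) _ _ _ _ _
  (measurable_consTF mF) (fun=> F0 _)).
Qed.

Lemma ge0_integral_tuple21 n (F : n.+1.-tuple R -> \bar R) :
  measurable_fun setT F -> (forall t, 0 <= F t)%E ->
  (\int[lebt n.+1]_t F t = \int[lebt n]_t \int[leb]_a F (consT (a, t)))%E.
Proof.
move=> mF F0; rewrite ge0_integral_tuple12//.
exact: (@fubini_tonelli _ _ (measurableTypeR R) _ _ _ _ _
  (measurable_consTF mF) (fun=> F0 _)).
Qed.

Let measurable_consT1 n (F : n.+1.-tuple R -> \bar R) t : measurable_fun setT F ->
  measurable_fun setT (fun a => F (consT (a, t))).
Proof.
move=> mF; apply: (measurableT_comp (measurable_consTF mF)).
exact: measurable_fun_pair.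
Qed.

Let measurable_consT2 n (F : n.+1.-tuple R -> \bar R) a : measurable_fun setT F ->
  measurable_fun setT (fun t => F (consT (a, t))).
Proof.
move=> mF; apply: (measurableT_comp (measurable_consTF mF)).
exact: measurable_fun_pair.
Qed.

Lemma measurable_affine n m (M : 'M[R]_(m, n)) (b : 'cV[R]_m) :
  measurable_fun setT (fun t => vtup (M *m cvec t + b)).
Proof.
apply/measurable_vtup/vmeasurableD; last exact: vmeasurable_cst.
by apply: vmeasurableM; exact: vmeasurable_cvec.
Qed.

Let measurable_trans n (b : 'cV[R]_n) :
  measurable_fun setT (fun t => vtup (cvec t + b)).
Proof.
apply/measurable_vtup/vmeasurableD; last exact: vmeasurable_cst.
exact: vmeasurable_cvec.
Qed.

Lemma ge0_integral_translation n (b : 'cV[R]_n) (F : n.-tuple R -> \bar R) :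
  measurable_fun setT F -> (forall t, 0 <= F t)%E ->
  (\int[lebt n]_t F (vtup (cvec t + b)) = \int[lebt n]_t F t)%E.
Proof.
elim: n b F => [|n ih] b F mF F0.
  by apply: eq_integral => t _; congr F; apply: eq_from_tnth => -[].
rewrite ge0_integral_tuple12//; last exact: (measurableT_comp mF (measurable_trans b)).
rewrite [RHS]ge0_integral_tuple12//.
have eb : b = col_mx (usubmx (b : 'cV[R]_(1 + n))) (dsubmx (b : 'cV[R]_(1 + n))).
  by rewrite vsubmxK.
set b1 := usubmx _ in eb; set b2 := dsubmx _ in eb.
have e a t : vtup (cvec (consT (a, t)) + b : 'cV[R]_(1 + n)) =
    consT (a + b1 0 0, vtup (cvec t + b2)).
  transitivity (vtup (col_mx a%:M (cvec t) + col_mx b1 b2 : 'cV[R]_(1 + n))).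
    by rewrite -eb -cvec_cons.
  by rewrite add_col_mx vtup_col !mxE eqxx mulr1n.
under eq_integral => a _.
  under eq_integral => t _ do rewrite e.
  rewrite (ih b2 (fun t => F (consT (a + b1 0 0, t))))//; last exact: measurable_consT2.
  over.
rewrite [RHS](@ge0_integral_affine _ 1 (b1 0 0))//.
- by rewrite normr1 mul1e; apply: eq_integral => a _; rewrite mul1r.
- exact: (@measurable_fun_fubini_tonelli_F _ _ (measurableTypeR R) _ _ (lebt n) _
    (measurable_consTF mF) (fun=> F0 _)).
- by move=> x; exact: integral_ge0.
Qed.

(** The matrices for which the formula holds are closed under product; every
    invertible matrix is a product of block triangular ones, for which Fubini
    reduces the formula to lower dimension. *)
Let cov n (M : 'M[R]_n) := forall F : n.-tuple R -> \bar R,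
  measurable_fun setT F -> (forall t, 0 <= F t)%E ->
  (\int[lebt n]_t F t = `|\det M|%:E * \int[lebt n]_t F (vtup (M *m cvec t)))%E.

Let measurable_lin n (M : 'M[R]_n) :
  measurable_fun setT (fun t => vtup (M *m cvec t)).
Proof. by apply/measurable_vtup/vmeasurableM; exact: vmeasurable_cvec. Qed.

Let covM n (M N : 'M[R]_n) : cov M -> cov N -> cov (M *m N).
Proof.
move=> cM cN F mF F0; rewrite (cM F)// (cN (fun t => F (vtup (M *m cvec t))))//.
  rewrite muleA -EFinM -normrM -det_mulmx; congr (_ * _)%E.
  by apply: eq_integral => t _; rewrite vtupK mulmxA.
exact: (measurableT_comp mF (measurable_lin _)).
Qed.

(** Integrating the first coordinate first leaves an affine map of the line, then
    a map in lower dimension. *)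
Let cov_upper n (a : R) (v : 'rV[R]_n) (N : 'M[R]_n) : a != 0 -> cov N ->
  cov (block_mx a%:M v 0 N : 'M[R]_(1 + n)).
Proof.
move=> a0 cN F mF F0; rewrite det_ublock det_scalar1.
rewrite !ge0_integral_tuple21//; last exact: (measurableT_comp mF (measurable_lin _)).
have e x t : vtup ((block_mx a%:M v 0 N : 'M[R]_(1 + n)) *m cvec (consT (x, t))) =
    consT (a * x + (v *m cvec t) 0 0, vtup (N *m cvec t)).
  rewrite cvec_cons mul_block_col mul0mx add0r vtup_col; congr (consT (_, _)).
  by rewrite mxE -scalar_mxM [in X in X + _]mxE eqxx mulr1n.
under [in RHS]eq_integral => t _ do under eq_integral => x _ do rewrite e.
rewrite (cN (fun t => \int[leb]_x F (consT (x, t)))%E); last 2 first.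
- exact: (@measurable_fun_fubini_tonelli_G _ _ (measurableTypeR R) _ _ leb _
    (measurable_consTF mF) (fun=> F0 _)).
- by move=> t; exact: integral_ge0.
have e2 t : (\int[leb]_x F (consT (x, vtup (N *m cvec t))) =
   `|a|%:E * \int[leb]_x F (consT ((a * x + (v *m cvec t) 0 0)%R, vtup (N *m cvec t))))%E.
  exact: (@ge0_integral_affine _ a ((v *m cvec t) 0 0)
    (fun x => F (consT (x, vtup (N *m cvec t)))) a0 (measurable_consT1 _ mF)).
transitivity (`|\det N|%:E * \int[lebt n]_t (`|a|%:E *
    \int[leb]_x F (consT ((a * x + (v *m cvec t) 0 0)%R, vtup (N *m cvec t)))))%E.
  by congr (_ * _)%E; apply: eq_integral => t _; exact: e2.
rewrite ge0_integralZl//; last 2 first.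
- pose G p := F (vtup ((block_mx a%:M v 0 N : 'M[R]_(1 + n)) *m cvec (@consT R n p))).
  have mG : measurable_fun [set: RT n] G.
    exact: (measurable_consTF (measurableT_comp mF (measurable_lin _))).
  have := @measurable_fun_fubini_tonelli_G _ _ (measurableTypeR R) _ _ leb _ mG
    (fun=> F0 _); apply: eq_measurable_fun => t _.
  by apply: eq_integral => x _; rewrite /G e.
- by move=> t _; exact: integral_ge0.
by rewrite muleA -EFinM normrM mulrC.
Qed.

(** Integrating the last coordinates first leaves a translation. *)
Let cov_lower n (w : 'cV[R]_n) : cov (block_mx 1%:M 0 w 1%:M : 'M[R]_(1 + n)).
Proof.
move=> F mF F0; rewrite det_lblock !det1 mulr1 normr1 mul1e.
rewrite !ge0_integral_tuple12//; last exact: (measurableT_comp mF (measurable_lin _)).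
apply: eq_integral => x _.
rewrite -[LHS](ge0_integral_translation (w *m x%:M) (measurable_consT2 _ _))//.
apply: eq_integral => t _; congr F.
rewrite cvec_cons mul_block_col mul0mx addr0 !mul1mx vtup_col addrC.
by rewrite mxE eqxx mulr1n.
Qed.

Lemma ge0_integral_linear n (M : 'M[R]_n) (F : n.-tuple R -> \bar R) :
  M \in unitmx -> measurable_fun setT F -> (forall t, 0 <= F t)%E ->
  (\int[lebt n]_t F t = `|\det M|%:E * \int[lebt n]_t F (vtup (M *m cvec t)))%E.
Proof.
move=> uM; move: F; rewrite -/(cov M).
elim: n M uM => [|n ih] M uM.
  move=> F mF F0; rewrite det_mx00 normr1 mul1e.
  by apply: eq_integral => t _; congr F; apply: eq_from_tnth => -[].
have cov1 k : cov (1%:M : 'M[R]_k).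
  by move=> F mF F0; rewrite det1 normr1 mul1e; apply: eq_integral => t _;
    rewrite mul1mx cvecK.
rewrite -(@submxK _ 1 n 1 n M) in uM *.
set a := ulsubmx _ in uM *; set v := ursubmx _ in uM *.
set w := dlsubmx _ in uM *; set N := drsubmx _ in uM *.
(* the corner entry is made invertible by adding a suitable row to the first *)
have [u hu] : exists u : 'rV[R]_n, (a + u *m w) 0 0 != 0.
  have [a0|/negPn/eqP a0] := boolP (a 0 0 != 0); first by exists 0; rewrite mul0mx addr0.
  have [w0|/eqP/colP] := eqVneq w 0; last first.
    move=> /existsNP [j wj]; exists (delta_mx 0 j).
    rewrite mxE a0 add0r -rowE mxE; apply/eqP; rewrite !mxE in wj *; exact: wj.
  have a00 : a = 0 by rewrite [a]mx11_scalar a0 raddf0.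
  have : (block_mx a v w N : 'M[R]_(1 + n)) *m col_mx 1%:M 0 = 0.
    by rewrite mul_block_col a00 w0 !mul0mx !mulmx0 !addr0 col_mx0.
  move/(congr1 (mulmx (invmx (block_mx a v w N)))).
  rewrite mulmx0 mulKmx// => /eqP; rewrite col_mx_eq0 => /andP[/eqP/matrixP].
  by move=> /(_ 0 0)/eqP; rewrite !mxE eqxx oner_eq0.
set c := (a + u *m w) 0 0 in hu.
have cE : a + u *m w = c%:M by rewrite -mx11_scalar.
pose N' := N - w *m (c^-1 *: (v + u *m N)).
have e : block_mx a v w N = (block_mx 1%:M (- u) 0 1%:M : 'M[R]_(1 + n)) *m
    ((block_mx 1%:M 0 (c^-1 *: w) 1%:M) *m (block_mx c%:M (v + u *m N) 0 N')).
  have -> : block_mx 1%:M 0 (c^-1 *: w) 1%:M *m block_mx c%:M (v + u *m N) 0 N' =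
      block_mx c%:M (v + u *m N) w N :> 'M[R]_(1 + n).
    rewrite mulmx_block; congr block_mx; rewrite ?mul0mx ?mulmx0 ?addr0 ?mul1mx//.
      by rewrite mul_mx_scalar scalerA mulfV// scale1r.
    by rewrite /N' -scalemxAr -scalemxAl addrC subrK.
  rewrite mulmx_block !mul0mx !mul1mx !add0r -cE !mulNmx.
  by rewrite -[a + _ - _]addrA subrr addr0 -[v + _ - _]addrA subrr addr0.
have uN' : N' \in unitmx.
  move: uM; rewrite e !unitmx_mul => /andP[_ /andP[_]].
  rewrite !unitmxE.
  rewrite -[\det _]/(\det (block_mx c%:M (v + u *m N) 0 N' : 'M[R]_(1 + n))).
  by rewrite det_ublock unitrM => /andP[].
rewrite e; apply: covM; first by apply: (@cov_upper _ 1) => //; exact: oner_neq0.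
by apply: covM; [exact: cov_lower | apply: cov_upper => //; exact: ih].
Qed.

End TupleIntegral.

(** * Change of variables and products for complex integrands *)

(** A change of variables known for nonnegative functions holds for complex ones;
    it is applied below to affine maps and to [consT]. *)
Section CTransfer.
Context d1 d2 (X : measurableType d1) (Y : measurableType d2) (R : realType).
Variables (mu : {measure set X -> \bar R}) (nu : {measure set Y -> \bar R}).
Variables (phi : X -> Y) (c : R).
Hypothesis mphi : measurable_fun setT phi.
Hypothesis c0 : 0 < c.
Hypothesis munu : forall F : Y -> \bar R, measurable_fun setT F ->
  (forall y, 0 <= F y)%E -> (\int[nu]_y F y = c%:E * \int[mu]_x F (phi x))%E.

Let integrable_transfer (f : Y -> R) : measurable_fun setT f ->
  nu.-integrable setT (EFin \o f) <-> mu.-integrable setT (EFin \o (f \o phi)).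
Proof.
move=> mf; have mf' : measurable_fun setT (EFin \o f) by exact/measurable_EFinP.
have mfp : measurable_fun setT (EFin \o (f \o phi)).
  exact: (measurableT_comp mf' mphi).
have e : (\int[nu]_y `|(EFin \o f) y| =
    c%:E * \int[mu]_x `|(EFin \o (f \o phi)) x|)%E.
  by rewrite munu//; exact: measurableT_comp.
split => /integrableP[_ h]; apply/integrableP; split => //.
  move: h; rewrite e; case: (\int[mu]_x _)%E => [r _| |_]; [exact: ltry| |by rewrite ltNye].
  by rewrite mulry gtr0_sg// mul1e ltxx.
by rewrite e; apply: lte_mul_pinfty => //; rewrite lee_fin ltW.
Qed.

Let Rintegral_transfer (f : Y -> R) : mu.-integrable setT (EFin \o (f \o phi)) ->
  measurable_fun setT f -> \int[nu]_y f y = c * \int[mu]_x f (phi x).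
Proof.
move=> i mf; have mf' : measurable_fun setT (EFin \o f) by exact/measurable_EFinP.
have ip := integrable_pos_fin_num measurableT i; have ine := integrable_neg_fin_num measurableT i.
rewrite /Rintegral [in LHS]integralE [X in _ = _ * fine X]integralE.
rewrite (munu (measurable_funepos mf') (fun=> funepos_ge0 _ _)).
rewrite (munu (measurable_funeneg mf') (fun=> funeneg_ge0 _ _)).
have ep : (\int[mu]_x ((fun y => (f y)%:E)^\+ (phi x)) =
    \int[mu]_x (EFin \o (f \o phi))^\+ x)%E.
  by apply: eq_integral => x _; rewrite !funeposE.
have en : (\int[mu]_x ((fun y => (f y)%:E)^\- (phi x)) =
    \int[mu]_x (EFin \o (f \o phi))^\- x)%E.
  by apply: eq_integral => x _; rewrite !funenegE.
rewrite ep en -[X in fine (X - _)]fineK; last by rewrite fin_numM.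
by rewrite -(fineK ip) -(fineK ine) -!EFinM -!EFinB /= mulrBr.
Qed.

Lemma Cintegrable_transfer (F : Y -> R[i]) : Cmeasurable F ->
  Cintegrable nu F <-> Cintegrable mu (fun x => F (phi x)).
Proof.
move=> [F1 F2]; split => -[i1 i2]; split.
- exact/(integrable_transfer F1).
- exact/(integrable_transfer F2).
- exact/(integrable_transfer F1).
- exact/(integrable_transfer F2).
Qed.

Lemma Cintegral_transfer (F : Y -> R[i]) : Cmeasurable F ->
  Cintegrable mu (fun x => F (phi x)) ->
  Cintegral nu F = c%:C * Cintegral mu (fun x => F (phi x)).
Proof.
move=> [F1 F2] [i1 i2]; apply: complex_ext; rewrite ?ReM ?ImM /= !mul0r ?subr0 ?addr0.
  exact: (Rintegral_transfer i1 F1).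
exact: (Rintegral_transfer i2 F2).
Qed.

End CTransfer.

Section CTupleIntegral.
Context (R : realType).
Local Notation leb := (@lebesgue_measure R).
Local Notation lebt := (lebesgue_tuple R).

Definition Vintegrable n (F : 'cV[R]_n -> R[i]) :=
  Cintegrable (lebt n) (fun t => F (cvec t)).

Definition Vmeasurable n (F : 'cV[R]_n -> R[i]) :=
  Cmeasurable (fun t : n.-tuple R => F (cvec t)).

Lemma Vmeasurable_comp d (T : measurableType d) n (F : 'cV[R]_n -> R[i])
    (h : T -> 'cV[R]_n) :
  Vmeasurable F -> vmeasurable h -> Cmeasurable (fun t => F (h t)).
Proof.
move=> mF mh; have := Cmeasurable_comp (measurable_vtup mh) mF.
by under eq_fun do rewrite vtupK.
Qed.

Lemma ge0_integral_affine_tuple n (M : 'M[R]_n) (b : 'cV[R]_n) (G : n.-tuple R -> \bar R) :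
  M \in unitmx -> measurable_fun setT G -> (forall y, 0 <= G y)%E ->
  (\int[lebt n]_y G y = `|\det M|%:E * \int[lebt n]_x G (vtup (M *m cvec x + b)))%E.
Proof.
move=> uM mG G0; rewrite -(ge0_integral_translation b mG G0).
rewrite (ge0_integral_linear uM)//.
  by congr (_ * _)%E; apply: eq_integral => t _; rewrite vtupK.
apply: (measurableT_comp mG); apply: measurable_vtup; apply: vmeasurableD.
  exact: vmeasurable_cvec.
exact: vmeasurable_cst.
Qed.

Lemma unitmx_det_gt0 n (M : 'M[R]_n) : M \in unitmx -> 0 < `|\det M|.
Proof. by rewrite unitmxE unitfE normr_gt0. Qed.

Lemma Vintegrable_affine n (M : 'M[R]_n) (b : 'cV[R]_n) (F : 'cV[R]_n -> R[i]) :
  M \in unitmx -> Vintegrable F -> Vintegrable (fun x => F (M *m x + b)).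
Proof.
move=> uM iF; have mF := Cintegrable_measurable iF.
have := (Cintegrable_transfer (measurable_affine M b) (unitmx_det_gt0 uM)
  (fun G => @ge0_integral_affine_tuple _ M b G uM) mF).1 iF.
by rewrite /Vintegrable; under eq_fun do rewrite vtupK.
Qed.

Lemma intRn_affine n (M : 'M[R]_n) (b : 'cV[R]_n) (F : 'cV[R]_n -> R[i]) :
  M \in unitmx -> Vintegrable F ->
  intRn F = `|\det M|%:C * intRn (fun x => F (M *m x + b)).
Proof.
move=> uM iF; have mF := Cintegrable_measurable iF.
have iF' := Vintegrable_affine b uM iF.
rewrite /intRn (Cintegral_transfer (fun G => @ge0_integral_affine_tuple _ M b G uM) mF).
  by congr (_ * Cintegral _ _); apply/funext => t; rewrite vtupK.
by under eq_fun do rewrite vtupK.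
Qed.

Lemma Vintegrable_translate n (b : 'cV[R]_n) (F : 'cV[R]_n -> R[i]) :
  Vintegrable F -> Vintegrable (fun x => F (x + b)).
Proof.
move=> iF; have := Vintegrable_affine b (unitmx1 _ _) iF.
by under eq_fun do rewrite mul1mx.
Qed.

Lemma intRn_translate n (b : 'cV[R]_n) (F : 'cV[R]_n -> R[i]) :
  Vintegrable F -> intRn (fun x => F (x + b)) = intRn F.
Proof.
move=> iF; rewrite (intRn_affine b (unitmx1 _ _) iF) det1 normr1 mul1r.
by congr intRn; apply/funext => x; rewrite mul1mx.
Qed.

Lemma unitmx_scale n (c : R) : c != 0 -> (c%:M : 'M[R]_n) \in unitmx.
Proof.
by move=> c0; rewrite unitmxE det_scalar unitfE expf_neq0.
Qed.

Lemma intRn_scale n (c : R) (F : 'cV[R]_n -> R[i]) : c != 0 ->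
  Vintegrable F -> intRn F = (`|c| ^+ n)%:C * intRn (fun x => F (c *: x)).
Proof.
move=> c0 iF; rewrite (intRn_affine 0 (unitmx_scale n c0) iF) det_scalar normrX.
by congr (_ * intRn _); apply/funext => x; rewrite addr0 mul_scalar_mx.
Qed.

Lemma Vintegrable_scale n (c : R) (F : 'cV[R]_n -> R[i]) : c != 0 ->
  Vintegrable F -> Vintegrable (fun x => F (c *: x)).
Proof.
move=> c0 iF; have := Vintegrable_affine 0 (unitmx_scale n c0) iF.
by under eq_fun do rewrite addr0 mul_scalar_mx.
Qed.

Let RT n := (measurableTypeR R * n.-tuple R)%type.

Let cons_transfer n (F : n.+1.-tuple R -> \bar R) : measurable_fun setT F ->
  (forall t, 0 <= F t)%E ->
  (\int[lebt n.+1]_t F t = 1%:E * \int[leb \x lebt n]_p F (consT p))%E.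
Proof. by move=> mF F0; rewrite mul1e ge0_integral_tupleS. Qed.

Lemma Ctensor_integrable d1 d2 (T1 : measurableType d1) (T2 : measurableType d2)
    (m1 : {sigma_finite_measure set T1 -> \bar R})
    (m2 : {sigma_finite_measure set T2 -> \bar R}) (F : T1 -> R[i]) (G : T2 -> R[i]) :
  Cintegrable m1 F -> Cintegrable m2 G ->
  Cintegrable (m1 \x m2)%E (fun p => F p.1 * G p.2).
Proof.
move=> iF iG; apply: (@Cintegrable_dominated _ _ _ _ _
    (fun p => norm1c (F p.1) * norm1c (G p.2))).
- apply: CmeasurableM.
    exact: (Cmeasurable_comp measurable_fst (Cintegrable_measurable iF)).
  exact: (Cmeasurable_comp measurable_snd (Cintegrable_measurable iG)).
- exact: (integrable_tensor (integrable_norm1c iF) (integrable_norm1c iG)).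
- by move=> p; exact: norm1cM.
Qed.

Lemma Ctensor_integral d1 d2 (T1 : measurableType d1) (T2 : measurableType d2)
    (m1 : {sigma_finite_measure set T1 -> \bar R})
    (m2 : {sigma_finite_measure set T2 -> \bar R}) (F : T1 -> R[i]) (G : T2 -> R[i]) :
  Cintegrable m1 F -> Cintegrable m2 G ->
  Cintegral (m1 \x m2)%E (fun p => F p.1 * G p.2) =
  Cintegral m1 F * Cintegral m2 G.
Proof.
move=> iF iG; rewrite Cintegral12; last exact: Ctensor_integrable.
rewrite mulrC -CintegralZ//; congr Cintegral; apply/funext => x /=.
by rewrite CintegralZ// mulrC.
Qed.

(** Both the integrable majorant and the Poisson kernel are products of functions of
    one coordinate; this reduces them to dimension one. *)
Lemma Cprod_tuple n (h : 'I_n -> R -> R[i]) : (forall i, Cintegrable leb (h i)) ->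
  Cintegrable (lebt n) (fun t => \prod_(i < n) h i (tnth t i)) /\
  Cintegral (lebt n) (fun t => \prod_(i < n) h i (tnth t i)) =
  \prod_(i < n) Cintegral leb (h i).
Proof.
elim: n h => [|n ih] h ihi.
  rewrite [X in Cintegral _ X](_ : _ = fun=> (1%:C)); last first.
    by apply/funext => t; rewrite big_ord0.
  rewrite big_ord0 Cintegral_real; split; last first.
    rewrite Rintegral_cst// mul1r.
    by rewrite [X in fine X](_ : _ = 1%E)//= diracT.
  rewrite [X in Cintegrable _ X](_ : _ = fun=> (1%:C)); last first.
    by apply/funext => t; rewrite big_ord0.
  by split => /=; apply: (@finite_measure_integrable_cst _ _ _ \d_([tuple])).
have [i1 e1] := ih (fun i => h (lift ord0 i)) (fun i => ihi _).
pose F (p : RT n) := h ord0 p.1 * \prod_(i < n) h (lift ord0 i) (tnth p.2 i).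
have FE : (fun p : RT n => \prod_(i < n.+1) h i (tnth (consT p) i)) = F.
  apply/funext => -[a t]; rewrite big_ord_recl; congr (_ * _).
  by apply: eq_bigr => i _; rewrite tnthS.
have iF : Cintegrable (leb \x lebt n)%E F by exact: (Ctensor_integrable (ihi ord0) i1).
have mh : Cmeasurable (fun t : n.+1.-tuple R => \prod_(i < n.+1) h i (tnth t i)).
  apply: Cmeasurable_prod => i.
  exact: (Cmeasurable_comp (measurable_tnth i) (Cintegrable_measurable (ihi i))).
have tr1 := @Cintegrable_transfer _ _ (RT n) _ R (leb \x lebt n)%E (lebt n.+1)
  (@consT R n) 1 (@measurable_consT R n) ltr01 (@cons_transfer n) _ mh.
have tr2 := @Cintegral_transfer _ _ (RT n) _ R (leb \x lebt n)%E (lebt n.+1)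
  (@consT R n) 1 (@cons_transfer n) _ mh.
split; first by apply/tr1; rewrite FE.
rewrite tr2 FE// mul1r big_ord_recl -e1.
exact: (Ctensor_integral (ihi ord0) i1).
Qed.

End CTupleIntegral.

(** * The Poisson kernel and its Fourier transform *)

Section Poisson1D.
Context (R : realType).
Local Notation leb := (@lebesgue_measure R).

Lemma integral_even (f : R -> R) (l : R) : (forall x, 0 <= f x) ->
  continuous f -> (forall x, f (- x) = f x) ->
  (\int[leb]_(x in `[0%R, +oo[) (f x)%:E = l%:E)%E ->
  leb.-integrable setT (EFin \o f) /\ \int[leb]_x f x = 2 * l.
Proof.
move=> f0 cf ef fl.
have e : (\int[leb]_x (f x)%:E = (2 * l)%:E)%E.
  rewrite ge0_symfun_integralT//; last by move=> x /=; rewrite ef.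
  by rewrite -set_itvcy fl.
split; last by rewrite /Rintegral e.
apply/integrableP; split.
  by apply/measurable_EFinP; exact: continuous_measurable_fun.
under eq_integral do rewrite /= ger0_norm//.
by rewrite e ltry.
Qed.

Lemma integral_oneDsqrV :
  leb.-integrable setT (EFin \o (fun x => (1 + x ^+ 2)^-1)) /\
  \int[leb]_x (1 + x ^+ 2)^-1 = pi.
Proof.
have [i e] : leb.-integrable setT (EFin \o (fun x => (1 + x ^+ 2)^-1)) /\
    \int[leb]_x (1 + x ^+ 2)^-1 = 2 * (pi / 2).
  apply: integral_even.
  - by move=> x; rewrite invr_ge0 addr_ge0// sqr_ge0.
  - exact: continuous_oneDsqrV.
  - by move=> x; rewrite sqrrN.
  - exact: integral0y_oneDsqr.
by split=> //; rewrite e; field.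
Qed.

Lemma continuous_expRNnorm : continuous (fun t : R => expR (- `|t|)).
Proof.
move=> x; apply: continuous_comp; last exact: continuous_expR.
by apply: continuousN; exact: norm_continuous.
Qed.

Lemma measurable_expRNnorm : measurable_fun [set: R] (fun t : R => expR (- `|t|)).
Proof. by apply: continuous_measurable_fun; exact: continuous_expRNnorm. Qed.

Lemma measurable_oneDsqrV : measurable_fun [set: R] (fun x : R => (1 + x ^+ 2)^-1).
Proof. by apply: continuous_measurable_fun; exact: continuous_oneDsqrV. Qed.

Lemma continuous_cosM (a : R) : continuous (fun t : R => cos (a * t)).
Proof.
move=> x; apply: continuous_comp; last exact: continuous_cos.
exact: mulrl_continuous.
Qed.

(** Adding 1 to the cosine keeps the integrand nonnegative, which is what the
    fundamental theorem on a half-line asks for. *)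
Let integral_expR_1Dcos (a : R) :
  leb.-integrable setT (EFin \o (fun t => expR (- `|t|) * (1 + cos (a * t)))) /\
  \int[leb]_t (expR (- `|t|) * (1 + cos (a * t))) = 2 * (1 + (1 + a ^+ 2)^-1).
Proof.
have a0 : 1 + a ^+ 2 != 0 by rewrite gt_eqF// ltr_pwDl// sqr_ge0.
apply: integral_even.
- by move=> t; rewrite mulr_ge0 ?expR_ge0// -lerBlDl sub0r cos_geN1.
- move=> x; apply: cvgM; first exact: continuous_expRNnorm.
  by apply: cvgD; [exact: cvg_cst | exact: continuous_cosM].
- by move=> t; rewrite normrN mulrN cosN.
pose F (t : R) : R := expR (- t) *
  ((a * sin (a * t) - cos (a * t)) / (1 + a ^+ 2) - 1).
pose f (t : R) : R := expR (- t) * (1 + cos (a * t)).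
have dF (t : R) : is_derive t 1 F (f t).
  rewrite /F; apply: is_derive_eq.
  rewrite /f /GRing.scale /=; field; exact: a0.
have cF : continuous F.
  by move=> t; apply/differentiable_continuous/derivable1_diffP; exact: ex_derive.
transitivity (\int[leb]_(t in `[0%R, +oo[) (f t)%:E)%E.
  apply: eq_integral => t; rewrite inE /= in_itv /= andbT => t0.
  by rewrite ger0_norm.
rewrite (@ge0_continuous_FTC2y R f F 0 0).
- rewrite /F mulr0 sin0 cos0 oppr0 expR0 mulr0 -EFinB; congr EFin.
  by field.
- by move=> x _; rewrite mulr_ge0 ?expR_ge0// -lerBlDl sub0r cos_geN1.
- apply: continuous_subspaceT => x; apply: cvgM; last first.
    by apply: cvgD; [exact: cvg_cst | exact: continuous_cosM].
  by apply: continuous_comp; [exact: opp_continuous | exact: continuous_expR].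
- apply/cvgr0Pnorm_le => e e0.
  pose C := `|a| + 1 + 1.
  have hb (t : R) : `|F t| <= expR (- t) * C.
    rewrite /F normrM gtr0_norm ?expR_gt0// ler_wpM2l ?expR_ge0//.
    apply: le_trans (ler_normB _ _) _; rewrite normr1 /C lerD2r.
    rewrite normrM normfV [`|1 + _|]ger0_norm ?addr_ge0 ?sqr_ge0//.
    rewrite ler_pdivrMr; last by rewrite ltr_pwDl// sqr_ge0.
    apply: (@le_trans _ _ (`|a| + 1)); last first.
      by rewrite ler_peMr ?addr_ge0// lerDl sqr_ge0.
    apply: le_trans (ler_normB _ _) _; apply: lerD.
      by rewrite normrM ler_piMr// ler_norml sin_geN1 sin_le1.
    by rewrite ler_norml cos_geN1 cos_le1.
  have C0 : 0 < C by rewrite /C ltr_pwDr// addr_ge0.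
  have h : (fun t : R => expR (- t) * C) @ +oo --> (0 : R).
    by rewrite -(mul0r C); apply: cvgM; [exact: cvgr_expR | exact: cvg_cst].
  move/cvgr0Pnorm_le : h => /(_ e e0); apply: filterS => t.
  by apply: le_trans; apply: le_trans (hb t) (ler_norm _).
- by move=> x _; exact: ex_derive.
- by apply: cvg_at_right_filter; exact: cF.
- by move=> x _; rewrite derive1E; exact: derive_val.
Qed.

Lemma integral_expRNnorm :
  leb.-integrable setT (EFin \o (fun t => expR (- `|t|))) /\
  \int[leb]_t expR (- `|t|) = 2.
Proof.
have [i e] := integral_expR_1Dcos 0.
have i1 : leb.-integrable setT (EFin \o (fun t => expR (- `|t|))).
  apply: le_integrable i => //.
    by apply/measurable_EFinP; exact: measurable_expRNnorm.
  move=> t _ /=; rewrite mul0r cos0 lee_fin normrM ler_peMr// ger0_norm ?addr_ge0//.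
  by rewrite lerDl.
split=> //; apply: (@mulIf _ 2); first by rewrite pnatr_eq0.
rewrite -RintegralZr//.
have -> : \int[leb]_t (expR (- `|t|) * 2) = \int[leb]_t (expR (- `|t|) * (1 + cos (0 * t))).
  by apply: eq_Rintegral => t _; rewrite mul0r cos0.
by rewrite e; field.
Qed.

Lemma integral_expRNnorm_cos (a : R) :
  \int[leb]_t (expR (- `|t|) * cos (a * t)) = 2 / (1 + a ^+ 2).
Proof.
have [i e] := integral_expR_1Dcos a; have [i1 e1] := integral_expRNnorm.
have -> : \int[leb]_t (expR (- `|t|) * cos (a * t)) =
    \int[leb]_t (expR (- `|t|) * (1 + cos (a * t)) - expR (- `|t|)).
  by apply: eq_Rintegral => t _; ring.
by rewrite RintegralB// e e1; ring.
Qed.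

Let ge0_integral_opp (F : R -> \bar R) : measurable_fun setT F ->
  (forall x, 0 <= F x)%E -> (\int[leb]_x F x = 1%:E * \int[leb]_x F (- x)%R)%E.
Proof.
move=> mF F0; have n10 : (-1 : R) != 0 by rewrite oppr_eq0 oner_eq0.
rewrite (ge0_integral_affine 0 n10)//.
rewrite normrN1; congr (_ * _)%E; apply: eq_integral => x _.
by rewrite mulN1r addr0.
Qed.

(** The cosine part is elementary and the sine part vanishes by parity. *)
Lemma Cintegral_poisson (a : R) :
  Cintegrable leb (fun t => (expR (- `|t|))%:C * expi (a * t)) /\
  Cintegral leb (fun t => (expR (- `|t|))%:C * expi (a * t)) = (2 / (1 + a ^+ 2))%:C.
Proof.
have [i1 _] := integral_expRNnorm.
have mF : Cmeasurable (fun t : R => (expR (- `|t|))%:C * expi (a * t)).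
  apply: CmeasurableM.
    by apply: Cmeasurable_real; exact: measurable_expRNnorm.
  by apply: Cmeasurable_expi; exact: measurable_funM.
have iF : Cintegrable leb (fun t => (expR (- `|t|))%:C * expi (a * t)).
  apply: (@Cintegrable_dominated _ (measurableTypeR R) R leb _ (fun t => expR (- `|t|) * 2)) => //.
    by apply: eq_integrable (integrableZr measurableT 2 i1).
  by move=> t; rewrite norm1cMr ger0_norm ?expR_ge0// ler_wpM2l ?expR_ge0// norm1c_expi.
split=> //; apply: complex_ext.
  rewrite /= -integral_expRNnorm_cos; apply: eq_Rintegral => t _.
  by rewrite mul0r subr0.
(* reflecting [t] conjugates the integrand, so that the imaginary part of the integral
   is its own opposite *)
have := @Cintegral_transfer _ _ _ _ R leb leb -%R 1 ge0_integral_opp _ mF.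
have -> : (fun t : R => (expR (- `|- t|))%:C * expi (a * - t)) =
    (fun t => conjc ((expR (- `|t|))%:C * expi (a * t))).
  apply/funext => t; rewrite normrN mulrN expiN; apply: complex_ext.
    by rewrite Re_conjc !ReM Re_conjc Im_conjc /= !mul0r.
  by rewrite Im_conjc !ImM Re_conjc Im_conjc /= !mul0r !addr0 mulrN.
have iFc : Cintegrable leb (fun t => conjc ((expR (- `|t|))%:C * expi (a * t))).
  apply: Cintegrable_dominated (integrable_norm1c iF) _; first exact: Cmeasurable_conj.
  by move=> t; rewrite norm1c_conj.
move=> /(_ iFc); rewrite mul1r Cintegral_conj// => /(congr1 (@complex.Im R)).
by rewrite Im_conjc /=; lra.
Qed.

Lemma integral_poisson :
  leb.-integrable setT (EFin \o (fun y => 2 / (1 + (- (2 * pi) * y) ^+ 2))) /\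
  \int[leb]_y (2 / (1 + (- (2 * pi) * y) ^+ 2)) = 1.
Proof.
have p0 : 0 < (2 * pi : R) by rewrite mulr_gt0// pi_gt0.
have [i e] := integral_oneDsqrV.
pose g (x : R) : R := (1 + x ^+ 2)^-1.
have mg : Cmeasurable (fun x => (g x)%:C).
  by apply: Cmeasurable_real; exact: measurable_oneDsqrV.
have aff (F : R -> \bar R) : measurable_fun setT F -> (forall x, 0 <= F x)%E ->
    (\int[leb]_x F x = (2 * pi)%:E * \int[leb]_x F (- (2 * pi) * x)%R)%E.
  move=> mF F0; rewrite (@ge0_integral_affine R (- (2 * pi)) 0)//; last first.
    by rewrite oppr_eq0 gt_eqF.
  rewrite normrN gtr0_norm//; congr (_ * _)%E; apply: eq_integral => x _.
  by rewrite addr0.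
have ig : Cintegrable leb (fun x => (g x)%:C).
  split => //=; by apply: eq_integrable (integrable0 leb setT).
have mphi : measurable_fun [set: measurableTypeR R] (fun x : R => - (2 * pi) * x).
  by apply: measurable_funM.
have ig' := (@Cintegrable_transfer _ _ (measurableTypeR R) (measurableTypeR R) R
  leb leb _ _ mphi p0 aff _ mg).1 ig.
have := @Cintegral_transfer _ _ (measurableTypeR R) (measurableTypeR R) R leb leb _ _ aff _ mg ig'.
rewrite !Cintegral_real e => /(congr1 (@complex.Re R)) /=; rewrite mul0r subr0 => e2.
have ig2 : leb.-integrable setT (EFin \o (fun x : R => g (- (2 * pi) * x))) by case: ig'.
split; first by apply: eq_integrable (integrableZl measurableT 2 ig2).
rewrite RintegralZl//; apply: (@mulfI _ pi); first by rewrite gt_eqF// pi_gt0.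
by rewrite mulr1 [RHS]e2 /g; ring.
Qed.

End Poisson1D.

Section PoissonTuple.
Context (R : realType) (n : nat).
Local Notation lebt := (lebesgue_tuple R).
Implicit Types x y : 'cV[R]_n.

Lemma dotvE x y : dotv x y = \sum_i x i 0 * y i 0.
Proof. by rewrite /dotv mxE; apply: eq_bigr => i _; rewrite mxE. Qed.

Lemma dotvC x y : dotv x y = dotv y x.
Proof. by rewrite !dotvE; apply: eq_bigr => i _; rewrite mulrC. Qed.

(** The Abel factor and the Poisson kernel form a Fourier pair that can be computed
    by elementary means; they serve as approximate unit in the inversion formula. *)
Definition abel x : R := \prod_i expR (- `|x i 0|).

Definition poisson y : R := \prod_i (2 / (1 + (- (2 * pi) * y i 0) ^+ 2)).

(** The integrable majorant against which all Schwartz functions are compared. *)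
Definition weight x : R := \prod_i (1 + x i 0 ^+ 2)^-1.

Let prod_real (h : 'I_n -> R) : (\prod_i (h i)%:C : R[i]) = (\prod_i h i)%:C.
Proof. by rewrite rmorph_prod. Qed.

Let real_tuple (h : R -> R) :
  (@lebesgue_measure R).-integrable setT (EFin \o h) ->
  (lebt n).-integrable setT (EFin \o (fun t => \prod_i h (tnth t i))) /\
  \int[lebt n]_t (\prod_i h (tnth t i)) = \prod_(i < n) \int[lebesgue_measure]_x h x.
Proof.
move=> ih; have ihC : Cintegrable lebesgue_measure (fun x : R => (h x)%:C).
  by split => //=; apply: eq_integrable (integrable0 lebesgue_measure setT).
have [] := Cprod_tuple (fun _ : 'I_n => ihC).
under eq_fun do rewrite prod_real; move=> [i1 _].
rewrite !Cintegral_real prod_real => /(congr1 (@complex.Re R)) /= e.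
by split.
Qed.

Lemma integrable_weight : (lebt n).-integrable setT (EFin \o (fun t => weight (cvec t))).
Proof.
have [i _] := integral_oneDsqrV R; have [i1 _] := real_tuple i.
by apply: eq_integrable i1 => // t _ /=; congr EFin; apply: eq_bigr => j _; rewrite mxE.
Qed.

Lemma integrable_poisson :
  (lebt n).-integrable setT (EFin \o (fun t => poisson (cvec t))).
Proof.
have [i _] := integral_poisson R; have [i1 _] := real_tuple i.
by apply: eq_integrable i1 => // t _ /=; congr EFin; apply: eq_bigr => j _; rewrite mxE.
Qed.

Lemma integral_poisson_tuple : \int[lebt n]_t poisson (cvec t) = 1.
Proof.
have [i e] := integral_poisson R; have [_ e1] := real_tuple i.
transitivity (\prod_(i < n) (1 : R)); last by rewrite big1.
under [RHS]eq_bigr do rewrite -e.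
rewrite -e1; apply: eq_Rintegral => t _.
by apply: eq_bigr => j _; rewrite mxE.
Qed.

Lemma fourier_abel y :
  Vintegrable (fun x => (abel x)%:C * expi (- (2 * pi) * dotv x y)) /\
  intRn (fun x => (abel x)%:C * expi (- (2 * pi) * dotv x y)) = (poisson y)%:C.
Proof.
have [] := Cprod_tuple (fun i : 'I_n => (Cintegral_poisson (- (2 * pi) * y i 0)).1).
have -> : (fun t : n.-tuple R => \prod_(i < n) ((expR (- `|tnth t i|))%:C *
     expi (- (2 * pi) * y i 0 * tnth t i))) =
    (fun t => (abel (cvec t))%:C * expi (- (2 * pi) * dotv (cvec t) y)).
  apply/funext => t; rewrite big_split /= prod_real -expi_sum; congr (_%:C * expi _).
    by apply: eq_bigr => i _; rewrite mxE.
  rewrite dotvE mulr_sumr; apply: eq_bigr => i _; rewrite mxE; ring.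
move=> i1 e1; split=> //; rewrite /intRn e1 -prod_real.
by apply: eq_bigr => i _; rewrite (Cintegral_poisson _).2.
Qed.

Lemma Vintegrable_abel : Vintegrable (fun x => (abel x)%:C).
Proof.
have [+ _] := fourier_abel 0; congr Vintegrable; apply/funext => x.
rewrite dotvE big1 ?mulr0 ?expi0 ?mulr1// => i _; by rewrite mxE mulr0.
Qed.

Lemma abel_ge0 x : 0 <= abel x.
Proof. by apply: prodr_ge0 => i _; exact: expR_ge0. Qed.

Lemma abel_le1 x : abel x <= 1.
Proof.
apply: (@le_trans _ _ (\prod_(i < n) 1)); last by rewrite big1.
by apply: ler_prod => i _; rewrite expR_ge0 -expR0 ler_expR oppr_le0 normr_ge0.
Qed.

Lemma poisson_ge0 y : 0 <= poisson y.
Proof.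
by apply: prodr_ge0 => i _; rewrite divr_ge0// addr_ge0// sqr_ge0.
Qed.

Lemma weight_gt0 x : 0 < weight x.
Proof.
by apply: prodr_gt0 => i _; rewrite invr_gt0 ltr_pwDl// sqr_ge0.
Qed.

End PoissonTuple.

(** * Directional derivatives *)

Section DirectionalDerivative.
Context (R : realType) (n : nat).
Implicit Types (f g : 'cV[R]_n -> R[i]) (x v : 'cV[R]_n) (d : R[i]).

(** Complex numbers are treated as a pair of reals here, since the derivatives of
    the Schwartz space are those of the real and imaginary parts. *)
Definition cderive f v x d :=
  is_derive x v (fun y => complex.Re (f y)) (complex.Re d) /\
  is_derive x v (fun y => complex.Im (f y)) (complex.Im d).

Lemma cderive_eq f v x d d' : cderive f v x d -> d = d' -> cderive f v x d'.
Proof. by move=> ? <-. Qed.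

Lemma cderive_cst d v x : cderive (fun=> d) v x 0.
Proof. by split; exact: is_derive_cst. Qed.

Lemma cderiveD f g v x d e : cderive f v x d -> cderive g v x e ->
  cderive (fun y => f y + g y) v x (d + e).
Proof.
move=> [f1 f2] [g1 g2]; split; rewrite ?ReD ?ImD.
  by under eq_fun do rewrite ReD; exact: is_deriveD.
by under eq_fun do rewrite ImD; exact: is_deriveD.
Qed.

Lemma cderiveM f g v x d e : cderive f v x d -> cderive g v x e ->
  cderive (fun y => f y * g y) v x (f x * e + g x * d).
Proof.
move=> [f1 f2] [g1 g2]; split.
  under eq_fun do rewrite ReM.
  apply: (is_derive_eq (is_deriveB (is_deriveM f1 g1) (is_deriveM f2 g2))).
  by rewrite !ReD !ReM /GRing.scale /=; ring.
under eq_fun do rewrite ImM.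
apply: (is_derive_eq (is_deriveD (is_deriveM f1 g2) (is_deriveM f2 g1))).
by rewrite !ImD !ImM /GRing.scale /=; ring.
Qed.

Lemma cderiveZ (c : R[i]) f v x d : cderive f v x d ->
  cderive (fun y => c * f y) v x (c * d).
Proof.
move=> df; apply: cderive_eq (cderiveM (cderive_cst c v x) df) _.
by rewrite mulr0 addr0.
Qed.

Lemma cderive_conj f v x d : cderive f v x d ->
  cderive (fun y => conjc (f y)) v x (conjc d).
Proof.
move=> [f1 f2]; split; rewrite ?Re_conjc ?Im_conjc.
  by under eq_fun do rewrite Re_conjc.
by under eq_fun do rewrite Im_conjc; exact: is_deriveN.
Qed.

Lemma cderive_real (h : 'cV[R]_n -> R) v x (e : R) : is_derive x v h e ->
  cderive (fun y => (h y)%:C) v x e%:C.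
Proof. by move=> dh; split => //=; exact: is_derive_cst. Qed.

Lemma is_derive_line (h : 'cV[R]_n -> R) v x (e : R) :
  is_derive x v h e <-> is_derive (0 : R) 1 (fun s => h (s *: v + x)) e.
Proof.
have E : (fun t : R => t^-1 *: (((fun s => h (s *: v + x)) \o shift (0 : R)) (t *: (1 : R))
     - h (0 *: v + x))) = (fun t : R => t^-1 *: ((h \o shift x) (t *: v) - h x)).
  apply/funext => t /=.
  by rewrite addr0 scale0r add0r [t *: 1]mulr1.
split => -[dh <-]; split.
- exact: (derivable1P h x v).1.
- by rewrite /derive E.
- exact: (derivable1P h x v).2.
- by rewrite /derive E.
Qed.

Lemma is_derive_comp (F : R -> R) (h : 'cV[R]_n -> R) v x (a e : R) :
  is_derive (h x) 1 F a -> is_derive x v h e ->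
  is_derive x v (F \o h) (a * e).
Proof.
move=> dF dh; apply/is_derive_line.
have dh' := (is_derive_line h v x e).1 dh.
apply: (@is_derive1_comp _ F (fun s => h (s *: v + x))) => //.
by rewrite scale0r add0r.
Qed.

Lemma cderive_expi (q : 'cV[R]_n -> R) v x (e : R) : is_derive x v q e ->
  cderive (fun y => expi (q y)) v x (expi (q x) * (e *i)).
Proof.
move=> dq; split.
  apply: is_derive_eq (is_derive_comp (is_derive_cos _) dq) _.
  by rewrite ReM /= mulr0 sub0r mulNr.
apply: is_derive_eq (is_derive_comp (is_derive_sin _) dq) _.
by rewrite ImM /= mulr0 addr0.
Qed.

Lemma is_derive_coord i v x :
  is_derive x v (fun y : 'cV[R]_n => y i 0) (v i 0).
Proof.
apply/is_derive_line.
have -> : (fun s : R => (s *: v + x) i 0) = (fun s => s * v i 0 + x i 0).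
  by apply/funext => s; rewrite !mxE.
by apply: is_derive_eq; rewrite /GRing.scale /=; ring.
Qed.

Lemma is_derive_affine (m : nat) (h : 'cV[R]_m -> R) (M : 'M[R]_(m, n)) (b : 'cV[R]_m)
    v x (e : R) : is_derive (M *m x + b) (M *m v) h e ->
  is_derive x v (fun y => h (M *m y + b)) e.
Proof.
have E : (fun t : R => t^-1 *: (((fun y => h (M *m y + b)) \o shift x) (t *: v)
    - h (M *m x + b))) =
    (fun t : R => t^-1 *: ((h \o shift (M *m x + b)) (t *: (M *m v)) - h (M *m x + b))).
  by apply/funext => t /=; rewrite mulmxDr -scalemxAr addrA.
by case=> [dh <-]; split; rewrite /derivable /derive E.
Qed.

Lemma is_derive_shift (h : 'cV[R]_n -> R) v x (s e : R) :
  is_derive (s *: v + x) v h e -> is_derive s 1 (fun t => h (t *: v + x)) e.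
Proof.
move=> /is_derive_line [dh <-].
have E : (fun t : R => t^-1 *: (((fun t => h (t *: v + x)) \o shift s) (t *: (1 : R))
    - h (s *: v + x))) =
  (fun t : R => t^-1 *: (((fun t => h (t *: v + (s *: v + x))) \o shift (0 : R))
    (t *: (1 : R)) - h (0 *: v + (s *: v + x)))).
  apply/funext => t /=; rewrite addr0 scale0r add0r [t *: 1]mulr1.
  by rewrite scalerDl addrA.
by split; [move: dh; rewrite /derivable E | rewrite /derive E].
Qed.

(** The intermediate point is located through its absolute value only, so that both
    signs of [s] are covered at once. *)
Lemma mean_value_line (h dh : 'cV[R]_n -> R) v x (s : R) :
  (forall y, is_derive y v h (dh y)) ->
  exists2 t : R, `|t| <= `|s| & h (s *: v + x) - h x = dh (t *: v + x) * s.
Proof.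
move=> dhP; pose g (t : R) := h (t *: v + x).
have dg (t : R) : is_derive t 1 g (dh (t *: v + x)) by exact: is_derive_shift.
have cg : continuous g.
  by move=> t; apply/differentiable_continuous/derivable1_diffP; case: (dg t).
have [s0|s0] := leP 0 s.
  have [t] := MVT_segment s0 (fun t _ => dg t) (continuous_subspaceT cg).
  rewrite in_itv /= => /andP[t0 ts] e; exists t; first by rewrite !ger0_norm.
  by rewrite -[X in dh X * s]/(t *: v + x) -[in RHS](subr0 s) -e /g scale0r add0r.
have [t] := MVT_segment (ltW s0) (fun t _ => dg t) (continuous_subspaceT cg).
rewrite in_itv /= => /andP[ts t0] e; exists t; first by rewrite !ler0_norm ?lerN2// ltW.
move: e; rewrite /g scale0r add0r sub0r mulrN => e.
by rewrite -opprB e opprK.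
Qed.

(** Quadratic error bounds survive integration: with this criterion integrals depending
    on a parameter are differentiated without any limit theorem. *)
Lemma is_derive_taylor (h : 'cV[R]_n -> R) v x (e C : R) :
  (forall s : R, `|s| <= 1 -> `|h (s *: v + x) - h x - s * e| <= C * s ^+ 2) ->
  is_derive x v h e.
Proof.
move=> hC.
have C0 : 0 <= C.
  have := hC 1; rewrite normr1 expr1n mulr1 => /(_ (lexx _)).
  exact: le_trans.
have cv : (fun t : R => t^-1 *: ((h \o shift x) (t *: v) - h x)) @ 0^' --> e.
  apply/cvgrPdist_le => /= eps eps0.
  have d0 : 0 < Num.min 1 (eps / (C + 1)).
    by rewrite lt_min ltr01 divr_gt0// ltr_wpDl.
  near=> t.
  have tn0 : t != 0 by near: t; exact: nbhs_dnbhs_neq.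
  have tmin : `|t| < Num.min 1 (eps / (C + 1)).
    by near: t; exact: dnbhs0_lt.
  move: tmin; rewrite lt_min => /andP[t1 teps].
  have := hC t (ltW t1).
  rewrite -[t ^+ 2]real_normK ?num_real// => ht.
  have -> : e - t^-1 *: (h (t *: v + x) - h x) =
      - (t^-1 * (h (t *: v + x) - h x - t * e)).
    by rewrite /GRing.scale /=; field.
  rewrite normrN normrM normfV ler_pdivrMl ?normr_gt0//.
  apply: le_trans ht _; rewrite expr2 mulrA mulrC ler_wpM2l//.
  apply: (@le_trans _ _ (C * (eps / (C + 1)))); first by rewrite ler_wpM2l// ltW.
  by rewrite mulrCA ler_piMr ?(ltW eps0)// ler_pdivrMr ?mul1r ?lerDl// ltr_wpDl.
split; first by apply/cvg_ex; exists e.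
exact: (cvg_lim _ cv).
Unshelve. all: by end_near. Qed.

End DirectionalDerivative.

(** * The Schwartz space *)

Section GradientDirection.
Context (R : realType) (n : nat).

Lemma norm_delta_mx_le (i : 'I_n) : `|delta_mx i 0 : 'cV[R]_n| <= 1.
Proof.
rewrite [leLHS]mx_normrE; apply: bigmax_le => //= -[j k] _ /=.
by rewrite !mxE; case: (_ && _); rewrite ?normr1// normr0.
Qed.

Let is_derive_dirD (h dh : 'cV[R]_n -> R) (k : 'I_n) (c : R) (w x : 'cV[R]_n) (d : R) :
  (forall y, is_derive y (delta_mx k 0) h (dh y)) -> {for x, continuous dh} ->
  is_derive x w h d -> is_derive x (c *: delta_mx k 0 + w) h (c * dh x + d).
Proof.
move=> hdh cdh [dw <-]; set e : 'cV[R]_n := delta_mx k 0.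
have cv : (fun t : R => t^-1 *: ((h \o shift x) (t *: (c *: e + w)) - h x)) @ 0^' -->
    c * dh x + 'D_w h x.
  have -> : (fun t : R => t^-1 *: ((h \o shift x) (t *: (c *: e + w)) - h x)) =
      (fun t : R => t^-1 *: (h ((t * c) *: e + (t *: w + x)) - h (t *: w + x))) \+
      (fun t : R => t^-1 *: ((h \o shift x) (t *: w) - h x)).
    by apply/funext => t /=; rewrite -scalerDr addrA subrK (scalerDr t) scalerA addrA.
  apply: cvgD => //.
  apply/cvgrPdist_le => /= eps eps0.
  have eps'0 : 0 < eps / (`|c| + 1) by rewrite divr_gt0// ltr_wpDl.
  have /cvgrPdist_le/(_ _ eps'0)/nbhs_ballP[r /= r0 hr] := cdh.
  have den0 : 0 < `|c| + `|w| + 1 by rewrite ltr_wpDl// addr_ge0.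
  near=> t.
  have tn0 : t != 0 by near: t; exact: nbhs_dnbhs_neq.
  have tr : `|t| < r / (`|c| + `|w| + 1).
    by near: t; apply: dnbhs0_lt; rewrite divr_gt0.
  have [s sle ->] := mean_value_line (t *: w + x) (t * c) hdh.
  have -> : c * dh x - t^-1 *: (dh (s *: e + (t *: w + x)) * (t * c)) =
      c * (dh x - dh (s *: e + (t *: w + x))).
    by rewrite /GRing.scale /=; field.
  rewrite normrM; apply: (@le_trans _ _ (`|c| * (eps / (`|c| + 1)))).
    rewrite ler_wpM2l//; apply: hr; rewrite -ball_normE /=.
    have -> : x - (s *: e + (t *: w + x)) = - (s *: e + t *: w).
      by rewrite addrA opprD addrCA subrr addr0.
    rewrite normrN; apply: le_lt_trans (ler_normD _ _) _; rewrite !normrZ.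
    apply: (@le_lt_trans _ _ (`|t| * (`|c| + `|w|))).
      rewrite mulrDr lerD2r -normrM; apply: le_trans sle.
      by rewrite ler_piMr// norm_delta_mx_le.
    move: tr; rewrite ltr_pdivlMr//; apply: le_lt_trans.
    by rewrite ler_wpM2l// lerDl.
  by rewrite mulrCA ler_piMr ?(ltW eps0)// ler_pdivrMr ?mul1r ?lerDl// ltr_wpDl.
split; first by apply/cvg_ex; exists (c * dh x + 'D_w h x).
exact: (cvg_lim _ cv).
Unshelve. all: by end_near. Qed.

(** One coordinate is moved at a time, with the mean value theorem in that
    coordinate; continuity of the partial derivatives brings the intermediate points
    back to [x]. *)
Lemma is_derive_gradient (h : 'cV[R]_n -> R) (dh : 'I_n -> 'cV[R]_n -> R) v x :
  (forall i y, is_derive y (delta_mx i 0) h (dh i y)) ->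
  (forall i, continuous (dh i)) ->
  is_derive x v h (\sum_i v i 0 * dh i x).
Proof.
move=> hdh cdh.
have vE : v = \sum_i v i 0 *: delta_mx i 0.
  rewrite [LHS]matrix_sum_delta; apply: eq_bigr => i _.
  by rewrite big_ord_recl big_ord0 addr0.
rewrite {1}vE; elim: (index_enum _) => [|i s ih].
  by rewrite !big_nil; exact: is_derive0.
by rewrite !big_cons; apply: is_derive_dirD => //; exact: cdh.
Qed.

End GradientDirection.

Section StableClass.
Context (R : realType) (n : nat).
Implicit Types (f g : 'cV[R]_n -> R[i]) (x v : 'cV[R]_n).
Local Notation fct := ('cV[R]_n -> R[i]).

Definition ccontinuous f :=
  continuous (fun x => complex.Re (f x)) /\ continuous (fun x => complex.Im (f x)).

Lemma ccontinuous_cst (c : R[i]) : ccontinuous (fun=> c).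
Proof. by split; exact: cst_continuous. Qed.

Lemma ccontinuousD f g : ccontinuous f -> ccontinuous g ->
  ccontinuous (fun x => f x + g x).
Proof.
move=> [f1 f2] [g1 g2]; split.
  by under eq_fun do rewrite ReD; move=> x; exact: (cvgD (f1 x) (g1 x)).
by under eq_fun do rewrite ImD; move=> x; exact: (cvgD (f2 x) (g2 x)).
Qed.

Lemma ccontinuousM f g : ccontinuous f -> ccontinuous g ->
  ccontinuous (fun x => f x * g x).
Proof.
move=> [f1 f2] [g1 g2]; split.
  under eq_fun do rewrite ReM; move=> x.
  exact: (cvgB (cvgM (f1 x) (g1 x)) (cvgM (f2 x) (g2 x))).
under eq_fun do rewrite ImM; move=> x.
exact: (cvgD (cvgM (f1 x) (g2 x)) (cvgM (f2 x) (g1 x))).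
Qed.

Lemma ccontinuous_conj f : ccontinuous f -> ccontinuous (fun x => conjc (f x)).
Proof.
move=> [f1 f2]; split; first by under eq_fun do rewrite Re_conjc.
by under eq_fun do rewrite Im_conjc; move=> x; exact: (cvgN (f2 x)).
Qed.

Lemma ccontinuous_real (h : 'cV[R]_n -> R) : continuous h ->
  ccontinuous (fun x => (h x)%:C).
Proof. by move=> ch; split=> //; exact: cst_continuous. Qed.

(** A class of functions that decay faster than any polynomial and that is
    closed under partial derivatives consists of Schwartz functions; each
    closure property of the Schwartz space is proved by exhibiting such a
    class, with no induction on multi-indices. *)
Definition stable (K : fct -> Prop) := forall g, K g ->
  [/\ ccontinuous g,
   forall i, exists2 g', K g' & forall x, cderive g (delta_mx i 0) x (g' x) &
   forall alpha, exists M : R, forall x, norm1c ((mpow x alpha)%:C * g x) <= M].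

Lemma stable_schwartz (K : fct -> Prop) g : stable K -> K g -> schwartz g.
Proof.
move=> sK Kg.
have P s : exists2 g', K g' &
    partials s (fun x => complex.Re (g x)) = (fun x => complex.Re (g' x)) /\
    partials s (fun x => complex.Im (g x)) = (fun x => complex.Im (g' x)).
  elim: s => [|i s [g' Kg' [e1 e2]]]; first by exists g.
  have [_ /(_ i)[g'' Kg'' d] _] := sK _ Kg'; exists g'' => //=.
  by split; apply/funext => x; rewrite ?e1 ?e2; have [d1 d2] := d x; exact: derive_val.
have B g' : K g' -> forall alpha, exists M, forall x,
    norm1c ((mpow x alpha)%:C * g' x) <= M by move=> /sK[].
split.
- move=> s; have [g' Kg' [-> _]] := P s; have [[c _] d _] := sK _ Kg'; split=> // i x.
  by have [g'' _ /(_ x)[[]]] := d i.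
- move=> alpha s; have [g' Kg' [-> _]] := P s; have [M hM] := B _ Kg' alpha.
  exists M => x; apply: le_trans (hM x); apply: le_trans (Re_le_norm1c _).
  by rewrite ReM /= mul0r subr0.
- move=> s; have [g' Kg' [_ ->]] := P s; have [[_ c] d _] := sK _ Kg'; split=> // i x.
  by have [g'' _ /(_ x)[_ []]] := d i.
- move=> alpha s; have [g' Kg' [_ ->]] := P s; have [M hM] := B _ Kg' alpha.
  exists M => x; apply: le_trans (hM x); apply: le_trans (Im_le_norm1c _).
  by rewrite ImM /= mul0r addr0.
Qed.

Definition pderiv (i : 'I_n) f : fct := fun x =>
  'D_(delta_mx i 0) (fun y => complex.Re (f y)) x +i*
  'D_(delta_mx i 0) (fun y => complex.Im (f y)) x.

Lemma pderivP f i x : schwartz f -> cderive f (delta_mx i 0) x (pderiv i f x).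
Proof.
move=> [s1 _ s2 _]; split; apply: derivableP.
  exact: (s1 [::]).2.
exact: (s2 [::]).2.
Qed.

Lemma schwartz_pderiv f i : schwartz f -> schwartz (pderiv i f).
Proof.
have E s (h : 'cV[R]_n -> R) : partials s (fun x => 'D_(delta_mx i 0) h x) =
    partials (rcons s i) h by rewrite /partials foldr_rcons.
move=> [s1 r1 s2 r2]; split => /=.
- by move=> s; have := s1 (rcons s i); rewrite -E.
- by move=> alpha s; have := r1 alpha (rcons s i); rewrite -E.
- by move=> s; have := s2 (rcons s i); rewrite -E.
- by move=> alpha s; have := r2 alpha (rcons s i); rewrite -E.
Qed.

Lemma schwartz_stable : stable (@schwartz R n).
Proof.
move=> f sf; split.
- by have [s _ t _] := sf; split; [exact: (s [::]).1 | exact: (t [::]).1].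
- move=> i; exists (pderiv i f); first exact: schwartz_pderiv.
  by move=> x; exact: pderivP.
- move=> alpha; have [_ r1 _ r2] := sf.
  have [M1 h1] := r1 alpha [::]; have [M2 h2] := r2 alpha [::].
  exists (M1 + M2) => x; rewrite norm1cMr mulrDr -!normrM.
  by apply: lerD; [exact: h1 | exact: h2].
Qed.

Lemma schwartz_continuous f : schwartz f -> ccontinuous f.
Proof. by move=> /schwartz_stable[]. Qed.

Lemma schwartzD f g : schwartz f -> schwartz g -> schwartz (fun x => f x + g x).
Proof.
move=> sf sg; pose K h := exists f1 f2, [/\ schwartz f1, schwartz f2 &
  h = fun x => f1 x + f2 x].
apply: (@stable_schwartz K); last by exists f, g.
move=> _ [f1 [f2 [s1 s2 ->]]].
have [c1 _ b1] := schwartz_stable s1; have [c2 _ b2] := schwartz_stable s2.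
split; first exact: ccontinuousD.
- move=> i; exists (fun x => pderiv i f1 x + pderiv i f2 x).
    by exists (pderiv i f1), (pderiv i f2); split=> //; exact: schwartz_pderiv.
  by move=> x; apply: cderiveD; exact: pderivP.
- move=> alpha; have [M1 h1] := b1 alpha; have [M2 h2] := b2 alpha.
  exists (M1 + M2) => x; rewrite mulrDr.
  by apply: le_trans (norm1cD _ _) _; exact: lerD.
Qed.

Lemma schwartzZ (c : R[i]) f : schwartz f -> schwartz (fun x => c * f x).
Proof.
move=> sf; pose K h := exists2 f1, schwartz f1 & h = fun x => c * f1 x.
apply: (@stable_schwartz K); last by exists f.
move=> _ [f1 s1 ->]; have [c1 _ b1] := schwartz_stable s1.
split; first exact: ccontinuousM (ccontinuous_cst c) c1.
- move=> i; exists (fun x => c * pderiv i f1 x).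
    by exists (pderiv i f1) => //; exact: schwartz_pderiv.
  by move=> x; apply: cderiveZ; exact: pderivP.
- move=> alpha; have [M h] := b1 alpha; exists (norm1c c * M) => x.
  rewrite mulrCA; apply: le_trans (norm1cM _ _) _.
  by rewrite ler_wpM2l ?norm1c_ge0.
Qed.

Lemma schwartz_sum (I : Type) (s : seq I) (F : I -> fct) :
  (exists f, schwartz f) -> (forall i, schwartz (F i)) ->
  schwartz (fun x => \sum_(i <- s) F i x).
Proof.
move=> [f sf] sF; elim: s => [|i s ih].
  have := schwartzZ 0 sf; congr schwartz; apply/funext => x.
  by rewrite mul0r big_nil.
have := schwartzD (sF i) ih; congr schwartz; apply/funext => x.
by rewrite big_cons.
Qed.

Lemma schwartz_conj f : schwartz f -> schwartz (fun x => conjc (f x)).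
Proof.
move=> sf; pose K h := exists2 f1, schwartz f1 & h = fun x => conjc (f1 x).
apply: (@stable_schwartz K); last by exists f.
move=> _ [f1 s1 ->]; have [c1 _ b1] := schwartz_stable s1; split.
- exact: ccontinuous_conj.
- move=> i; exists (fun x => conjc (pderiv i f1 x)).
    by exists (pderiv i f1) => //; exact: schwartz_pderiv.
  by move=> x; apply: cderive_conj; exact: pderivP.
- move=> alpha; have [M h] := b1 alpha; exists M => x.
  by rewrite norm1cMr norm1c_conj -norm1cMr.
Qed.

Lemma schwartz_coord f (i : 'I_n) : schwartz f ->
  schwartz (fun x => (x i 0)%:C * f x).
Proof.
move=> sf; pose K h := exists f1 f2, [/\ schwartz f1, schwartz f2 &
  h = fun x => f1 x + (x i 0)%:C * f2 x].
apply: (@stable_schwartz K); last first.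
  exists (fun x => 0 * f x), f; split=> //; first exact: schwartzZ.
  by apply/funext => x; rewrite mul0r add0r.
move=> _ [f1 [f2 [s1 s2 ->]]].
have [c1 _ b1] := schwartz_stable s1; have [c2 _ b2] := schwartz_stable s2.
split.
- apply: ccontinuousD c1 _; apply: ccontinuousM c2.
  by apply: ccontinuous_real; exact: coord_continuous.
- move=> j; exists (fun x => pderiv j f1 x + ((delta_mx j 0 : 'cV[R]_n) i 0)%:C * f2 x
    + (x i 0)%:C * pderiv j f2 x).
    exists (fun x => pderiv j f1 x + ((delta_mx j 0 : 'cV[R]_n) i 0)%:C * f2 x), (pderiv j f2).
    split=> //; last exact: schwartz_pderiv.
    by apply: schwartzD; [exact: schwartz_pderiv | exact: schwartzZ].
  move=> x; apply: cderive_eq; first apply: cderiveD (pderivP j x s1) _.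
    apply: cderiveM (pderivP j x s2); apply: cderive_real; exact: is_derive_coord.
  by rewrite -addrA; congr (_ + _); rewrite addrC; congr (_ + _); rewrite mulrC.
- move=> alpha; have [M1 h1] := b1 alpha.
  have [M2 h2] := b2 (fun k => (alpha k + (k == i))%N).
  exists (M1 + M2) => x; rewrite mulrDr; apply: le_trans (norm1cD _ _) _.
  apply: lerD => //; apply: le_trans (h2 x).
  rewrite mulrA -rmorphM; have -> // : mpow x alpha * x i 0 =
    mpow x (fun k => (alpha k + (k == i))%N).
  rewrite /mpow; under [RHS]eq_bigr do rewrite exprD.
  rewrite big_split /=; congr (_ * _).
  rewrite (bigD1 i)//= eqxx expr1 big1 ?mulr1// => k /negPf ->.
  by rewrite expr0.
Qed.

(** Stability under multiplication by coordinates turns plain boundedness into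
    decay faster than any polynomial, which is how decay is checked for most
    classes. *)
Lemma closed_decay (K : fct -> Prop) :
  (forall g i, K g -> K (fun x => (x i 0)%:C * g x)) ->
  (forall g, K g -> exists M : R, forall x, norm1c (g x) <= M) ->
  forall g alpha, K g -> exists M : R, forall x, norm1c ((mpow x alpha)%:C * g x) <= M.
Proof.
move=> KX Kb g alpha Kg; apply: Kb; rewrite /mpow.
have KXn k i h : K h -> K (fun x => (x i 0 ^+ k)%:C * h x).
  move=> Kh; elim: k => [|k ih].
    by rewrite (_ : (fun x => _) = h)//; apply/funext => x; rewrite expr0 mul1r.
  have := KX _ i ih; congr K; apply/funext => x.
  by rewrite exprS rmorphM mulrA.
elim: (index_enum _) => [|i s ih].
  by rewrite (_ : (fun x => _) = g)//; apply/funext => x; rewrite big_nil mul1r.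
have := KXn (alpha i) i _ ih; congr K; apply/funext => x.
by rewrite big_cons rmorphM mulrA.
Qed.

Lemma schwartz_bounded f : schwartz f -> exists M : R, forall x, norm1c (f x) <= M.
Proof.
move=> /schwartz_stable[_ _ /(_ (fun=> 0%N))[M h]]; exists M => x.
have := h x; rewrite (_ : mpow _ _ = 1) ?mul1r// /mpow big1// => i _.
Qed.

(** The product of the polynomials [1 + x_i ^ 2] with [f] is again a Schwartz
    function, hence bounded. *)
Lemma schwartz_weight f : schwartz f ->
  exists M : R, forall x, norm1c (f x) <= M * weight x.
Proof.
move=> sf; pose p x : R := \prod_i (1 + x i 0 ^+ 2).
have : schwartz (fun x => (p x)%:C * f x).
  rewrite /p; elim: (index_enum _) => [|i s ih].
    by rewrite (_ : (fun x => _) = f)//; apply/funext => x; rewrite big_nil mul1r.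
  have := schwartzD ih (schwartz_coord i (schwartz_coord i ih)).
  congr schwartz; apply/funext => x.
  by rewrite big_cons !rmorphM rmorphD rmorphXn /= rmorph1; ring.
move=> /schwartz_bounded [M h]; exists M => x.
have p0 : 0 < p x by apply: prodr_gt0 => i _; rewrite ltr_pwDl// sqr_ge0.
have := h x; rewrite norm1cMr gtr0_norm// /weight prodfV -/(p x).
by rewrite ler_pdivlMr// mulrC.
Qed.

End StableClass.

(** * Measurability of continuous functions *)

Section ContinuousMeasurable.
Context (R : realType) (n : nat).

Lemma continuous_sumf (T : topologicalType) (I : Type) (s : seq I) (F : I -> T -> R) :
  (forall i, continuous (F i)) -> continuous (fun x => \sum_(i <- s) F i x).
Proof.
move=> cF; elim: s => [|i s ih].
  by under eq_fun do rewrite big_nil; exact: cst_continuous.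
by under eq_fun do rewrite big_cons; move=> x; exact: (cvgD (cF i x) (ih x)).
Qed.

Lemma continuous_compose (T U V : topologicalType) (f : T -> U) (g : U -> V) :
  continuous f -> continuous g -> continuous (fun x => g (f x)).
Proof. by move=> cf cg x; apply: continuous_comp; [exact: cf | exact: cg]. Qed.

Lemma continuous_cV (T : topologicalType) (h : T -> 'cV[R]_n) :
  (forall i, continuous (fun t => h t i 0)) -> continuous h.
Proof.
move=> ch t; apply/cvgrPdist_lt => e e0.
have : \forall s \near t, forall i, `|h t i 0 - h s i 0| < e.
  by apply: filter_forall => i; move/cvgrPdist_lt : (ch i t); exact.
apply: filterS => s hs; rewrite [ltLHS]mx_normrE; apply: bigmax_lt => //= -[i j] _ /=.
by rewrite !mxE ord1.
Qed.

Lemma continuous_affine m (M : 'M[R]_(n, m)) (b : 'cV[R]_n) :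
  continuous (fun x : 'cV[R]_m => M *m x + b).
Proof.
apply: continuous_cV => i.
have -> : (fun x : 'cV[R]_m => (M *m x + b) i 0) =
    (fun x => \sum_j M i j * x j 0 + b i 0) by apply/funext => x; rewrite !mxE.
have cs : continuous (fun x : 'cV[R]_m => \sum_j M i j * x j 0).
  apply: continuous_sumf => j x.
  exact: (cvgM (cvg_cst (M i j)) (@coord_continuous R m 1 j 0 x)).
by move=> x; exact: (cvgD (cs x) (cvg_cst _)).
Qed.

Lemma measurable_cvec_ball (q : 'cV[R]_n) (r : R) :
  measurable [set t : n.-tuple R | ball q r (cvec t)].
Proof.
have [r0|r0] := leP r 0.
  rewrite (_ : [set _ | _] = set0)// -subset0 => t /=.
  by rewrite -ball_normE /= => /lt_le_trans/(_ r0); rewrite normr_lt0.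
rewrite (_ : [set _ | _] = \bigcap_(i in [set: 'I_n])
    [set t : n.-tuple R | `|q i 0 - tnth t i| < r]).
  apply: fin_bigcap_measurable; [exact: finite_finset | move=> i _].
  have mi : measurable_fun setT (fun t : n.-tuple R => `|q i 0 - tnth t i|).
    apply: measurableT_comp => //; apply: measurable_funB => //.
    exact: measurable_tnth.
  have := mi measurableT `]-oo, r[%classic (measurable_itv _).
  by rewrite setTI; congr measurable; apply/seteqP; split => t /=; rewrite in_itv.
apply/seteqP; split => t /=; rewrite -ball_normE /= [X in X < r]mx_normrE.
  move=> h i _ /=; apply: le_lt_trans h.
  have := @le_bigmax _ _ _ 0 (fun ij => `|(q - cvec t) ij.1 ij.2|) (i, 0).
  by rewrite /= !mxE.
move=> h; apply: bigmax_lt => // -[i j] _ /=; rewrite !mxE ord1; exact: h.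
Qed.

(** Open sets of the vector topology are countable unions of balls with
    rational data, whence they are measurable in the product structure. *)
Lemma measurable_cvec_open (V : set 'cV[R]_n) : open V ->
  measurable (@cvec R n @^-1` V).
Proof.
move=> oV; pose B (p : 'cV[rat]_n * nat) : set (n.-tuple R) :=
  [set t | ball (map_mx ratr p.1 : 'cV[R]_n) (p.2.+1%:R^-1) (cvec t)].
pose D := [set p : 'cV[rat]_n * nat |
  ball (map_mx ratr p.1 : 'cV[R]_n) (p.2.+1%:R^-1) `<=` V].
rewrite (_ : _ @^-1` V = \bigcup_(p in D) B p).
  rewrite bigcup_mkcond; apply: countable_bigcupT_measurable; first exact: countableP.
  by move=> p; case: ifPn => _ //; exact: measurable_cvec_ball.
apply/seteqP; split => [t Vt|t [p Dp Bp]]; last exact: Dp.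
have [e /= e0 hV] := (nbhs_ballP _ _).1 (open_nbhs_nbhs (conj oV Vt)).
have [k hk] : exists k : nat, (k.+1%:R^-1 : R) < e / 2.
  have := @near_infty_natSinv_lt R (PosNum (divr_gt0 e0 (ltr0n _ 2))).
  by move=> [N _ hN]; exists N; apply: (hN N) => /=.
set r : R := k.+1%:R^-1 in hk.
have r0 : 0 < r by rewrite invr_gt0 ltr0n.
have /choice[q hq] : forall i : 'I_n, exists q : rat, `|ratr q - cvec t i 0| < r.
  move=> i; have : cvec t i 0 - r < cvec t i 0 + r by rewrite ltrD2l gtrN.
  move=> /rat_in_itvoo[q]; rewrite in_itv /= => /andP[h1 h2]; exists q.
  by rewrite ltr_norml ltrBrDr ltrBlDr addrC h1 addrC h2.
have bq : ball (map_mx ratr (\col_i q i) : 'cV[R]_n) r (cvec t).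
  rewrite -ball_normE /= [X in X < r]mx_normrE; apply: bigmax_lt => // -[i j] _ /=.
  by have := hq i; rewrite !mxE.
exists (\col_i q i, k) => //= y /= by_; apply: hV.
have := ball_triangle (ball_sym bq) by_; apply: le_ball.
by rewrite (splitr e); apply: lerD; exact: ltW.
Qed.

Lemma continuous_cvec_measurable (h : 'cV[R]_n -> R) : continuous h ->
  measurable_fun setT (fun t : n.-tuple R => h (cvec t)).
Proof.
move=> /continuousP ch; apply: (measurability _ (RGenOpens.measurableE R)).
move=> _ [_ [a [b ->] <-]]; rewrite setTI.
exact: (measurable_cvec_open (ch _ (interval_open _ _))).
Qed.

Lemma ccontinuous_Vmeasurable (f : 'cV[R]_n -> R[i]) : ccontinuous f -> Vmeasurable f.
Proof.
move=> [f1 f2]; split.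
  exact: (@continuous_cvec_measurable (fun x => complex.Re (f x))).
exact: (@continuous_cvec_measurable (fun x => complex.Im (f x))).
Qed.

End ContinuousMeasurable.

(** * Closure properties of the Schwartz space *)

Section SchwartzClosure.
Context (R : realType) (n : nat).
Implicit Types (f g : 'cV[R]_n -> R[i]) (x v : 'cV[R]_n).
Local Notation fct := ('cV[R]_n -> R[i]).

Lemma schwartz_measurable f : schwartz f -> Vmeasurable f.
Proof. by move=> sf; apply: ccontinuous_Vmeasurable; exact: schwartz_continuous. Qed.

Lemma Vintegrable_weight f (M : R) : Vmeasurable f ->
  (forall x, norm1c (f x) <= M * weight x) -> Vintegrable f.
Proof.
move=> mf fM.
apply: (@Cintegrable_dominated _ _ _ _ _ (fun t => M * weight (cvec t))) => //.
by apply: eq_integrable (integrableZl _ M (integrable_weight R n)).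
Qed.

Lemma schwartz_integrable f : schwartz f -> Vintegrable f.
Proof.
move=> sf; have [M hM] := schwartz_weight sf.
exact: Vintegrable_weight (schwartz_measurable sf) hM.
Qed.

Lemma schwartz_linear (a : 'I_n -> R) (b : R) f : schwartz f ->
  schwartz (fun x => (\sum_j a j * x j 0 + b)%:C * f x).
Proof.
move=> sf; have s1 : schwartz (fun x => \sum_j ((a j)%:C * ((x j 0)%:C * f x))).
  apply: schwartz_sum; first by exists f.
  by move=> j; apply: schwartzZ; exact: schwartz_coord.
have := schwartzD s1 (schwartzZ b%:C sf); congr schwartz; apply/funext => x.
rewrite rmorphD mulrDl rmorph_sum mulr_suml; congr (_ + _).
by apply: eq_bigr => j _; rewrite rmorphM mulrA.
Qed.

(** By the Leibniz rule, the finite sums of products of Schwartz functions form a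
    class closed under differentiation. *)
Inductive product_span : fct -> Prop :=
| product_span_mul f g h : schwartz f -> schwartz g ->
    (forall x, h x = f x * g x) -> product_span h
| product_span_add h1 h2 h : product_span h1 -> product_span h2 ->
    (forall x, h x = h1 x + h2 x) -> product_span h.

Lemma schwartzM f g : schwartz f -> schwartz g -> schwartz (fun x => f x * g x).
Proof.
move=> sf sg; apply: (@stable_schwartz _ _ product_span); last exact: product_span_mul sf sg _.
move=> h Kh; split.
- elim: Kh => [f1 g1 h1 sf1 sg1 /funext ->|h1 h2 h3 _ ih1 _ ih2 /funext ->].
    by apply: ccontinuousM; exact: schwartz_continuous.
  exact: ccontinuousD.
- move=> i; elim: Kh => [f1 g1 h1 sf1 sg1 /funext ->|h1 h2 h3 _ ih1 _ ih2 /funext ->].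
    exists (fun x => f1 x * pderiv i g1 x + g1 x * pderiv i f1 x).
      apply: (@product_span_add (fun x => f1 x * pderiv i g1 x)
        (fun x => g1 x * pderiv i f1 x)) => //.
        exact: (product_span_mul sf1 (schwartz_pderiv i sg1)).
      exact: (product_span_mul sg1 (schwartz_pderiv i sf1)).
    by move=> x; apply: cderiveM; exact: pderivP.
  have [d1 K1 D1] := ih1; have [d2 K2 D2] := ih2.
  exists (fun x => d1 x + d2 x); first exact: product_span_add K1 K2 _.
  by move=> x; exact: cderiveD.
- move=> alpha; apply: (closed_decay _ _ _ Kh) => {h Kh alpha}.
    move=> h i; elim => [f1 g1 h1 sf1 sg1 E|h1 h2 h3 _ ih1 _ ih2 E].
      by apply: (product_span_mul (schwartz_coord i sf1) sg1) => x; rewrite E mulrA.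
    by apply: (product_span_add ih1 ih2) => x; rewrite E mulrDr.
  move=> h; elim => [f1 g1 h1 sf1 sg1 E|h1 h2 h3 _ [M1 b1] _ [M2 b2] E].
    have [M1 b1] := schwartz_bounded sf1; have [M2 b2] := schwartz_bounded sg1.
    exists (M1 * M2) => x; rewrite E; apply: le_trans (norm1cM _ _) _.
    by apply: ler_pM; rewrite ?norm1c_ge0.
  by exists (M1 + M2) => x; rewrite E; apply: le_trans (norm1cD _ _) _; exact: lerD.
Qed.

Lemma cderive_affine (M : 'M[R]_n) (b : 'cV[R]_n) f i x : schwartz f ->
  cderive (fun y => f (M *m y + b)) (delta_mx i 0) x
    (\sum_j ((M j i)%:C * pderiv j f (M *m x + b))).
Proof.
move=> sf.
have Mi j : (M *m delta_mx i 0 : 'cV[R]_n) j 0 = M j i.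
  by rewrite -colE mxE.
have ReS (F : 'I_n -> R[i]) : complex.Re (\sum_j F j) = \sum_j complex.Re (F j).
  by apply: (big_morph _ (@ReD R)).
have ImS (F : 'I_n -> R[i]) : complex.Im (\sum_j F j) = \sum_j complex.Im (F j).
  by apply: (big_morph _ (@ImD R)).
have [dR dI] : (forall j y, is_derive y (delta_mx j 0)
    (fun y => complex.Re (f y)) (complex.Re (pderiv j f y))) /\
  (forall j y, is_derive y (delta_mx j 0)
    (fun y => complex.Im (f y)) (complex.Im (pderiv j f y))).
  by split=> j y; case: (pderivP j y sf).
have cR j := (schwartz_continuous (schwartz_pderiv j sf)).1.
have cI j := (schwartz_continuous (schwartz_pderiv j sf)).2.
split.
  apply: (@is_derive_affine _ _ _ (fun y => complex.Re (f y))).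
  apply: (is_derive_eq (is_derive_gradient _ _ dR cR)).
  by rewrite ReS; apply: eq_bigr => j _; rewrite Mi ReM /= mul0r subr0.
apply: (@is_derive_affine _ _ _ (fun y => complex.Im (f y))).
apply: (is_derive_eq (is_derive_gradient _ _ dI cI)).
by rewrite ImS; apply: eq_bigr => j _; rewrite Mi ImM /= mul0r addr0.
Qed.

(** In terms of [y = M x + b] the coordinates of [x] are affine functions, so that
    multiplying by them preserves the class of pullbacks. *)
Lemma schwartz_affine (M : 'M[R]_n) (b : 'cV[R]_n) f : M \in unitmx -> schwartz f ->
  schwartz (fun x => f (M *m x + b)).
Proof.
move=> uM sf; pose K h := exists2 f1, schwartz f1 & h = fun x => f1 (M *m x + b).
apply: (@stable_schwartz _ _ K); last by exists f.
have K_coord g i : K g -> K (fun x => (x i 0)%:C * g x).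
  move=> [f1 s1 ->]; pose N := invmx M.
  exists (fun y : 'cV[R]_n => (\sum_j N i j * y j 0 + - (N *m b) i 0)%:C * f1 y).
    exact: schwartz_linear.
  apply/funext => x; congr (_%:C * _).
  have -> : \sum_j N i j * (M *m x + b) j 0 = (N *m (M *m x + b)) i 0 by rewrite mxE.
  by rewrite mulmxDr mulKmx// [in RHS]mxE addrK.
have K_bounded g : K g -> exists B : R, forall x, norm1c (g x) <= B.
  by move=> [f1 s1 ->]; have [B hB] := schwartz_bounded s1; exists B.
move=> g Kg; have [f1 s1 ->] := Kg.
have [c1 c2] := schwartz_continuous s1; split.
- split; first exact: (continuous_compose (@continuous_affine R n n M b) c1).
  exact: (continuous_compose (@continuous_affine R n n M b) c2).
- move=> i; exists (fun x => \sum_j ((M j i)%:C * pderiv j f1 (M *m x + b))).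
    exists (fun y => \sum_j ((M j i)%:C * pderiv j f1 y)) => //.
    apply: schwartz_sum; first by exists f.
    by move=> j; apply: schwartzZ; exact: schwartz_pderiv.
  by move=> x; exact: cderive_affine.
- by move=> alpha; apply: (closed_decay K_coord K_bounded); exists f1.
Qed.

Lemma schwartz_linmap (M : 'M[R]_n) f : M \in unitmx -> schwartz f ->
  schwartz (fun x => f (M *m x)).
Proof.
move=> uM sf; have := schwartz_affine 0 uM sf.
by congr schwartz; apply/funext => x; rewrite addr0.
Qed.

Lemma schwartz_scale (c : R) (b : 'cV[R]_n) f : c != 0 -> schwartz f ->
  schwartz (fun x => f (c *: x + b)).
Proof.
move=> c0 sf; have := schwartz_affine b (unitmx_scale n c0) sf.
by congr schwartz; apply/funext => x; rewrite mul_scalar_mx.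
Qed.

Definition quadratic (L : 'M[R]_n) (b : 'cV[R]_n) x : R := dotv x (L *m x) + dotv b x.

Lemma dotvDl (x y z : 'cV[R]_n) : dotv (x + y) z = dotv x z + dotv y z.
Proof. by rewrite /dotv linearD mulmxDl mxE. Qed.

Lemma dotvDr (x y z : 'cV[R]_n) : dotv x (y + z) = dotv x y + dotv x z.
Proof. by rewrite /dotv mulmxDr mxE. Qed.

Lemma dotvZl (c : R) (x y : 'cV[R]_n) : dotv (c *: x) y = c * dotv x y.
Proof. by rewrite /dotv linearZ -scalemxAl mxE. Qed.

Lemma dotvZr (c : R) (x y : 'cV[R]_n) : dotv x (c *: y) = c * dotv x y.
Proof. by rewrite /dotv -scalemxAr mxE. Qed.

Lemma continuous_dotv m (M N : 'M[R]_(n, m)) (a b : 'cV[R]_n) :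
  continuous (fun x : 'cV[R]_m => dotv (M *m x + a) (N *m x + b)).
Proof.
under eq_fun do rewrite dotvE.
apply: continuous_sumf => j x.
have h1 := continuous_compose (@continuous_affine R n m M a) (@coord_continuous R n 1 j 0).
have h2 := continuous_compose (@continuous_affine R n m N b) (@coord_continuous R n 1 j 0).
exact: (cvgM (h1 x) (h2 x)).
Qed.

Lemma continuous_quadratic (L : 'M[R]_n) (b : 'cV[R]_n) : continuous (quadratic L b).
Proof.
have -> : quadratic L b = (fun x => dotv (1%:M *m x + 0) (L *m x + 0) +
    dotv (0 *m x + b) (1%:M *m x + 0)).
  by apply/funext => x; rewrite !mul1mx mul0mx !addr0 add0r.
move=> x.
exact: (cvgD (@continuous_dotv _ 1%:M L 0 0 x) (@continuous_dotv _ 0 1%:M b 0 x)).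
Qed.

(** Along a line the second-order remainder of a quadratic function is exact. *)
Lemma is_derive_quadratic (L : 'M[R]_n) (b : 'cV[R]_n) (i : 'I_n) x :
  is_derive x (delta_mx i 0) (quadratic L b) (\sum_j (L i j + L j i) * x j 0 + b i 0).
Proof.
set e : 'cV[R]_n := delta_mx i 0.
have dote y : dotv e y = y i 0.
  rewrite dotvE (bigD1 i)//= mxE !eqxx mul1r big1 ?addr0// => j ji.
  by rewrite mxE (negPf ji) mul0r.
apply: (@is_derive_taylor _ _ _ _ _ _ `|dotv e (L *m e)|) => s _.
have -> : \sum_j (L i j + L j i) * x j 0 = dotv e (L *m x) + dotv x (L *m e).
  rewrite dote mxE dotvE -big_split; apply: eq_bigr => j _.
  by rewrite mulrDl -colE mxE; congr (_ + _); rewrite mulrC.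
have -> : b i 0 = dotv b e by rewrite dotvC dote.
rewrite /quadratic mulmxDr -scalemxAr !(dotvDl, dotvDr, dotvZl, dotvZr).
set A := dotv e _; set B := dotv e (L *m x).
rewrite [X in `|X|](_ : _ = A * s ^+ 2); last by ring.
by rewrite normrM [`|s ^+ 2|]ger0_norm ?sqr_ge0.
Qed.

(** A derivative of the phase is an affine function, so differentiating
    [expi q * f] gives [expi q] times another Schwartz function. *)
Lemma schwartz_chirp (L : 'M[R]_n) (b : 'cV[R]_n) f : schwartz f ->
  schwartz (fun x => expi (quadratic L b x) * f x).
Proof.
move=> sf; pose q := quadratic L b.
pose K h := exists2 f1, schwartz f1 & h = fun x => expi (q x) * f1 x.
apply: (@stable_schwartz _ _ K); last by exists f.
move=> _ [f1 s1 ->]; have [c1 _ b1] := schwartz_stable s1; split.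
- apply: ccontinuousM c1; split => x /=.
    by apply: continuous_comp; [exact: continuous_quadratic | exact: continuous_cos].
  by apply: continuous_comp; [exact: continuous_quadratic | exact: continuous_sin].
- move=> i; pose l x := \sum_j (L i j + L j i) * x j 0 + b i 0.
  exists (fun x => expi (q x) * (pderiv i f1 x + 'i%C * ((l x)%:C * f1 x))).
    exists (fun x => pderiv i f1 x + 'i%C * ((l x)%:C * f1 x)) => //.
    apply: schwartzD; first exact: schwartz_pderiv.
    by apply: schwartzZ; exact: schwartz_linear.
  move=> x; apply: cderive_eq.
    exact: (cderiveM (cderive_expi (is_derive_quadratic L b i x)) (pderivP i x s1)).
  rewrite mulrDr; congr (_ + _); rewrite -/(l x).
  have -> : (l x) *i = 'i%C * (l x)%:C :> R[i].
    by apply: complex_ext; rewrite ?ReM ?ImM /=; ring.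
  by rewrite -/q; ring.
- move=> alpha; have [M h] := b1 alpha; exists (2 * M) => x.
  rewrite mulrCA; apply: le_trans (norm1cM _ _) _.
  by apply: ler_pM; rewrite ?norm1c_ge0 ?norm1c_expi.
Qed.

Lemma schwartz_modulation (b : 'cV[R]_n) f : schwartz f ->
  schwartz (fun x => expi (dotv b x) * f x).
Proof.
move=> sf; have := schwartz_chirp 0 b sf.
by congr schwartz; apply/funext => x; rewrite /quadratic mul0mx /dotv mulmx0 mxE add0r.
Qed.

End SchwartzClosure.

(** * The Fourier transform on the Schwartz space *)

Section Fourier.
Context (R : realType) (n : nat).
Implicit Types (f g : 'cV[R]_n -> R[i]) (x y xi : 'cV[R]_n).
Local Notation fct := ('cV[R]_n -> R[i]).
Local Notation tau := (- (2 * pi : R)).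
Local Notation mu := (lebesgue_tuple R n).

Definition fourier g : fct := fun xi => intRn (fun x => g x * expi (tau * dotv x xi)).

Lemma eq_intRn f g : f =1 g -> intRn f = intRn g.
Proof. by move=> /funext ->. Qed.

Lemma vmeasurable_cst_dotv xi : measurable_fun setT (fun t : n.-tuple R => dotv (cvec t) xi).
Proof. by apply: measurable_dotv; [exact: vmeasurable_cvec | exact: vmeasurable_cst]. Qed.

Lemma Vmeasurable_modulation g (c : R) xi : Vmeasurable g ->
  Vmeasurable (fun x => g x * expi (c * dotv x xi)).
Proof.
move=> mg; apply: CmeasurableM => //; apply: Cmeasurable_expi.
by apply: measurable_funM => //; exact: vmeasurable_cst_dotv.
Qed.

Lemma Vintegrable_dominated f g (c : R) : Vmeasurable f -> Vintegrable g ->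
  (forall x, norm1c (f x) <= c * norm1c (g x)) -> Vintegrable f.
Proof.
move=> mf ig fg.
apply: (@Cintegrable_dominated _ _ _ _ _ (fun t => c * norm1c (g (cvec t)))) => //.
by apply: eq_integrable (integrableZl _ c (integrable_norm1c ig)).
Qed.

Lemma Vintegrable_modulation g (c : R) xi : Vintegrable g ->
  Vintegrable (fun x => g x * expi (c * dotv x xi)).
Proof.
move=> ig; apply: (@Vintegrable_dominated _ g 2) => //.
  by apply: Vmeasurable_modulation; exact: Cintegrable_measurable ig.
move=> x; apply: le_trans (norm1cM _ _) _.
by rewrite mulrC ler_wpM2r ?norm1c_ge0 ?norm1c_expi.
Qed.

Lemma schwartz_mod g (c : R) xi : schwartz g ->
  schwartz (fun x => g x * expi (c * dotv x xi)).
Proof.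
move=> sg; have := schwartz_modulation (c *: xi) sg.
by congr schwartz; apply/funext => x; rewrite mulrC dotvZl dotvC.
Qed.

Lemma norm1c_intRn_le f g (c : R) : Vintegrable f -> Vintegrable g ->
  (forall x, norm1c (f x) <= c * norm1c (g x)) ->
  norm1c (intRn f) <= c * \int[mu]_t norm1c (g (cvec t)).
Proof.
move=> iF iG fg; rewrite -RintegralZl//; last exact: integrable_norm1c.
apply: norm1c_Cintegral_le => //.
by apply: eq_integrable (integrableZl _ c (integrable_norm1c iG)).
Qed.

Lemma intRnD f g : Vintegrable f -> Vintegrable g ->
  intRn (fun x => f x + g x) = intRn f + intRn g.
Proof. exact: CintegralD. Qed.

Lemma intRnB f g : Vintegrable f -> Vintegrable g ->
  intRn (fun x => f x - g x) = intRn f - intRn g.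
Proof. exact: CintegralB. Qed.

Lemma intRnZ (c : R[i]) f : Vintegrable f -> intRn (fun x => c * f x) = c * intRn f.
Proof. exact: CintegralZ. Qed.

Lemma VintegrableZ (c : R[i]) f : Vintegrable f -> Vintegrable (fun x => c * f x).
Proof. exact: CintegrableZ. Qed.

Lemma VintegrableB f g : Vintegrable f -> Vintegrable g ->
  Vintegrable (fun x => f x - g x).
Proof. exact: CintegrableB. Qed.

Lemma fourier_bounded g : Vintegrable g ->
  exists M : R, forall xi, norm1c (fourier g xi) <= M.
Proof.
move=> ig; exists (2 * \int[mu]_t norm1c (g (cvec t))) => xi.
apply: norm1c_intRn_le => //; first exact: Vintegrable_modulation.
move=> x; apply: le_trans (norm1cM _ _) _.
by rewrite mulrC ler_wpM2r ?norm1c_ge0 ?norm1c_expi.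
Qed.

Lemma dotv_le x y : `|dotv x y| <= \sum_i `|x i 0| * `|y|.
Proof.
rewrite dotvE; apply: le_trans (ler_norm_sum _ _ _) _; apply: ler_sum => i _.
rewrite normrM ler_wpM2l// [leRHS]mx_normrE.
exact: (@le_bigmax _ _ _ 0 (fun ij => `|y ij.1 ij.2|) (i, 0)).
Qed.

Lemma lipschitz_continuous (h : 'cV[R]_n -> R) (C : R) :
  (forall x y, `|h (x + y) - h x| <= C * `|y|) -> continuous h.
Proof.
move=> hC x; apply/(@cvgrPdist_le _ _ _ _ (nbhs_filter x)) => e e0.
have d0 : 0 < e / (`|C| + 1) by rewrite divr_gt0// ltr_wpDl.
near=> y.
have -> : h x - h y = - (h (x + (y - x)) - h x) by rewrite [x + _]addrC subrK opprB.
rewrite normrN; apply: le_trans (hC _ _) _.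
have : `|x - y| <= e / (`|C| + 1) by near: y; exact: cvgr_dist_le.
rewrite distrC ler_pdivlMr ?ltr_wpDl// => h1.
apply: le_trans h1; rewrite mulrDr mulr1 mulrC.
apply: le_trans (ler_wpM2l _ (ler_norm C)) _ => //.
by rewrite lerDl.
Unshelve. all: by end_near. Qed.

(** The exponential is Lipschitz in the frequency, with a constant that grows linearly
    in [x]; first moments of [g] being finite, the transform is Lipschitz. *)
Lemma schwartz_fourier_continuous g : schwartz g -> ccontinuous (fourier g).
Proof.
move=> sg; have ig := schwartz_integrable sg.
have iX i : Vintegrable (fun x => (x i 0)%:C * g x).
  exact: schwartz_integrable (schwartz_coord i sg).
pose C := \sum_i (6 * `|tau| * \int[mu]_t norm1c ((cvec t i 0)%:C * g (cvec t))).
have L xi eta : norm1c (fourier g (xi + eta) - fourier g xi) <= C * `|eta|.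
  rewrite /fourier -intRnB; try exact: Vintegrable_modulation.
  rewrite /C mulr_suml.
  pose G (t : n.-tuple R) : R :=
    \sum_i 6 * `|tau| * `|eta| * norm1c ((cvec t i 0)%:C * g (cvec t)).
  have iG i : mu.-integrable setT (EFin \o (fun t =>
      6 * `|tau| * `|eta| * norm1c ((cvec t i 0)%:C * g (cvec t)))).
    by apply: eq_integrable (integrableZl _ _ (integrable_norm1c (iX i))).
  have eG : \int[mu]_t G t = \sum_i (6 * `|tau| *
      \int[mu]_t norm1c ((cvec t i 0)%:C * g (cvec t))) * `|eta| /\
      mu.-integrable setT (EFin \o G).
    rewrite /G; elim: (index_enum _) => [|i s [ihe ihi]].
      rewrite big_nil; split.
        by under eq_Rintegral do rewrite big_nil; rewrite Rintegral_cst// mul0r.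
      apply: eq_integrable (integrable0 mu setT) => // t _ /=; by rewrite big_nil.
    split.
      under eq_Rintegral do rewrite big_cons.
      rewrite RintegralD// ihe big_cons; congr (_ + _).
      rewrite RintegralZl//; last exact: integrable_norm1c (iX i).
      by rewrite mulrAC.
    apply: eq_integrable (integrableD _ (iG i) ihi) => // t _ /=.
    by rewrite big_cons EFinD.
  have [<- iG'] := eG.
  apply: norm1c_Cintegral_le iG' _.
    by apply: CintegrableB; exact: Vintegrable_modulation.
  move=> t; rewrite -mulrBr dotvDr (mulrDr tau) expiD -[X in _ * (_ - X)]mulr1 -mulrBr mulrA.
  apply: le_trans (norm1cM _ _) _.
  apply: (@le_trans _ _ (norm1c (g (cvec t)) * 2 * (3 * `|tau * dotv (cvec t) eta|))).
    apply: ler_pM; rewrite ?norm1c_ge0 ?expi_lipschitz//.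
    apply: le_trans (norm1cM _ _) _.
    by rewrite ler_wpM2l ?norm1c_ge0 ?norm1c_expi.
  apply: (@le_trans _ _ (norm1c (g (cvec t)) * 2 *
      (3 * (`|tau| * (\sum_i `|cvec t i 0| * `|eta|))))).
    rewrite ler_wpM2l ?mulr_ge0 ?norm1c_ge0// ler_wpM2l// normrM.
    by rewrite ler_wpM2l// dotv_le.
  rewrite /G !mulr_sumr; apply: ler_sum => i _; rewrite norm1cMr.
  by rewrite le_eqVlt; apply/orP; left; apply/eqP; ring.
split; apply: (@lipschitz_continuous _ C) => xi eta; apply: le_trans (L xi eta).
  by rewrite -ReN -ReD; exact: Re_le_norm1c.
by rewrite -ImN -ImD; exact: Im_le_norm1c.
Qed.

Lemma cderive_taylor f v x (d : R[i]) (C : R) :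
  (forall s : R, `|s| <= 1 ->
     norm1c (f (s *: v + x) - f x - s%:C * d) <= C * s ^+ 2) ->
  cderive f v x d.
Proof.
move=> hC; split; apply: (@is_derive_taylor _ _ _ _ _ _ C) => s s1;
  apply: le_trans (hC s s1).
  apply: le_trans (Re_le_norm1c _); rewrite !ReD !ReN ReM /= mul0r subr0.
  exact: lexx.
apply: le_trans (Im_le_norm1c _); rewrite !ImD !ImN ImM /= mul0r addr0.
exact: lexx.
Qed.

Lemma cderive_fourier g i xi : schwartz g ->
  cderive (fourier g) (delta_mx i 0) xi
    (fourier (fun x => (tau *i) * ((x i 0)%:C * g x)) xi).
Proof.
move=> sg; have ig := schwartz_integrable sg.
have sX := schwartz_coord i sg.
have iXX := schwartz_integrable (schwartz_coord i sX).
have iD := schwartz_integrable (schwartzZ (tau *i) sX).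
apply: (@cderive_taylor _ _ _ _
  (8 * tau ^+ 2 * \int[mu]_t norm1c ((cvec t i 0)%:C * ((cvec t i 0)%:C * g (cvec t))))).
move=> s _; rewrite /fourier -intRnB; try exact: Vintegrable_modulation.
rewrite -intRnZ; last exact: Vintegrable_modulation.
have i3 : Vintegrable (fun x => s%:C * ((tau *i) * ((x i 0)%:C * g x) *
    expi (tau * dotv x xi))).
  by apply: VintegrableZ; exact: Vintegrable_modulation.
have i12 : Vintegrable (fun x => g x * expi (tau * dotv x (s *: delta_mx i 0 + xi)) -
    g x * expi (tau * dotv x xi)).
  by apply: VintegrableB; exact: Vintegrable_modulation.
rewrite -intRnB// mulrAC.
apply: norm1c_intRn_le iXX _; first exact: VintegrableB.
move=> x.
have dote : dotv x (delta_mx i 0) = x i 0.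
  rewrite dotvE (bigD1 i)//= mxE !eqxx mulr1 big1 ?addr0// => j ji.
  by rewrite mxE (negPf ji) mulr0.
rewrite [X in norm1c X](_ : _ = g x * expi (tau * dotv x xi) *
    (expi (tau * (s * x i 0)) - 1 - ((tau * (s * x i 0)) *i))); last first.
  rewrite dotvDr dotvZr dote mulrDr expiD.
  have -> : (tau * (s * x i 0)) *i = s%:C * (tau *i) * (x i 0)%:C :> R[i].
    by apply: complex_ext; rewrite ?ReM ?ImM /=; ring.
  by ring.
apply: le_trans (norm1cM _ _) _.
apply: (@le_trans _ _ (norm1c (g x) * 2 * (4 * (tau * (s * x i 0)) ^+ 2))).
  apply: ler_pM; rewrite ?norm1c_ge0 ?expi_taylor//.
  apply: le_trans (norm1cM _ _) _.
  by rewrite ler_wpM2l ?norm1c_ge0 ?norm1c_expi.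
rewrite !norm1cMr [`|x i 0| * _]mulrA -expr2 real_normK ?num_real//.
by rewrite le_eqVlt; apply/orP; left; apply/eqP; ring.
Qed.

(** Displacements of length at most 1 change the majorant by a bounded factor, since
    [1 + a ^ 2 <= 3 * (1 + (t + a) ^ 2)] as soon as [t ^ 2 <= 1]. *)
Lemma weight_shift i (t : R) x : `|t| <= 1 ->
  weight (t *: delta_mx i 0 + x) <= 3 * weight x.
Proof.
move=> t1; rewrite /weight (bigD1 i)//= [in leRHS](bigD1 i)//= mulrA.
have -> : \prod_(j < n | j != i) (1 + (t *: delta_mx i 0 + x : 'cV[R]_n) j 0 ^+ 2)^-1 =
    \prod_(j < n | j != i) (1 + x j 0 ^+ 2)^-1.
  by apply: eq_bigr => j ji; rewrite !mxE (negPf ji) mulr0 add0r.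
apply: ler_wpM2r.
  by apply: prodr_ge0 => j _; rewrite invr_ge0 addr_ge0// sqr_ge0.
rewrite !mxE !eqxx mulr1; set a := x i 0.
have h1 : 0 < 1 + a ^+ 2 by rewrite ltr_pwDl// sqr_ge0.
have h2 : 0 < 1 + (t + a) ^+ 2 by rewrite ltr_pwDl// sqr_ge0.
rewrite -(ler_pM2r h2) mulVf ?gt_eqF// mulrAC -(ler_pM2r h1) mul1r mulrVK ?unitfE ?gt_eqF//.
have : t ^+ 2 <= 1 by rewrite -real_normK ?num_real// expr_le1.
have := sqr_ge0 (t + a + t); have := sqr_ge0 (t + a); rewrite !expr2; lra.
Qed.

Let taylor2 (h d1 d2 : 'cV[R]_n -> R) i (M : R) :
  (forall y, is_derive y (delta_mx i 0) h (d1 y)) ->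
  (forall y, is_derive y (delta_mx i 0) d1 (d2 y)) ->
  (forall y, `|d2 y| <= M * weight y) ->
  forall (s : R) x, `|s| <= 1 ->
  `|h (s *: delta_mx i 0 + x) - h x - s * d1 x| <= (3 * M * s ^+ 2) * weight x.
Proof.
move=> hd1 hd2 hM s x s1.
have [t ts ->] := mean_value_line x s hd1.
have -> : d1 (t *: delta_mx i 0 + x) * s - s * d1 x = s * (d1 (t *: delta_mx i 0 + x) - d1 x).
  by ring.
have [u ut ->] := mean_value_line x t hd2.
have M0 : 0 <= M.
  by have := le_trans (normr_ge0 _) (hM 0); rewrite pmulr_lge0// weight_gt0.
rewrite !normrM -[s ^+ 2]real_normK ?num_real//.
have u1 : `|u| <= 1 by apply: le_trans ut (le_trans ts s1).
have hw := weight_shift i x u1.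
apply: (@le_trans _ _ (`|s| * (M * (3 * weight x) * `|s|))).
  rewrite ler_wpM2l// ler_pM//; apply: le_trans (hM _) _.
  by rewrite ler_wpM2l.
by rewrite le_eqVlt; apply/orP; left; apply/eqP; ring.
Qed.

(** Translation invariance makes the integral of [h (x + s e_i) - h x] vanish,
    while its quotient by [s] tends to the integral of the derivative. *)
Lemma intRn_pderiv (h : fct) i : schwartz h -> intRn (pderiv i h) = 0.
Proof.
move=> sh; set e : 'cV[R]_n := delta_mx i 0.
have s1 := schwartz_pderiv i sh; have s2 := schwartz_pderiv i s1.
have ih := schwartz_integrable sh; have i1 := schwartz_integrable s1.
have [M hM] := schwartz_weight s2.
pose W := \int[mu]_t weight (cvec t).
have B (s : R) : `|s| <= 1 -> norm1c (s%:C * intRn (pderiv i h)) <= (6 * M * s ^+ 2) * W.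
  move=> ls; rewrite -norm1cN -sub0r.
  have <- : intRn (fun x => h (x + s *: e) - h x) = 0.
    by rewrite intRnB//; [rewrite intRn_translate// subrr | exact: Vintegrable_translate].
  have i2 : Vintegrable (fun x => h (x + s *: e) - h x).
    by apply: VintegrableB => //; exact: Vintegrable_translate.
  rewrite -intRnZ// -intRnB//; last exact: VintegrableZ.
  rewrite /W -RintegralZl//; last exact: integrable_weight.
  apply: norm1c_Cintegral_le.
  - exact: (VintegrableB i2 (VintegrableZ s%:C i1)).
  - by apply: eq_integrable (integrableZl _ _ (integrable_weight R n)).
  move=> t; rewrite [cvec t + _]addrC; set x := cvec t.
  have h1 : `|complex.Re (h (s *: e + x)) - complex.Re (h x) - s * complex.Re (pderiv i h x)|
      <= (3 * M * s ^+ 2) * weight x.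
    apply: (@taylor2 (fun y => complex.Re (h y)) (fun y => complex.Re (pderiv i h y))
      (fun y => complex.Re (pderiv i (pderiv i h) y))) => //.
    - by move=> y; case: (pderivP i y sh).
    - by move=> y; case: (pderivP i y s1).
    - by move=> y; apply: le_trans (Re_le_norm1c _) (hM y).
  have h2 : `|complex.Im (h (s *: e + x)) - complex.Im (h x) - s * complex.Im (pderiv i h x)|
      <= (3 * M * s ^+ 2) * weight x.
    apply: (@taylor2 (fun y => complex.Im (h y)) (fun y => complex.Im (pderiv i h y))
      (fun y => complex.Im (pderiv i (pderiv i h) y))) => //.
    - by move=> y; case: (pderivP i y sh).
    - by move=> y; case: (pderivP i y s1).
    - by move=> y; apply: le_trans (Im_le_norm1c _) (hM y).
  rewrite /norm1c !ReD !ImD !ReN !ImN ReM ImM.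
  rewrite [complex.Re s%:C]/= [complex.Im s%:C]/= !mul0r subr0 addr0.
  apply: le_trans (lerD h1 h2) _.
  by rewrite le_eqVlt; apply/orP; left; apply/eqP; ring.
apply: norm1c_eq0; apply/ler_addgt0Pr => eps eps0; rewrite add0r.
pose D := `|6 * M * W| + 1.
have D0 : 0 < D by rewrite ltr_wpDl.
pose s := Num.min 1 (eps / D).
have s0 : 0 < s by rewrite lt_min ltr01 divr_gt0.
have sle1 : `|s| <= 1 by rewrite gtr0_norm// ge_min lexx.
have := B s sle1; rewrite norm1cMr gtr0_norm//.
rewrite (_ : 6 * M * s ^+ 2 * W = s * (s * (6 * M * W))); last by ring.
rewrite ler_pM2l// => /le_trans; apply.
apply: (@le_trans _ _ (s * D)).
  rewrite ler_pM2l//; apply: le_trans (ler_norm _) _; by rewrite lerDl.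
by rewrite -ler_pdivlMr// ge_min lexx orbT.
Qed.

Lemma pderiv_unique f i x d : cderive f (delta_mx i 0) x d -> pderiv i f x = d.
Proof.
by move=> [d1 d2]; apply: complex_ext => /=; exact: derive_val.
Qed.

Lemma cderive_modulation (c : R) xi i x :
  cderive (fun y => expi (c * dotv y xi)) (delta_mx i 0) x
    (expi (c * dotv x xi) * ((c * xi i 0) *i)).
Proof.
have := cderive_expi (is_derive_quadratic 0 (c *: xi) i x).
have -> : quadratic 0 (c *: xi) = (fun y => c * dotv y xi).
  by apply/funext => y; rewrite /quadratic mul0mx {1}/dotv mulmx0 mxE add0r dotvZl dotvC.
by rewrite big1 => [|j _]; rewrite !mxE ?add0r ?mul0r.
Qed.

(** The integral of the derivative of [g x * expi (- 2 pi x . xi)] vanishes. *)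
Lemma fourier_pderiv g i xi : schwartz g ->
  fourier (pderiv i g) xi = - (tau * xi i 0) *i * fourier g xi.
Proof.
move=> sg; have ig := schwartz_integrable sg.
have ig1 := schwartz_integrable (schwartz_pderiv i sg).
have sh := schwartz_mod tau xi sg.
have := intRn_pderiv i sh.
rewrite (_ : pderiv i _ = fun x => ((tau * xi i 0) *i) * (g x * expi (tau * dotv x xi)) +
    pderiv i g x * expi (tau * dotv x xi)); last first.
  apply/funext => x; apply: pderiv_unique.
  apply: cderive_eq (cderiveM (pderivP i x sg) (cderive_modulation _ _ _ _)) _.
  by ring.
rewrite intRnD; last 2 first.
- by apply: VintegrableZ; exact: Vintegrable_modulation.
- exact: Vintegrable_modulation.
rewrite intRnZ; last exact: Vintegrable_modulation.
move/eqP; rewrite addrC addr_eq0 => /eqP; rewrite /fourier => ->.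
by rewrite -mulNr; congr (_ * _); apply: complex_ext; rewrite ?ReN ?ImN /= ?oppr0.
Qed.

Let tau0 : tau != 0.
Proof. by rewrite oppr_eq0 mulf_neq0 ?pnatr_eq0// gt_eqF// pi_gt0. Qed.

(** The transforms of Schwartz functions form a stable class, for the Fourier
    transform exchanges derivatives and multiplications by coordinates. *)
Lemma schwartz_fourier g : schwartz g -> schwartz (fourier g).
Proof.
move=> sg; pose K h := exists2 f, schwartz f & h = fourier f.
apply: (@stable_schwartz _ _ K); last by exists g.
have K_coord h i : K h -> K (fun x => (x i 0)%:C * h x).
  move=> [f sf ->]; exists (fun x => ((tau^-1) *i) * pderiv i f x).
    by apply: schwartzZ; exact: schwartz_pderiv.
  apply/funext => xi.
  have -> : fourier (fun x => (tau^-1 *i) * pderiv i f x) xi =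
      (tau^-1 *i) * fourier (pderiv i f) xi.
    rewrite /fourier -intRnZ; first by apply: eq_intRn => x; rewrite mulrA.
    by apply: Vintegrable_modulation; apply: schwartz_integrable; exact: schwartz_pderiv.
  rewrite fourier_pderiv// mulrA; congr (_ * _).
  move: tau0; generalize tau => t t0.
  by apply: complex_ext; rewrite ?ReM ?ImM /=; field; exact: t0.
have K_bounded h : K h -> exists B : R, forall x, norm1c (h x) <= B.
  by move=> [f sf ->]; apply: fourier_bounded; exact: schwartz_integrable.
move=> h Kh; split; last by move=> alpha; exact: (closed_decay K_coord K_bounded).
  by case: Kh => f sf ->; exact: schwartz_fourier_continuous.
move=> i; case: Kh => f sf ->.
exists (fourier (fun x => (tau *i) * ((x i 0)%:C * f x))).
  exists (fun x => (tau *i) * ((x i 0)%:C * f x)) => //.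
  by apply: schwartzZ; exact: schwartz_coord.
by move=> xi; exact: cderive_fourier.
Qed.

End Fourier.

(** * Fourier inversion and Parseval's identity *)

Section FourierInversion.
Context (R : realType) (n : nat).
Implicit Types (f g a b : 'cV[R]_n -> R[i]) (x y xi : 'cV[R]_n).
Local Notation tau := (- (2 * pi : R)).
Local Notation mu := (lebesgue_tuple R n).

Lemma fourier_multiplication a b : Vintegrable a -> Vintegrable b ->
  intRn (fun xi => fourier a xi * b xi) = intRn (fun x => a x * fourier b x).
Proof.
move=> ia ib.
pose F (p : n.-tuple R * n.-tuple R) : R[i] :=
  a (cvec p.1) * b (cvec p.2) * expi (tau * dotv (cvec p.1) (cvec p.2)).
have mF : Cmeasurable F.
  apply: CmeasurableM.
    exact: Cintegrable_measurable (Ctensor_integrable ia ib).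
  apply: Cmeasurable_expi; apply: measurable_funM => //; apply: measurable_dotv.
    by move=> i; exact: (measurableT_comp (vmeasurable_cvec i)).
  by move=> i; exact: (measurableT_comp (vmeasurable_cvec i)).
have iF : Cintegrable (mu \x mu)%E F.
  apply: (@Cintegrable_dominated _ _ _ _ _
    (fun p => norm1c (a (cvec p.1)) * norm1c (b (cvec p.2)) * 2)) => //.
    have h := integrable_tensor (integrable_norm1c ia) (integrable_norm1c ib).
    by apply: eq_integrable (integrableZr measurableT 2 h).
  move=> p; apply: le_trans (norm1cM _ _) _; apply: ler_pM; rewrite ?norm1c_ge0 ?norm1cM//.
  exact: norm1c_expi.
have := Fubini_Cintegral iF; rewrite /F /= => e.
transitivity (Cintegral mu (fun y : n.-tuple R =>
    Cintegral mu (fun x : n.-tuple R => F (x, y)))).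
  congr Cintegral; apply/funext => t.
  rewrite mulrC -intRnZ; last exact: Vintegrable_modulation.
  by congr Cintegral; apply/funext => s; rewrite /F /=; ring.
rewrite -[LHS]e; congr Cintegral; apply/funext => t.
rewrite -intRnZ; last exact: Vintegrable_modulation.
congr Cintegral; apply/funext => s; rewrite /F /= [dotv (cvec s) _]dotvC; ring.
Qed.

Lemma fourier_scale g (c : R) xi : 0 < c -> Vintegrable g ->
  (c ^+ n)%:C * fourier (fun x => g (c *: x)) (c *: xi) = fourier g xi.
Proof.
move=> c0 ig; have cn0 : c != 0 by rewrite gt_eqF.
rewrite /fourier (intRn_scale cn0 (Vintegrable_modulation tau xi ig)) gtr0_norm//.
by congr (_ * _); apply: eq_intRn => x; rewrite dotvZl dotvZr.
Qed.

(** The multiplication formula for the dilate of [g] and the Abel factor, whose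
    transform is the Poisson kernel; the dilation is moved to the Abel factor. *)
Lemma fourier_abel_dilate g (c : R) : 0 < c -> schwartz g ->
  intRn (fun xi => fourier g xi * (abel (c *: xi))%:C) =
  intRn (fun y => g (c *: y) * (poisson y)%:C).
Proof.
move=> c0 sg; have cn0 : c != 0 by rewrite gt_eqF.
have sgc : schwartz (fun x => g (c *: x)).
  by have := schwartz_scale 0 cn0 sg; congr schwartz; apply/funext => x; rewrite addr0.
have igc := schwartz_integrable sgc.
have -> : (fun y => g (c *: y) * (poisson y)%:C) =
    (fun y => g (c *: y) * fourier (fun x => (abel x)%:C) y).
  by apply/funext => y; rewrite /fourier (fourier_abel y).2.
rewrite -(fourier_multiplication igc (Vintegrable_abel R n)).
have iH : Vintegrable (fun xi => fourier (fun x => g (c *: x)) xi * (abel xi)%:C).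
  have [M hM] := fourier_bounded igc.
  apply: (@Vintegrable_dominated _ _ _ (fun x => (abel x)%:C) M).
  - apply: CmeasurableM; last exact: Cintegrable_measurable (Vintegrable_abel R n).
    exact: schwartz_measurable (schwartz_fourier sgc).
  - exact: Vintegrable_abel.
  - by move=> x; apply: le_trans (norm1cM _ _) _; rewrite ler_wpM2r ?norm1c_ge0.
rewrite (intRn_scale cn0 iH) gtr0_norm// -(intRnZ _ (Vintegrable_scale cn0 iH)).
apply: eq_intRn => xi; rewrite mulrA fourier_scale//; exact: schwartz_integrable.
Qed.

Let eps (k : nat) : R := k.+1%:R^-1.

Let eps_gt0 k : 0 < eps k. Proof. by rewrite invr_gt0 ltr0n. Qed.

Let cvg_eps_scale (h : 'cV[R]_n -> R) x : {for 0, continuous h} ->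
  (fun k => h (eps k *: x)) @ \oo --> h 0.
Proof.
move=> ch; have cx : (fun k => eps k *: x) @ \oo --> (0 *: x : 'cV[R]_n).
  by apply: cvgZr_tmp; exact: cvg_harmonic.
by rewrite scale0r in cx; exact: (cvg_comp _ _ cx ch).
Qed.

Lemma continuous_abel : continuous (@abel R n).
Proof.
rewrite /abel; elim: (index_enum _) => [|i s ih].
  by under eq_fun do rewrite big_nil; exact: cst_continuous.
under eq_fun do rewrite big_cons; move=> x.
have h := continuous_compose (@coord_continuous R n 1 i 0) (@continuous_expRNnorm R).
exact: (cvgM (h x) (ih x)).
Qed.

(** As [c] tends to 0 in the previous identity, the left member tends to the integral
    of the transform, because the Abel factor tends to 1, and the right one to
    [g 0] times the mass 1 of the Poisson kernel, both by dominated convergence. *)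
Theorem fourier_inversion0 g : schwartz g -> intRn (fourier g) = g 0.
Proof.
move=> sg; have sF := schwartz_fourier sg; have iF := schwartz_integrable sF.
have [M hM] := schwartz_bounded sg.
have [cg1 cg2] := schwartz_continuous sg.
have mabel : Vmeasurable (fun x : 'cV[R]_n => (abel x)%:C).
  exact: Cintegrable_measurable (Vintegrable_abel R n).
have abel0 : abel (0 : 'cV[R]_n) = 1.
  by rewrite /abel big1// => i _; rewrite mxE normr0 oppr0 expR0.
have cabel (t : n.-tuple R) : (fun k => abel (eps k *: cvec t)) @ \oo --> (1 : R).
  by have := @cvg_eps_scale (@abel R n) (cvec t) (@continuous_abel 0); rewrite abel0.
pose F1 k (t : n.-tuple R) : R[i] := fourier g (cvec t) * (abel (eps k *: cvec t))%:C.
pose F2 k (t : n.-tuple R) : R[i] := g (eps k *: cvec t) * (poisson (cvec t))%:C.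
pose G2 (t : n.-tuple R) : R[i] := g 0 * (poisson (cvec t))%:C.
have mF1 k : Cmeasurable (F1 k).
  apply: CmeasurableM; first exact: schwartz_measurable.
  by apply: (Vmeasurable_comp mabel); apply: vmeasurableZ; exact: vmeasurable_cvec.
have ReMr (z : R[i]) (r : R) : complex.Re (z * r%:C) = complex.Re z * r.
  by rewrite ReM /= mulr0 subr0.
have ImMr (z : R[i]) (r : R) : complex.Im (z * r%:C) = complex.Im z * r.
  by rewrite ImM /= mulr0 add0r.
have R1 t : (fun k => complex.Re (F1 k t)) @ \oo --> complex.Re (fourier g (cvec t)).
  rewrite -[X in _ --> X]mulr1 /F1; under eq_fun do rewrite ReMr.
  exact: (cvgM (cvg_cst _) (cabel t)).
have I1 t : (fun k => complex.Im (F1 k t)) @ \oo --> complex.Im (fourier g (cvec t)).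
  rewrite -[X in _ --> X]mulr1 /F1; under eq_fun do rewrite ImMr.
  exact: (cvgM (cvg_cst _) (cabel t)).
have B1 k t : norm1c (F1 k t) <= norm1c (fourier g (cvec t)).
  by rewrite /F1 mulrC norm1cMr ger0_norm ?abel_ge0// ler_piMl ?norm1c_ge0// abel_le1.
have [L1 L2] := Cdominated mF1 R1 I1 (integrable_norm1c iF) B1.
have ip := integrable_poisson R n.
have mp : measurable_fun setT (fun t : n.-tuple R => poisson (cvec t)).
  by apply/measurable_EFinP; exact: (measurable_int mu).
have mF2 k : Cmeasurable (F2 k).
  apply: CmeasurableM; last exact: Cmeasurable_real.
  apply: (Vmeasurable_comp (schwartz_measurable sg)); apply: vmeasurableZ.
  exact: vmeasurable_cvec.
have R2 t : (fun k => complex.Re (F2 k t)) @ \oo --> complex.Re (G2 t).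
  rewrite /F2 /G2 ReMr; under eq_fun do rewrite ReMr.
  apply: cvgM; last exact: cvg_cst.
  exact: (@cvg_eps_scale (fun x => complex.Re (g x)) (cvec t) (cg1 0)).
have I2 t : (fun k => complex.Im (F2 k t)) @ \oo --> complex.Im (G2 t).
  rewrite /F2 /G2 ImMr; under eq_fun do rewrite ImMr.
  apply: cvgM; last exact: cvg_cst.
  exact: (@cvg_eps_scale (fun x => complex.Im (g x)) (cvec t) (cg2 0)).
have iMp : mu.-integrable setT (EFin \o (fun t => M * poisson (cvec t))).
  by apply: eq_integrable (integrableZl _ M ip).
have B2 k t : norm1c (F2 k t) <= M * poisson (cvec t).
  by rewrite /F2 mulrC norm1cMr ger0_norm ?poisson_ge0// mulrC ler_wpM2r ?poisson_ge0.
have [L3 L4] := Cdominated mF2 R2 I2 iMp B2.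
have E k : Cintegral mu (F1 k) = Cintegral mu (F2 k).
  exact: fourier_abel_dilate (eps_gt0 k) sg.
have E0 : Cintegral mu G2 = g 0.
  rewrite CintegralZ; last by split => //=; apply: eq_integrable (integrable0 mu setT).
  by rewrite Cintegral_real integral_poisson_tuple mulr1.
move: L1 L2; under eq_fun do rewrite E; move=> L1.
under eq_fun do rewrite E; move=> L2.
rewrite -[RHS]E0; apply: complex_ext.
  exact: (cvg_unique _ L1 L3).
exact: (cvg_unique _ L2 L4).
Qed.

Lemma fourier_translate g y xi : Vintegrable g ->
  fourier (fun x => g (x + y)) xi = expi (- (tau * dotv y xi)) * fourier g xi.
Proof.
move=> ig; rewrite -intRnZ; last exact: Vintegrable_modulation.
rewrite -[RHS](intRn_translate y); last first.
  by apply: VintegrableZ; exact: Vintegrable_modulation.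
apply: eq_intRn => x; rewrite dotvDl (mulrDr tau) expiD.
rewrite [RHS](_ : _ = expi (- (tau * dotv y xi)) * expi (tau * dotv y xi) *
   (g (x + y) * expi (tau * dotv x xi))); last by ring.
by rewrite -expiD addNr expi0 mul1r.
Qed.

Lemma fourier_inversion g y : schwartz g ->
  intRn (fun xi => fourier g xi * expi (- (tau * dotv y xi))) = g y.
Proof.
move=> sg; have := fourier_inversion0 (schwartz_scale y (oner_neq0 R) sg).
rewrite scaler0 add0r => <-; apply: eq_intRn => xi.
have -> : (fun x => g (1 *: x + y)) = (fun x => g (x + y)).
  by apply/funext => x; rewrite scale1r.
by rewrite (fourier_translate _ _ (schwartz_integrable sg)) mulrC.
Qed.

Lemma intRn_conj f : Vintegrable f -> intRn (fun x => conjc (f x)) = conjc (intRn f).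
Proof. exact: Cintegral_conj. Qed.

(** The conjugate of the transform of [b] has the conjugate of [b] as transform, by
    inversion; the multiplication formula moves the transform from one factor to
    the other. *)
Theorem parseval a b : schwartz a -> schwartz b ->
  intRn (fun xi => fourier a xi * conjc (fourier b xi)) =
  intRn (fun x => a x * conjc (b x)).
Proof.
move=> sa sb; have sFb := schwartz_fourier sb.
rewrite (fourier_multiplication (schwartz_integrable sa)); last first.
  exact: schwartz_integrable (schwartz_conj sFb).
apply: eq_intRn => x; congr (_ * _).
rewrite -[in RHS](fourier_inversion x sb) -intRn_conj; last first.
  have := Vintegrable_modulation (- tau) x (schwartz_integrable sFb).
  by congr Vintegrable; apply/funext => xi; rewrite dotvC mulNr.
apply: eq_intRn => xi; rewrite rmorphM; congr (_ * _).
by rewrite -[RHS]/(conjc (expi _)) expiN conjcK dotvC.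
Qed.

End FourierInversion.

(** * The cross-Wigner transform *)

Section CrossWigner.
Context (R : realType) (n : nat).
Implicit Types (f g h : 'cV[R]_n -> R[i]) (x y xi eta : 'cV[R]_n).
Local Notation tau := (- (2 * pi : R)).
Local Notation mu := (lebesgue_tuple R n).
Local Notation half := (2^-1 : R).

Lemma conjcMr (r : R) (z : R[i]) : conjc (r%:C * z) = r%:C * conjc z.
Proof.
by apply: complex_ext; rewrite ?Re_conjc ?Im_conjc !(ReM, ImM) ?Re_conjc ?Im_conjc /=;
  ring.
Qed.

Definition correlation f g x y : R[i] := f (x + half *: y) * conjc (g (x - half *: y)).

(** The Wigner transform is a Fourier transform of the correlation, at a fixed
    centre; the polarised form is what multiplication by coordinates requires. *)
Definition cross_wigner f g x xi : R[i] := fourier (correlation f g x) xi.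

Lemma wignerE f x xi : wigner f (col_mx x xi) = cross_wigner f f x xi.
Proof.
rewrite /wigner col_mxKu col_mxKd; apply: eq_intRn => y.
by rewrite [dotv y xi]dotvC mulNr.
Qed.

Let half0 : half != 0. Proof. by rewrite invr_eq0 pnatr_eq0. Qed.
Let Nhalf0 : - half != 0. Proof. by rewrite oppr_eq0. Qed.

Lemma schwartz_correlation f g x : schwartz f -> schwartz g ->
  schwartz (correlation f g x).
Proof.
move=> sf sg.
have := schwartzM (schwartz_scale x half0 sf)
  (schwartz_conj (schwartz_scale x Nhalf0 sg)).
by congr schwartz; apply/funext => y; rewrite /correlation !(addrC x) scaleNr.
Qed.

(** Inversion at the origin, where the correlation is the squared modulus. *)
Lemma cross_wigner_marginal f x : schwartz f ->
  Vintegrable (cross_wigner f f x) /\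
  intRn (cross_wigner f f x) = `|f x| ^+ 2.
Proof.
move=> sf; have sc := schwartz_correlation x sf sf; split.
  exact: schwartz_integrable (schwartz_fourier sc).
by rewrite fourier_inversion0// /correlation !scaler0 addr0 subr0 sqr_normc.
Qed.

(** The centre [x] is the mean of the two points [x + y / 2] and [x - y / 2]. *)
Lemma cross_wigner_coord f g i x xi : schwartz f -> schwartz g ->
  (x i 0)%:C * cross_wigner f g x xi =
  half%:C * cross_wigner (fun y => (y i 0)%:C * f y) g x xi +
  half%:C * cross_wigner f (fun y => (y i 0)%:C * g y) x xi.
Proof.
move=> sf sg; have sfi := schwartz_coord i sf; have sgi := schwartz_coord i sg.
have I a b : schwartz a -> schwartz b ->
    Vintegrable (fun y => correlation a b x y * expi (tau * dotv y xi)).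
  move=> sa sb; apply: Vintegrable_modulation; apply: schwartz_integrable.
  exact: schwartz_correlation.
rewrite /cross_wigner /fourier -!intRnZ; try exact: I.
rewrite -intRnD; try by apply: VintegrableZ; exact: I.
apply: eq_intRn => y; rewrite /correlation conjcMr !mxE.
set a := f _; set b := conjc _; set e := expi _.
have -> : (x i 0)%:C = half%:C * (x i 0 + half * y i 0)%:C +
    half%:C * (x i 0 - half * y i 0)%:C :> R[i].
  by rewrite -!rmorphM -rmorphD; congr (_%:C); field.
by ring.
Qed.

(** A frequency factor is a derivative of the correlation in [y], in which the two
    arguments move in opposite directions, whence the sign of the second term. *)
Lemma cross_wigner_freq f g i x xi : schwartz f -> schwartz g ->
  - (tau * xi i 0) *i * cross_wigner f g x xi =
  half%:C * cross_wigner (pderiv i f) g x xi +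
  (- half)%:C * cross_wigner f (pderiv i g) x xi.
Proof.
move=> sf sg; have sfi := schwartz_pderiv i sf; have sgi := schwartz_pderiv i sg.
have I a b : schwartz a -> schwartz b ->
    Vintegrable (fun y => correlation a b x y * expi (tau * dotv y xi)).
  move=> sa sb; apply: Vintegrable_modulation; apply: schwartz_integrable.
  exact: schwartz_correlation.
rewrite /cross_wigner -fourier_pderiv; last exact: schwartz_correlation.
rewrite /fourier -!intRnZ; try exact: I.
rewrite -intRnD; try by apply: VintegrableZ; exact: I.
apply: eq_intRn => y.
have Dc (c : R) a : schwartz a -> cderive (fun y => a (c *: y + x)) (delta_mx i 0) y
    (c%:C * pderiv i a (c *: y + x)).
  move=> sa; have := cderive_affine c%:M x i y sa.
  rewrite (bigD1 i)//= big1 => [|j ji]; last first.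
    by rewrite mxE (negPf ji) mulr0n mul0r.
  rewrite mxE eqxx mulr1n addr0 mul_scalar_mx.
  by congr cderive; apply/funext => z; rewrite mul_scalar_mx.
have -> : pderiv i (correlation f g x) y =
    f (half *: y + x) * conjc ((- half)%:C * pderiv i g (- half *: y + x)) +
    conjc (g (- half *: y + x)) * (half%:C * pderiv i f (half *: y + x)).
  apply: pderiv_unique.
  have -> : correlation f g x =
      (fun y => f (half *: y + x) * conjc (g (- half *: y + x))).
    by apply/funext => z; rewrite /correlation !(addrC x) scaleNr.
  by apply: cderiveM; [exact: Dc | apply: cderive_conj; exact: Dc].
rewrite /correlation !(addrC x) -!(scaleNr half y) conjcMr.
by ring.
Qed.

Lemma Cmeasurable_cross_wigner d (T : measurableType d) f g (h1 h2 : T -> 'cV[R]_n) :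
  Vmeasurable f -> Vmeasurable g -> vmeasurable h1 -> vmeasurable h2 ->
  Cmeasurable (fun t => cross_wigner f g (h1 t) (h2 t)).
Proof.
move=> mf mg m1 m2.
have m1' : vmeasurable (fun p : T * n.-tuple R => h1 p.1).
  by move=> i; exact: (measurableT_comp (m1 i)).
have m2' : vmeasurable (fun p : T * n.-tuple R => h2 p.1).
  by move=> i; exact: (measurableT_comp (m2 i)).
have m3 : vmeasurable (fun p : T * n.-tuple R => cvec p.2).
  by move=> i; exact: (measurableT_comp (vmeasurable_cvec i)).
pose F (p : T * n.-tuple R) : R[i] := correlation f g (h1 p.1) (cvec p.2) *
  expi (tau * dotv (cvec p.2) (h2 p.1)).
have mF : Cmeasurable F.
  apply: CmeasurableM; last first.
    by apply: Cmeasurable_expi; apply: measurable_funM => //; exact: measurable_dotv.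
  apply: CmeasurableM.
    by apply: (Vmeasurable_comp mf); apply: vmeasurableD => //; exact: vmeasurableZ.
  apply: Cmeasurable_conj; apply: (Vmeasurable_comp mg); apply: vmeasurableD => //.
  by apply: vmeasurableN; exact: vmeasurableZ.
exact: (Cmeasurable_Cintegral mu mF).
Qed.

(** One factor of the correlation is bounded and the integral of the other one does
    not depend on the centre, by an affine change of variables. *)
Lemma cross_wigner_bounded f g : schwartz f -> schwartz g ->
  exists M : R, forall x xi, norm1c (cross_wigner f g x xi) <= M.
Proof.
move=> sf sg; have [M hM] := schwartz_bounded sf.
pose G y : R[i] := (norm1c (g y))%:C.
have iG : Vintegrable G.
  split => /=; last by apply: eq_integrable (integrable0 mu setT).
  exact: integrable_norm1c (schwartz_integrable sg).
have uM := unitmx_scale n Nhalf0.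
exists (2 * M * complex.Re (`|\det ((- half)%:M : 'M[R]_n)|^-1%:C * intRn G)) => x xi.
have iGx := Vintegrable_affine x uM iG.
have -> : `|\det ((- half)%:M : 'M[R]_n)|^-1%:C * intRn G =
    intRn (fun y => G ((- half)%:M *m y + x)).
  rewrite (intRn_affine x uM iG) mulrA -rmorphM mulVf ?mul1r//.
  by rewrite gt_eqF// unitmx_det_gt0.
have sc := schwartz_correlation x sf sg.
have := @norm1c_intRn_le R n (fun y => correlation f g x y * expi (tau * dotv y xi))
  (fun y => G ((- half)%:M *m y + x)) (2 * M).
move=> /(_ (Vintegrable_modulation tau xi (schwartz_integrable sc)) iGx).
have h y : norm1c (correlation f g x y * expi (tau * dotv y xi)) <=
    2 * M * norm1c (G ((- half)%:M *m y + x)).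
  apply: le_trans (norm1cM _ _) _; rewrite mulrC -mulrA.
  apply: ler_pM; rewrite ?norm1c_ge0 ?norm1c_expi//.
  apply: le_trans (norm1cM _ _) _; apply: ler_pM; rewrite ?norm1c_ge0//.
  rewrite norm1c_conj /G norm1c_real ger0_norm ?norm1c_ge0//.
  by rewrite mul_scalar_mx scaleNr addrC.
move=> /(_ h); congr (_ <= _ * _); apply: eq_Rintegral => t _ /=.
by rewrite norm1c_real ger0_norm ?norm1c_ge0.
Qed.

(** The finite sums of cross-Wigner transforms are stable under multiplication by
    position and frequency coordinates: multiplying by the former multiplies
    both arguments by coordinates, multiplying by the latter differentiates
    them. Boundedness of each then gives decay faster than any polynomial. *)
Inductive wigner_span : ('cV[R]_n -> 'cV[R]_n -> R[i]) -> Prop :=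
| wigner_span_cross f g F : schwartz f -> schwartz g ->
    (forall x xi, F x xi = cross_wigner f g x xi) -> wigner_span F
| wigner_span_lin (c d : R[i]) F1 F2 F : wigner_span F1 -> wigner_span F2 ->
    (forall x xi, F x xi = c * F1 x xi + d * F2 x xi) -> wigner_span F.

Lemma wigner_span_bounded F : wigner_span F ->
  exists M : R, forall x xi, norm1c (F x xi) <= M.
Proof.
elim=> [f g F' sf sg E|c d F1 F2 F' _ [M1 h1] _ [M2 h2] E].
  have [M hM] := cross_wigner_bounded sf sg.
  by exists M => x xi; rewrite E.
exists (norm1c c * M1 + norm1c d * M2) => x xi; rewrite E.
apply: le_trans (norm1cD _ _) _; apply: lerD; apply: le_trans (norm1cM _ _) _;
  by rewrite ler_wpM2l ?norm1c_ge0.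
Qed.

Lemma wigner_span_coord F i : wigner_span F ->
  wigner_span (fun x xi => (x i 0)%:C * F x xi).
Proof.
elim=> [f g F' sf sg E|c d F1 F2 F' _ K1 _ K2 E]; last first.
  by apply: (wigner_span_lin (c := c) (d := d) K1 K2) => x xi; rewrite E; ring.
have K1 := wigner_span_cross (schwartz_coord i sf) sg (fun _ _ => erefl).
have K2 := wigner_span_cross sf (schwartz_coord i sg) (fun _ _ => erefl).
by apply: (wigner_span_lin K1 K2) => x xi; rewrite E cross_wigner_coord.
Qed.

Lemma wigner_span_freq F i : wigner_span F ->
  wigner_span (fun x xi => (xi i 0)%:C * F x xi).
Proof.
elim=> [f g F' sf sg E|c d F1 F2 F' _ K1 _ K2 E]; last first.
  by apply: (wigner_span_lin (c := c) (d := d) K1 K2) => x xi; rewrite E; ring.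
have K1 := wigner_span_cross (schwartz_pderiv i sf) sg (fun _ _ => erefl).
have K2 := wigner_span_cross sf (schwartz_pderiv i sg) (fun _ _ => erefl).
have t0 : tau != 0 by rewrite oppr_eq0 mulf_neq0 ?pnatr_eq0// gt_eqF// pi_gt0.
apply: (wigner_span_lin (c := (tau^-1 *i) * half%:C)
  (d := (tau^-1 *i) * (- half)%:C) K1 K2) => x xi.
rewrite E -!mulrA -mulrDr -cross_wigner_freq// mulrA; congr (_ * _).
move: t0; generalize tau => t t0.
by apply: complex_ext; rewrite ?ReM ?ImM /=; field; exact: t0.
Qed.

Lemma cross_wigner_weight f g alpha : schwartz f -> schwartz g ->
  exists M : R, forall x xi,
    norm1c ((mpow x alpha)%:C * cross_wigner f g x xi) <= M * (weight x * weight xi).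
Proof.
move=> sf sg; pose p x : R := \prod_i (1 + x i 0 ^+ 2).
have K0 : wigner_span (cross_wigner f g) by exact: (wigner_span_cross sf sg).
have K1 : wigner_span (fun x xi => (mpow x alpha)%:C * cross_wigner f g x xi).
  have KXn k i F : wigner_span F -> wigner_span (fun x xi => (x i 0 ^+ k)%:C * F x xi).
    move=> KF; elim: k => [|k /(wigner_span_coord i)].
      by move: KF; congr wigner_span; apply/funext => x; apply/funext => xi; rewrite expr0 mul1r.
    congr wigner_span; apply/funext => x; apply/funext => xi.
    by rewrite exprS rmorphM mulrA.
  rewrite /mpow; elim: (index_enum _) => [|i s /(KXn (alpha i) i)].
    move: K0; congr wigner_span; apply/funext => x; apply/funext => xi.
    by rewrite big_nil mul1r.
  congr wigner_span; apply/funext => x; apply/funext => xi.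
  by rewrite big_cons rmorphM mulrA.
have K2 : wigner_span (fun x xi => (p x)%:C * ((mpow x alpha)%:C * cross_wigner f g x xi)).
  rewrite /p; elim: (index_enum _) => [|i s ih].
    move: K1; congr wigner_span; apply/funext => x; apply/funext => xi.
    by rewrite big_nil mul1r.
  apply: (wigner_span_lin (c := 1) (d := 1) ih
    (wigner_span_coord i (wigner_span_coord i ih))) => x xi.
  by rewrite big_cons !rmorphM rmorphD rmorphXn /= rmorph1; ring.
have : wigner_span (fun x xi => (p xi)%:C *
    ((p x)%:C * ((mpow x alpha)%:C * cross_wigner f g x xi))).
  rewrite {1}/p; elim: (index_enum _) => [|i s ih].
    move: K2; congr wigner_span; apply/funext => x; apply/funext => xi.
    by rewrite big_nil mul1r.
  apply: (wigner_span_lin (c := 1) (d := 1) ih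
    (wigner_span_freq i (wigner_span_freq i ih))) => x xi.
  by rewrite big_cons !rmorphM rmorphD rmorphXn /= rmorph1; ring.
move=> /wigner_span_bounded [M h]; exists M => x xi.
have p0 y : 0 < p y by apply: prodr_gt0 => i _; rewrite ltr_pwDl// sqr_ge0.
have := h x xi; rewrite norm1cMr [norm1c ((p x)%:C * _)]norm1cMr !gtr0_norm//.
rewrite /weight !prodfV -/(p x) -/(p xi) -invfM ler_pdivlMr ?mulr_gt0//.
by rewrite mulrA mulrC [p xi * p x]mulrC.
Qed.

End CrossWigner.

(** * Symplectic covariance of the Wigner transform *)

Section Covariance.
Context (R : realType) (n : nat).
Implicit Types (f g h : 'cV[R]_n -> R[i]) (x y xi eta : 'cV[R]_n) (L N : 'M[R]_n).
Local Notation tau := (- (2 * pi : R)).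
Local Notation half := (2^-1 : R).

Lemma conjcM (z w : R[i]) : conjc (z * w) = conjc z * conjc w.
Proof. exact: rmorphM. Qed.

Lemma dotv_mulmx N x y : dotv x (N *m y) = dotv (N^T *m x) y.
Proof. by rewrite /dotv trmx_mul trmxK mulmxA. Qed.

Lemma dotvNl x y : dotv (- x) y = - dotv x y.
Proof. by rewrite -scaleN1r dotvZl mulN1r. Qed.

Lemma dotvNr x y : dotv x (- y) = - dotv x y.
Proof. by rewrite -scaleN1r dotvZr mulN1r. Qed.

Lemma wigner_phase (k : R[i]) f x xi : schwartz f ->
  cross_wigner (fun y => k * f y) (fun y => k * f y) x xi =
  k * conjc k * cross_wigner f f x xi.
Proof.
move=> sf; rewrite /cross_wigner /fourier -intRnZ.
  by apply: eq_intRn => y; rewrite /correlation conjcM; ring.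
apply: Vintegrable_modulation; apply: schwartz_integrable.
exact: schwartz_correlation.
Qed.

(** Polarising a quadratic phase leaves only its cross term, a modulation. *)
Lemma wigner_chirp L f x xi : L^T = L ->
  cross_wigner (fun y => expi (pi * dotv y (L *m y)) * f y)
    (fun y => expi (pi * dotv y (L *m y)) * f y) x xi =
  cross_wigner f f x (xi - L *m x).
Proof.
move=> symL; apply: eq_intRn => y; rewrite /correlation conjcM -expiN.
set a := f _; set b := conjc (f _).
rewrite [LHS](_ : _ = a * b * (expi (pi * dotv (x + half *: y) (L *m (x + half *: y))) *
   expi (- (pi * dotv (x - half *: y) (L *m (x - half *: y)))) *
   expi (tau * dotv y xi))); last by ring.
rewrite -!expiD; congr (_ * expi _).
rewrite !(mulmxDr, mulmxN) -!scalemxAr !(dotvDl, dotvDr, dotvNl, dotvNr, dotvZl, dotvZr).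
have -> : dotv x (L *m y) = dotv y (L *m x) by rewrite dotv_mulmx symL dotvC.
by field.
Qed.

(** The frequency transforms by the contragredient of [N]; writing it as the transpose
    applied to an arbitrary [eta] avoids an inverse. *)
Lemma wigner_linear N f x eta : N \in unitmx -> schwartz f ->
  cross_wigner f f (N *m x) eta =
  `|\det N|%:C * cross_wigner (fun y => f (N *m y)) (fun y => f (N *m y)) x (N^T *m eta).
Proof.
move=> uN sf; rewrite /cross_wigner /fourier (intRn_affine 0 uN); last first.
  apply: Vintegrable_modulation; apply: schwartz_integrable.
  exact: schwartz_correlation.
congr (_ * _); apply: eq_intRn => y; rewrite addr0 /correlation.
by rewrite !(mulmxDr, mulmxN) -!scalemxAr [dotv y _]dotv_mulmx trmxK.
Qed.

(** A substitution [y = 2 u] turns both factors into Fourier transforms in [u],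
    of a modulated translate of [g] and of a modulated reflection of [g];
    Parseval's identity removes the transforms. *)
Lemma wigner_fourier g x xi : schwartz g ->
  cross_wigner (fourier g) (fourier g) x xi = cross_wigner g g (- xi) x.
Proof.
move=> sg; have sF := schwartz_fourier sg.
have two0 : (2 : R) != 0 by rewrite pnatr_eq0.
have N10 : (-1 : R) != 0 by rewrite oppr_eq0 oner_neq0.
have i1 := Vintegrable_modulation tau xi
  (schwartz_integrable (schwartz_correlation x sF sF)).
have i2 := Vintegrable_modulation tau x
  (schwartz_integrable (schwartz_correlation (- xi) sg sg)).
rewrite /cross_wigner {1}/fourier [RHS]/fourier (intRn_scale two0 i1) (intRn_scale two0 i2).
congr (_ * _).
have half2 y : half *: (2 *: y) = y by rewrite scalerA mulVf// scale1r.
pose a t : R[i] := g (1 *: t + - (2 *: xi)) * expi (tau * dotv (t - 2 *: xi) x).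
pose b t : R[i] := g (-1 *: t + 0) * expi (- tau * dotv t x).
have sa : schwartz a.
  have := schwartzZ (expi (- (tau * dotv (2 *: xi) x)))
    (schwartz_mod tau x (schwartz_scale (- (2 *: xi)) (oner_neq0 R) sg)).
  congr schwartz; apply/funext => t; rewrite /a dotvDl dotvNl (mulrDr tau) expiD (mulrN tau); ring.
have sb : schwartz b by exact: schwartz_mod (schwartz_scale 0 N10 sg).
have Fa u : fourier a u = fourier g (x + u) * expi (tau * dotv (2 *: u) xi).
  rewrite mulrC /fourier -intRnZ; last first.
    by apply: Vintegrable_modulation; exact: schwartz_integrable.
  rewrite -[RHS](intRn_translate (- (2 *: xi))); last first.
    by apply: VintegrableZ; apply: Vintegrable_modulation; exact: schwartz_integrable.
  apply: eq_intRn => t; rewrite /a scale1r.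
  rewrite [RHS](_ : _ = g (t - 2 *: xi) * (expi (tau * dotv (2 *: u) xi) *
     expi (tau * dotv (t - 2 *: xi) (x + u)))); last by ring.
  rewrite -mulrA -!expiD; congr (_ * expi _).
  rewrite !(dotvDl, dotvDr, dotvNl, dotvNr, dotvZl, dotvZr) (dotvC u xi); ring.
have Fb u : fourier b u = fourier g (x - u).
  have i3 : Vintegrable (fun t => g t * expi (tau * dotv t (x - u))).
    by apply: Vintegrable_modulation; exact: schwartz_integrable.
  rewrite /fourier (intRn_scale N10 i3) normrN1 expr1n mul1r.
  apply: eq_intRn => t; rewrite /b addr0 -mulrA -expiD; congr (_ * expi _).
  by rewrite !(dotvDl, dotvDr, dotvNl, dotvNr, dotvZl, dotvZr); ring.
transitivity (intRn (fun u => fourier a u * conjc (fourier b u))).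
  apply: eq_intRn => u; rewrite /correlation half2 Fa Fb; ring.
rewrite parseval//.
have sab := schwartzM sa (schwartz_conj sb).
rewrite -(intRn_translate xi (schwartz_integrable sab)).
apply: eq_intRn => t; rewrite /correlation half2 /a /b scale1r scaleN1r addr0.
have -> : t + xi + - (2 *: xi) = - xi + t.
  by rewrite scaler_nat mulr2n opprD !addrA addrK addrC.
rewrite opprD [- t - xi]addrC conjcM -expiN.
set c := conjc (g _).
rewrite [LHS](_ : _ = g (- xi + t) * c * (expi (tau * dotv (- xi + t) x) *
  expi (- (- tau * dotv (t + xi) x)))); last by ring.
rewrite -expiD; congr (_ * expi _).
rewrite !(dotvDl, dotvDr, dotvNl, dotvNr, dotvZl, dotvZr); ring.
Qed.

End Covariance.

Section SymplecticBlocks.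
Context (R : realType) (n : nat).
Implicit Types S : 'M[R]_(n + n).
Local Notation J := (Jmx R n).

Lemma JmxJ : J *m J = - 1%:M.
Proof.
rewrite (scalar_mx_block n n 1) opp_block_mx !oppr0 /Jmx mulmx_block.
by congr block_mx; rewrite !(mul0mx, mulmx0, mul1mx, mulmx1, addr0, add0r).
Qed.

Lemma det_Jmx : \det J = 1.
Proof.
have -> : J = block_mx 1%:M 1%:M 0 1%:M *m
    (block_mx 1%:M 0 (- 1%:M) 1%:M *m block_mx 1%:M 1%:M 0 1%:M).
  have -> : block_mx 1%:M 0 (- 1%:M) 1%:M *m block_mx 1%:M 1%:M 0 1%:M =
      block_mx 1%:M 1%:M (- 1%:M) 0 :> 'M[R]_(n + n).
    rewrite mulmx_block.
    by congr block_mx; rewrite !(mul0mx, mulmx0, mul1mx, mulmx1, addr0, add0r, addNr).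
  rewrite mulmx_block.
  by congr block_mx; rewrite !(mul0mx, mulmx0, mul1mx, mulmx1, addr0, add0r, addrN).
by rewrite !det_mulmx !det_ublock det_lblock !det1 !mulr1.
Qed.

(** The first two relations are blocks of [S^T J S = J]; the last one is a block of
    [S J S^T = J], the transpose of a symplectic matrix being symplectic. *)
Lemma symplectic_blocks S : symplectic S ->
  [/\ (blkB S)^T *m blkD S = (blkD S)^T *m blkB S,
      (blkD S)^T *m blkA S - (blkB S)^T *m blkC S = 1%:M &
      blkA S *m (blkB S)^T = blkB S *m (blkA S)^T].
Proof.
rewrite /symplectic => hS.
have hST : S *m J *m S^T = J.
  have h1 : (- (J *m S^T *m J)) *m S = 1%:M.
    by rewrite mulNmx -!mulmxA (mulmxA S^T) hS JmxJ opprK.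
  have h2 := mulmx1C h1.
  have h3 : S *m J *m S^T *m J = - 1%:M.
    by rewrite -h2 mulmxN opprK !mulmxA.
  have := congr1 (mulmx^~ (- J)) h3.
  by rewrite -mulmxA mulmxN JmxJ opprK mulmx1 mulNmx mulmxN mul1mx opprK.
move: hS hST; rewrite -(submxK S).
rewrite /blkA /blkB /blkC /blkD !block_mxKul !block_mxKur !block_mxKdl !block_mxKdr.
set A := ulsubmx S; set B := ursubmx S; set C := dlsubmx S; set D := drsubmx S.
rewrite /Jmx !tr_block_mx !mulmx_block.
rewrite !(mulmx0, mulmxN, mulmx1, addr0, add0r, mulNmx).
move=> /eq_block_mx[_ _ e1 e2] /eq_block_mx[e3 _ _ _]; split.
- by move/eqP : e2; rewrite addrC subr_eq0 => /eqP.
- by have := congr1 -%R e1; rewrite opprD !opprK.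
- by move/eqP : e3; rewrite addrC subr_eq0 => /eqP.
Qed.

Lemma symplectic_det S : symplectic S -> `|\det S| = 1.
Proof.
move=> /(congr1 determinant); rewrite !det_mulmx det_tr det_Jmx mulr1 => h.
have : `|\det S| ^+ 2 = 1 by rewrite expr2 -normrM h normr1.
by move/eqP; rewrite sqrf_eq1 => /orP[/eqP//|/eqP e]; have := normr_ge0 (\det S);
  rewrite e oppr_ge0 ler10.
Qed.

End SymplecticBlocks.

Section Metaplectic.
Context (R : realType) (n : nat).
Implicit Types (S : 'M[R]_(n + n)) (f : 'cV[R]_n -> R[i]).
Local Notation operator := (('cV[R]_n -> R[i]) -> 'cV[R]_n -> R[i]).

(** What the marginals use of a metaplectic operator projecting onto [S]; unlike
    the integral formula of the free case, it is stable under composition. *)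
Definition covariant S (T : operator) := forall f, schwartz f ->
  schwartz (T f) /\ forall z, wigner (T f) (S *m z) = wigner f z.

Lemma covariant_comp S1 S2 (T1 T2 T : operator) :
  covariant S1 T1 -> covariant S2 T2 ->
  (forall f, schwartz f -> forall xi, T f xi = T1 (T2 f) xi) ->
  covariant (S1 *m S2) T.
Proof.
move=> c1 c2 TE f sf; have [s2 w2] := c2 f sf; have [s1 w1] := c1 _ s2.
have -> : T f = T1 (T2 f) by apply/funext => xi; exact: TE.
by split=> // z; rewrite -mulmxA w1 w2.
Qed.

(** Of the constant in the integral formula only the modulus matters, as the Wigner
    transform is quadratic. *)
Lemma metaplectic_constant (c : R[i]) (d : R) : d != 0 ->
  c ^+ 2 = (Num.sg d)%:C * (- 'i%C) ^+ n -> c * conjc c = 1.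
Proof.
move=> d0 hc.
have nc : `|c| ^+ 2 = 1.
  rewrite -normrX hc normrM normrX normrN.
  have -> : `|'i%C : R[i]| = 1.
    by rewrite normc_def /= expr0n expr1n /= add0r sqrtr1.
  rewrite expr1n mulr1 normc_def /= expr0n addr0 sqrtr_sqr normr_sg d0.
  by [].
by rewrite -sqr_normc.
Qed.

(** The integral formula of the free case is a composition of a quadratic phase, the
    Fourier transform, a linear change of variables and a second quadratic phase; the
    four covariance identities, applied in turn at the point [S (u, v)], lead back to
    [(u, v)] because [D B^-1] and [B^-1 A] are symmetric. *)
Lemma free_covariant S (T : operator) :
  free_symplectic S -> metaplectic_free S T -> covariant S T.
Proof.
move=> [hS dB0] [c [hc TE]] f sf.
have uB : blkB S \in unitmx by rewrite unitmxE unitfE.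
have [BD DA AB] := symplectic_blocks hS.
set A := blkA S in DA AB TE *; set B := blkB S in BD DA AB TE uB dB0 hc *.
set C := blkC S in DA *; set D := blkD S in BD DA TE *.
pose N := invmx B; have uN : N \in unitmx by rewrite unitmx_inv.
pose L1 := N *m A; pose L2 := D *m N.
have symL1 : L1^T = L1.
  rewrite /L1 trmx_mul /N trmx_inv.
  apply: (can_inj (mulKmx uB)); rewrite mulKVmx//.
  have uBT : B^T \in unitmx by rewrite unitmx_tr.
  by apply: (can_inj (mulmxK uBT)); rewrite mulmxA -AB mulmxKV.
have symL2 : L2^T = L2.
  rewrite /L2 trmx_mul /N trmx_inv.
  have uBT : B^T \in unitmx by rewrite unitmx_tr.
  apply: (can_inj (mulKmx uBT)); rewrite mulKVmx// mulmxA BD.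
  by rewrite mulmxK.
pose h y : R[i] := expi (pi * dotv y (L1 *m y)) * f y.
pose k : R[i] := c / (Num.sqrt `|\det B|)%:C.
pose G y : R[i] := fourier h (N *m y).
have TfE : T f = fun y => k * (expi (pi * dotv y (L2 *m y)) * G y).
  apply/funext => y; rewrite TE// /quad_fourier -/A -/B -/D -/N -/L1 -/L2.
  rewrite -/k; congr (_ * _).
  have sh : schwartz h.
    have := schwartz_chirp (pi *: L1) 0 sf; congr schwartz; apply/funext => z.
    by rewrite /h /quadratic -scalemxAl dotvZr {2}/dotv trmx0 mul0mx mxE addr0.
  rewrite /G /fourier -intRnZ; last first.
    by apply: Vintegrable_modulation; exact: schwartz_integrable.
  apply: eq_intRn => z; rewrite /h.
  rewrite [RHS](_ : _ = f z * (expi (pi * dotv y (L2 *m y)) *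
    expi (pi * dotv z (L1 *m z)) * expi (- (2 * pi) * dotv z (N *m y)))); last by ring.
  by rewrite -!expiD mulrDr mulNr.
have sh : schwartz h.
  have := schwartz_chirp (pi *: L1) 0 sf; congr schwartz; apply/funext => z.
  by rewrite /h /quadratic -scalemxAl dotvZr {2}/dotv trmx0 mul0mx mxE addr0.
have sF := schwartz_fourier sh.
have sG : schwartz G by exact: schwartz_linmap.
have sH : schwartz (fun y => expi (pi * dotv y (L2 *m y)) * G y).
  have := schwartz_chirp (pi *: L2) 0 sG; congr schwartz; apply/funext => z.
  by rewrite /quadratic -scalemxAl dotvZr {2}/dotv trmx0 mul0mx mxE addr0.
split; first by rewrite TfE; exact: schwartzZ.
have kk : k * conjc k = (`|\det N|)%:C.
  have b0 : 0 < `|\det B| by rewrite normr_gt0.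
  have s0 : Num.sqrt `|\det B| != 0 by rewrite gt_eqF// sqrtr_gt0.
  rewrite /k conjcM mulrACA (metaplectic_constant dB0 hc) mul1r.
  rewrite -fmorphV conjc_real -rmorphM -expr2 exprVn sqr_sqrtr ?ltW//.
  by rewrite det_inv normfV.
move=> z; rewrite -[z]vsubmxK; set u := usubmx z; set v := dsubmx z.
pose x := A *m u + B *m v; pose xi := C *m u + D *m v.
have -> : S *m col_mx u v = col_mx x xi.
  by rewrite -[S in LHS]submxK mul_block_col.
rewrite !wignerE TfE wigner_phase// kk wigner_chirp//.
pose eta := B^T *m (xi - L2 *m x).
have etaE : N^T *m eta = xi - L2 *m x by rewrite /eta mulmxA -trmx_mul mulmxV// trmx1 mul1mx.
rewrite -etaE -wigner_linear// wigner_fourier// wigner_chirp//.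
have Nx : N *m x = L1 *m u + v by rewrite /x mulmxDr mulmxA mulKmx.
have etau : eta = - u.
  rewrite /eta /xi /L2 -mulmxA Nx mulmxBr !mulmxDr !mulmxA BD.
  rewrite mulmxK//.
  by rewrite opprD addrACA subrr addr0 -mulmxBl -opprB DA mulNmx mul1mx.
by rewrite etau opprK Nx addrAC subrr add0r.
Qed.

Lemma metaplectic_covariant S (T : operator) : metaplectic S T -> covariant S T.
Proof.
move=> [[fS mS]|[S1 [S2 [T1 [T2 [[f1 m1] [f2 m2] -> TE]]]]]].
  exact: free_covariant.
exact: covariant_comp (free_covariant f1 m1) (free_covariant f2 m2) TE.
Qed.

End Metaplectic.

(** * Marginals of the theta-Wigner function *)

Section Marginals.
Context (R : realType) (n : nat).
Implicit Types (f g : 'cV[R]_n -> R[i]) (x y xi : 'cV[R]_n).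
Local Notation mu := (lebesgue_tuple R n).

(** The inner integral is that of [weight] composed with an affine map of the second
    variable: it is a constant multiple of the first factor. *)
Lemma integrable_weight_sheared (P Q : 'M[R]_n) : Q \in unitmx ->
  (mu \x mu)%E.-integrable setT
    (EFin \o (fun p => weight (cvec p.1) * weight (P *m cvec p.1 + Q *m cvec p.2))).
Proof.
move=> uQ.
have iw := integrable_weight R n.
have mw : measurable_fun setT (fun t : n.-tuple R => weight (cvec t)).
  by apply/measurable_EFinP; exact: (measurable_int mu).
have m1 : vmeasurable (fun p : n.-tuple R * n.-tuple R => cvec p.1).
  by move=> i; exact: (measurableT_comp (vmeasurable_cvec i)).
have m2 : vmeasurable (fun p : n.-tuple R * n.-tuple R => cvec p.2).
  by move=> i; exact: (measurableT_comp (vmeasurable_cvec i)).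
have mv : measurable_fun setT (fun p : n.-tuple R * n.-tuple R =>
    weight (P *m cvec p.1 + Q *m cvec p.2)).
  have := measurableT_comp mw
    (measurable_vtup (vmeasurableD (vmeasurableM P m1) (vmeasurableM Q m2))).
  by apply: eq_measurable_fun => p _ /=; rewrite vtupK.
apply/integrable12ltyP.
  apply/measurable_EFinP; apply: measurable_funM => //.
  exact: (measurableT_comp mw).
have W0 : (0 <= \int[mu]_t (weight (cvec t))%:E)%E.
  by apply: integral_ge0 => t _; rewrite lee_fin ltW// weight_gt0.
have Wfin : (\int[mu]_t (weight (cvec t))%:E)%E \is a fin_num.
  exact: (integrable_fin_num measurableT iw).
have d0 := unitmx_det_gt0 uQ.
pose c : R := `|\det Q|^-1 * fine (\int[mu]_t (weight (cvec t))%:E)%E.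
have E (x : n.-tuple R) : (\int[mu]_y `|(weight (cvec x) * weight (P *m cvec x + Q *m cvec y))%:E| =
    c%:E * (weight (cvec x))%:E)%E.
  under eq_integral => y _.
    rewrite gee0_abs; last by rewrite lee_fin mulr_ge0// ltW// weight_gt0.
    rewrite EFinM; over.
  rewrite ge0_integralZl//; last 3 first.
  - by apply/measurable_EFinP; exact: (measurableT_comp mv (measurable_pair1 x)).
  - by move=> y _; rewrite lee_fin ltW// weight_gt0.
  - by rewrite lee_fin ltW// weight_gt0.
  rewrite muleC; congr (_ * _)%E; rewrite /c EFinM fineK//.
  rewrite (ge0_integral_affine_tuple (P *m cvec x) uQ); last 2 first.
  - by apply/measurable_EFinP.
  - by move=> y; rewrite lee_fin ltW// weight_gt0.
  rewrite muleA -EFinM mulVf ?mul1e ?gt_eqF//.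
  by apply: eq_integral => y _; rewrite vtupK addrC.
under eq_integral do rewrite /= E.
rewrite integralZl//; apply: lte_mul_pinfty.
- by rewrite lee_fin mulr_ge0 ?invr_ge0// fine_ge0.
- by [].
- exact: (integrable_lty measurableT iw).
Qed.

(** The fibre [x = const] of the sheared Wigner transform is an affine image of the
    frequency fibre, whose integral is the position marginal. *)
Lemma sheared_marginal g x (b : 'cV[R]_n) (Q : 'M[R]_n) : Q \in unitmx -> schwartz g ->
  has_intRn (fun xi => `|\det Q|%:C * cross_wigner g g x (b + Q *m xi)) (`|g x| ^+ 2).
Proof.
move=> uQ sg; have [i e] := cross_wigner_marginal x sg.
have E : (fun xi => cross_wigner g g x (Q *m xi + b)) =
    (fun xi => cross_wigner g g x (b + Q *m xi)).
  by apply/funext => xi; rewrite (addrC b).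
have i' := Vintegrable_affine b uQ i; rewrite E in i'.
split; first exact: (VintegrableZ _ i').
transitivity (`|\det Q|%:C * intRn (fun xi => cross_wigner g g x (b + Q *m xi))).
  exact: (intRnZ _ i').
by rewrite -e -E; apply/esym; exact: (intRn_affine b uQ i).
Qed.

Lemma sheared_moment g alpha (P Q : 'M[R]_n) : Q \in unitmx -> schwartz g ->
  has_intRnRn (fun x xi => (mpow x alpha)%:C *
      (`|\det Q|%:C * cross_wigner g g x (P *m x + Q *m xi)))
    (intRn (fun x => (mpow x alpha)%:C * `|g x| ^+ 2)).
Proof.
move=> uQ sg; have mg := schwartz_measurable sg.
have [M hM] := cross_wigner_weight alpha sg sg.
have m1 : vmeasurable (fun p : n.-tuple R * n.-tuple R => cvec p.1).
  by move=> i; exact: (measurableT_comp (vmeasurable_cvec i)).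
have m2 : vmeasurable (fun p : n.-tuple R * n.-tuple R => cvec p.2).
  by move=> i; exact: (measurableT_comp (vmeasurable_cvec i)).
have mm : measurable_fun setT (fun p : n.-tuple R * n.-tuple R => mpow (cvec p.1) alpha).
  rewrite /mpow; elim: (index_enum _) => [|i s ih].
    by under eq_fun do rewrite big_nil; exact: measurable_cst.
  under eq_fun do rewrite big_cons; apply: measurable_funM ih.
  exact: measurable_funX (m1 i).
have iF : Cintegrable (mu \x mu)%E (fun p => (mpow (cvec p.1) alpha)%:C *
    (`|\det Q|%:C * cross_wigner g g (cvec p.1) (P *m cvec p.1 + Q *m cvec p.2))).
  apply: (@Cintegrable_dominated _ _ _ _ _ (fun p => `|\det Q| * M *
     (weight (cvec p.1) * weight (P *m cvec p.1 + Q *m cvec p.2)))).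
  - apply: CmeasurableM; first exact: Cmeasurable_real.
    apply: CmeasurableM; first exact: Cmeasurable_cst.
    apply: Cmeasurable_cross_wigner => //.
    by apply: vmeasurableD; exact: vmeasurableM.
  - by apply: eq_integrable (integrableZl _ _ (integrable_weight_sheared P uQ)).
  - move=> p; rewrite mulrCA norm1cMr normr_id -mulrA.
    by rewrite ler_wpM2l.
split=> //; rewrite Cintegral12//; congr Cintegral; apply/funext => t /=.
have [i e] := sheared_marginal (cvec t) (P *m cvec t) uQ sg.
by rewrite (CintegralZ _ i) e.
Qed.

End Marginals.

Section ThetaWigner.
Context (R : realType) (n : nat).
Implicit Types (f : 'cV[R]_n -> R[i]) (x xi : 'cV[R]_n) (S D : 'M[R]_(n + n)).
Local Notation operator := (('cV[R]_n -> R[i]) -> 'cV[R]_n -> R[i]).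

Lemma sqrt_det_Omega D : Num.sqrt (\det (Omega D)) = `|\det D|.
Proof. by rewrite /Omega !det_mulmx det_tr det_Jmx mulr1 -expr2 sqrtr_sqr. Qed.

Lemma wigner_theta_covariant S D (T : operator) f z : covariant S T -> schwartz f ->
  wigner_theta D f z = (`|\det D|^-1)%:C * wigner (T f) (S *m invmx D *m z).
Proof.
move=> cT sf; rewrite /wigner_theta sqrt_det_Omega -mulmxA.
by have [_ ->] := cT f sf.
Qed.

(** The sign of this determinant depends on [n]; for the absolute value it suffices
    that the matrix is an involution. *)
Lemma norm_det_swap : `|\det (block_mx 0 1%:M 1%:M 0 : 'M[R]_(n + n))| = 1.
Proof.
set X := block_mx _ _ _ _.
have XX : X *m X = 1%:M.
  rewrite (scalar_mx_block n n 1) /X mulmx_block.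
  by congr block_mx; rewrite !(mul0mx, mulmx0, mul1mx, mulmx1, addr0, add0r).
have : `|\det X| ^+ 2 = 1 by rewrite -normrX expr2 -det_mulmx XX det1 normr1.
move/eqP; rewrite sqrf_eq1 => /orP[/eqP//|/eqP e].
by have := normr_ge0 (\det X); rewrite e oppr_ge0 ler10.
Qed.

Lemma det_block_antitriangular (P Q : 'M[R]_n) :
  `|\det (block_mx 0 1%:M P Q)| = `|\det P|.
Proof.
have -> : block_mx 0 1%:M P Q =
    block_mx 1%:M 0 Q P *m block_mx 0 1%:M 1%:M 0 :> 'M[R]_(n + n).
  rewrite mulmx_block.
  by congr block_mx; rewrite !(mul0mx, mulmx0, mul1mx, mulmx1, addr0, add0r).
by rewrite det_mulmx normrM norm_det_swap mulr1 det_lblock det1 mul1r.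
Qed.

(** The first rows of [S1] are those of [D], so that in the coordinates
    [(x, xi) = D w] the vector [S1 w] has first component [x]. *)
Lemma theta_shear_left S1 S2 : symplectic S1 -> D12 S1 S2 \in unitmx ->
  exists P Q : 'M[R]_n,
    [/\ S1 *m invmx (D12 S1 S2) = block_mx 1%:M 0 P Q, Q \in unitmx &
        `|\det Q| = `|\det (D12 S1 S2)|^-1].
Proof.
move=> hS1 uD; set D := D12 S1 S2 in uD *; set E := S1 *m invmx D.
have uE : usubmx E = row_mx 1%:M 0.
  rewrite /E -mul_usub_mx (_ : usubmx S1 = usubmx D); last first.
    by rewrite /D /D12 block_mxEv col_mxKu /blkA /blkB /ulsubmx /ursubmx hsubmxK.
  by rewrite mul_usub_mx mulmxV// (scalar_mx_block n n 1) block_mxEv col_mxKu.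
have EE : E = block_mx 1%:M 0 (dlsubmx E) (drsubmx E).
  by rewrite block_mxEv -uE /dlsubmx /drsubmx hsubmxK vsubmxK.
have detE : `|\det E| = `|\det D|^-1.
  by rewrite /E det_mulmx det_inv normrM normfV (symplectic_det hS1) mul1r.
have dQ : `|\det (drsubmx E)| = `|\det D|^-1.
  by rewrite -detE [in RHS]EE det_lblock det1 mul1r.
exists (dlsubmx E), (drsubmx E); split=> //.
by rewrite unitmxE unitfE -normr_gt0 dQ invr_gt0 unitmx_det_gt0.
Qed.

(** The last rows of [D12 S1 S2] are the first ones of [S2], so here the roles of
    position and frequency are exchanged. *)
Lemma theta_shear_right S1 S2 : symplectic S2 -> D12 S1 S2 \in unitmx ->
  exists P Q : 'M[R]_n,
    [/\ S2 *m invmx (D12 S1 S2) = block_mx 0 1%:M P Q, P \in unitmx &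
        `|\det P| = `|\det (D12 S1 S2)|^-1].
Proof.
move=> hS2 uD; set D := D12 S1 S2 in uD *; set E := S2 *m invmx D.
have uE : usubmx E = row_mx 0 1%:M.
  rewrite /E -mul_usub_mx (_ : usubmx S2 = dsubmx D); last first.
    by rewrite /D /D12 block_mxEv col_mxKd /blkA /blkB /ulsubmx /ursubmx hsubmxK.
  by rewrite mul_dsub_mx mulmxV// (scalar_mx_block n n 1) block_mxEv col_mxKd.
have EE : E = block_mx 0 1%:M (dlsubmx E) (drsubmx E).
  by rewrite block_mxEv -uE /dlsubmx /drsubmx hsubmxK vsubmxK.
have detE : `|\det E| = `|\det D|^-1.
  by rewrite /E det_mulmx det_inv normrM normfV (symplectic_det hS2) mul1r.
have dP : `|\det (dlsubmx E)| = `|\det D|^-1.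
  by rewrite -detE [in RHS]EE det_block_antitriangular.
exists (dlsubmx E), (drsubmx E); split=> //.
by rewrite unitmxE unitfE -normr_gt0 dP invr_gt0 unitmx_det_gt0.
Qed.

End ThetaWigner.

Theorem theorem12 (R : realType) (n : nat) (n_gt0 : (0 < n)%N)
    (S1 S2 : 'M[R]_(n + n))
    (hS1 : symplectic S1) (hS2 : symplectic S2)
    (hD : D12 S1 S2 \in unitmx)
    (T1 T2 : ('cV[R]_n -> R[i]) -> 'cV[R]_n -> R[i])
    (hT1 : metaplectic S1 T1) (hT2 : metaplectic S2 T2)
    (f : 'cV[R]_n -> R[i]) (hf : schwartz f) :
  let W := fun x xi : 'cV[R]_n => wigner_theta (D12 S1 S2) f (col_mx x xi) in
  [/\ forall alpha : 'I_n -> nat, (0 < msize alpha)%N ->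
        has_intRnRn (fun x xi => (mpow x alpha)%:C * W x xi)
          (intRn (fun x => (mpow x alpha)%:C * `|T1 f x| ^+ 2)),
      forall alpha : 'I_n -> nat, (0 < msize alpha)%N ->
        has_intRnRn (fun x xi => (mpow xi alpha)%:C * W x xi)
          (intRn (fun xi => (mpow xi alpha)%:C * `|T2 f xi| ^+ 2)),
      forall x : 'cV[R]_n, has_intRn (fun xi => W x xi) (`|T1 f x| ^+ 2) &
      forall xi : 'cV[R]_n, has_intRn (fun x => W x xi) (`|T2 f xi| ^+ 2)].
Proof.
move=> W.
have c1 := metaplectic_covariant hT1; have c2 := metaplectic_covariant hT2.
have [s1 _] := c1 f hf; have [s2 _] := c2 f hf.
have [P1 [Q1 [E1 uQ1 d1]]] := theta_shear_left hS1 hD.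
have [P2 [Q2 [E2 uP2 d2]]] := theta_shear_right hS2 hD.
have W1 x xi : W x xi = `|\det Q1|%:C *
    cross_wigner (T1 f) (T1 f) x (P1 *m x + Q1 *m xi).
  rewrite /W (wigner_theta_covariant _ _ c1 hf) E1 d1 mul_block_col.
  by rewrite mul1mx mul0mx addr0 wignerE.
have W2 x xi : W x xi = `|\det P2|%:C *
    cross_wigner (T2 f) (T2 f) xi (Q2 *m xi + P2 *m x).
  rewrite /W (wigner_theta_covariant _ _ c2 hf) E2 d2 mul_block_col.
  by rewrite mul1mx mul0mx add0r wignerE [_ + Q2 *m _]addrC.
split.
- move=> alpha _; have := sheared_moment alpha P1 uQ1 s1.
  by congr has_intRnRn; apply/funext => x; apply/funext => xi; rewrite W1.
- move=> alpha _; have [i e] := sheared_moment alpha Q2 uP2 s2.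
  pose F (p : n.-tuple R * n.-tuple R) := (mpow (cvec p.2) alpha)%:C * W (cvec p.1) (cvec p.2).
  have FE : F = (fun p => (mpow (cvec p.2) alpha)%:C * (`|\det P2|%:C *
      cross_wigner (T2 f) (T2 f) (cvec p.2) (Q2 *m cvec p.2 + P2 *m cvec p.1))).
    by apply/funext => p; rewrite /F W2.
  split; first by rewrite -/F FE; exact: (Cintegrable_swap i).
  by rewrite -/F FE -e; exact: (Cintegral_swap i).
- move=> x; have := sheared_marginal x (P1 *m x) uQ1 s1.
  by congr has_intRn; apply/funext => xi; rewrite W1.
- move=> xi; have := sheared_marginal xi (Q2 *m xi) uP2 s2.
  by congr has_intRn; apply/funext => x; rewrite W2.
Qed.
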